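(* Suppose that $(A_n,dk_n)\in\mathcal D$ ($n\ge 1$) and $(A,dk)\in\mathcal D$, and form the associated data $w_n,\gamma_n,F_n,\Omega_n,h_n$ and $w,\gamma,F,\Omega,h$. Then the following are equivalent: (a) $A_n\to A$ and $dk_n\to dk$ in weak-$*$ sense; (b) $w_n(z)\to w(z)$ locally uniformly on $\mathbb C^+$; (c) $\gamma_n(z)\to\gamma(z)$ locally uniformly on $\mathbb C^+$; (d) $F_n(\zeta)\to F(\zeta)$ locally uniformly on $D$; (e) $\Omega_n\to\Omega$ in the sense of kernel convergence; (f) $\sup\varphi h_n\to\sup\varphi h$ for every $\varphi\in C(S^1)$, $\varphi\ge 0$.
   Context: Notation: $\mathbb C^+$ is the open upper half plane, $D=\{|z|<1\}$, $D^+=D\cap\mathbb C^+$, $S^1=\partial D$, $D_r(z)$ is the open disk of radius $r$ about $z$. Suprema in (f) are over $S^1$. $\mathcal D$ is the set of pairs $(A,dk)$ with $A>0$ and $dk$ a Borel probability measure on $[-2,2]$ such that $-\ln A+\int_{[-2,2]}\ln|t-z|\,dk(t)\ge 0$ for all $z\in\mathbb C$. Data associated with $(A,dk)\in\mathcal D$: $w(z)=\ln A-\int_{[-2,2]}\ln(t-z)\,dk(t)$ for $z\in\mathbb C^+$, with $\mathrm{Im}\,\ln\zeta\in(-\pi,0)$ for $\zeta$ in the open lower half plane; $\gamma=-\mathrm{Re}\,w$; $F$ is the holomorphic extension to $D$ by reflection $F(\overline\zeta)=\overline{F(\zeta)}$ of $F(\zeta)=e^{w(-\zeta-1/\zeta)}$,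 $\zeta\in D^+$ (it is injective with image in $D$, and $F(0)=0$, $F'(0)=A$); $\Omega=F(D)$; and $h:S^1\to[0,1)$ is the unique upper semicontinuous function with $h(e^{-i\alpha})=h(e^{i\alpha})$ and $\Omega=\Omega_h:=\{re^{i\alpha}:0\le r<1-h(e^{i\alpha})\}$. Kernel convergence: $\Omega_n\to\Omega$ means that (i) if $z\in\Omega$, then there exist $r>0$ and $N$ so that $D_r(z)\subset\Omega_n$ for all $n\ge N$; (ii) if $z\notin\Omega$ and $r>0$, then there exists $N$ so that $D_r(z)$ is not contained in $\Omega_n$ for $n\ge N$. *)

(* Defs.v *)
From HB Require Import structures.
From mathcomp Require Import all_boot all_order all_algebra.
From mathcomp Require Export complex.
From mathcomp Require Import all_classical all_reals all_analysis.

Set Implicit Arguments.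
Unset Strict Implicit.
Unset Printing Implicit Defensive.

Import Order.TTheory GRing.Theory Num.Theory.
Import numFieldNormedType.Exports.
Import ComplexField.Normc.

Local Open Scope classical_set_scope.
Local Open Scope complex_scope.
Local Open Scope ring_scope.

(* The complex plane with its norm topology, as a normed module over itself.
   As usual, |z| lives in R[i], where x < y means that y - x is a positive
   real number; normc z is the same norm with values in R. *)
Notation Cplx R := ((R[i])^o) (only parsing).

Section complex_plane.
Variable R : realType.
Local Notation C := (Cplx R).

Definition upper_half : set C := [set z | 0 < complex.Im z].

Definition disk (z : C) (r : R) : set C := [set x | `|x - z| < r%:C].

Definition unit_disk : set C := disk 0 1.

Definition unit_disk_upper : set C := unit_disk `&` upper_half.

Definition unit_circle : set C := [set z | `|z| = 1].

Definition expi (a : R) : C := cos a +i* sin a.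

Definition cexp (z : C) : C := (expR (complex.Re z))%:C * expi (complex.Im z).

(* The logarithm on the open lower half plane whose imaginary part lies in
   ]-pi, 0[; see [cln_lowerP]. *)
Definition cln_lower (z : C) : C :=
  ln (normc z) +i* - acos (complex.Re z / normc z).

Definition holomorphic_on (U : set C) (f : C -> C) : Prop :=
  forall z, U z -> derivable f z 1.

Definition cvg_locally_uniformly (V : uniformType) (U : set C)
    (f_ : nat -> C -> V) (f : C -> V) : Prop :=
  forall z, U z ->
    exists2 W : set C, nbhs z W & {uniform W `&` U, f_ @ \oo --> f}.

Definition kernel_cvg (Omega_ : nat -> set C) (Omega : set C) : Prop :=
  (forall z, Omega z -> exists r N, 0 < r /\
     forall n, (N <= n)%N -> disk z r `<=` Omega_ n) /\
  (forall z r, ~ Omega z -> 0 < r -> exists N,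
     forall n, (N <= n)%N -> ~ (disk z r `<=` Omega_ n)).

Definition usc_on (S : set C) (h : C -> R) : Prop :=
  forall z, S z -> forall a, h z < a ->
    \forall y \near within S (nbhs z), h y < a.

Definition Omega_of (h : C -> R) : set C :=
  [set z | exists r a : R, 0 <= r < 1 - h (expi a) /\ z = r%:C * expi a].

End complex_plane.

Section associated_data.
Variable R : realType.
Local Notation C := (Cplx R).
Local Notation prob := (probability (measurableTypeR R) R).

Definition segment : set R := `[-2, 2]%classic.

(* A probability measure on [-2, 2] is a probability measure on R giving mass
   1 to [-2, 2].  The integral in the last clause is extended-real valued, with
   lne 0 = -oo, so that real points z in the support of dk are covered too. *)
Definition calD (A : R) (dk : prob) : Prop :=
  [/\ 0 < A,
      dk segment = 1%E &
      forall z : C,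
        (0 <= - (ln A)%:E +
              \int[dk]_(t in segment) lne (normc ((t : R)%:C - z))%:E)%E].

Definition weak_star_cvg (dk_ : nat -> prob) (dk : prob) : Prop :=
  forall f : R -> R, {within segment, continuous f} ->
    \int[dk_ n]_(t in segment) f t @[n --> \oo] -->
    \int[dk]_(t in segment) f t.

Definition cintegral (mu : prob) (D : set R) (f : R -> C) : C :=
  (\int[mu]_(t in D) complex.Re (f t)) +i*
  (\int[mu]_(t in D) complex.Im (f t)).

Definition w_of (A : R) (dk : prob) (z : C) : C :=
  (ln A)%:C - cintegral dk segment (fun t => cln_lower (t%:C - z)).

Definition gamma_of (A : R) (dk : prob) (z : C) : R :=
  - complex.Re (w_of A dk z).

(* These conditions determine F on the unit disk; its values elsewhere are
   never used. *)
Definition is_F (A : R) (dk : prob) (F : C -> C) : Prop :=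
  [/\ holomorphic_on (@unit_disk R) F,
      forall z, @unit_disk R z -> F (z^*)%C = ((F z)^*)%C &
      forall z, @unit_disk_upper R z -> F z = cexp (w_of A dk (- z - z^-1))].

(* Likewise, only the values of h on the unit circle matter. *)
Definition is_h (Omega : set C) (h : C -> R) : Prop :=
  [/\ forall z, @unit_circle R z -> 0 <= h z < 1,
      usc_on (@unit_circle R) h,
      forall a, h (expi (- a)) = h (expi a) &
      Omega = Omega_of h].

Definition sup_cvg (h_ : nat -> C -> R) (h : C -> R) : Prop :=
  forall phi : C -> R, {within @unit_circle R, continuous phi} ->
    (forall z, @unit_circle R z -> 0 <= phi z) ->
    sup [set phi z * h_ n z | z in @unit_circle R] @[n --> \oo] -->
    sup [set phi z * h z | z in @unit_circle R].

End associated_data.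

Section cln_lower.
Variable R : realType.

Lemma cln_lowerP (z : Cplx R) : complex.Im z < 0 ->
  - pi < complex.Im (cln_lower z) < 0 /\ cexp (cln_lower z) = z.
Proof.
case: z => x y /= y0; rewrite /cexp/= /cln_lower/=.
set n := Num.sqrt _.
have n2 : n ^+ 2 = x ^+ 2 + y ^+ 2 by rewrite sqr_sqrtr// addr_ge0 ?sqr_ge0.
have y2 : 0 < y ^+ 2 by rewrite exprn_even_gt0//= lt_eqF.
have n0 : 0 < n by rewrite sqrtr_gt0 ltr_wpDl ?sqr_ge0.
have nN0 : n != 0 by rewrite gt_eqF.
have : `|x / n| < 1.
  rewrite normrM normfV (gtr0_norm n0) ltr_pdivrMr// mul1r.
  rewrite -(@ltr_pXn2r _ 2)// ?nnegrE ?(ltW n0)//.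
  by rewrite real_normK ?num_real// n2 ltrDl.
rewrite ltr_norml => /andP[xn1 xn2].
have a0 : 0 < acos (x / n) by rewrite acos_gt0// (ltW xn1).
have api : acos (x / n) < pi by rewrite acos_ltpi// xn1 ltW.
split; first by rewrite ltrN2 api oppr_lt0.
have cE : cos (acos (x / n)) = x / n.
  by rewrite acosK// in_itv/= (ltW xn1) ltW.
have sE : sin (acos (x / n)) = - y / n.
  rewrite sin_acos ?(ltW xn1) ?(ltW xn2)//.
  have -> : 1 - (x / n) ^+ 2 = (- y / n) ^+ 2.
    rewrite !expr_div_n sqrrN n2; apply/eqP.
    rewrite subr_eq -mulrDl [X in X / _]addrC divff//.
    by rewrite -n2 expf_neq0.
  by rewrite sqrtr_sqr ger0_norm// divr_ge0 ?oppr_ge0 ?ltW.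
rewrite /expi cosN sinN cE sE lnK ?posrE//.
apply/eqP; rewrite eq_complex/= !mul0r subr0 addr0.
by rewrite mulNr opprK !(mulrC n) !mulfVK// !eqxx.
Qed.

End cln_lower.

(* Main.v *)
(* Put [zeta = e^s] and [t = - 2 cos x].  Then
     g s := log F (e^s) = ln A + \int (kappa (s + i x) + kappa (s - i x)) dk,
   where [kappa s = s / 2 - log (1 - e^s)].  Since [Re kappa'] is a Poisson kernel,
   [g] is a monotone map of the left half plane commuting with the translation by
   [2 pi i], and the rays going left from points of its image stay in the image,
   whose exponential is Omega minus the origin.

   Convergence of the data gives convergence of [g_n], hence (b), (c) and (d).
   Conversely, the values of [Re g_n] on the negative real axis determine in the
   limit [A] and the moments of [dk], through the expansion at [-oo], and
   polynomials are dense.  If [g_n] converges pointwise to [g], monotonicity makes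
   points of the image of [g] interior to the images of [g_n], and the maximum
   principle in an annulus prevents the latter from covering a fixed disc about a
   point outside the former; this is (e).  If (e) holds, the data converge along
   every ultrafilter to data having the domain Omega, and the Schwarz lemma shows
   that Omega determines the data.

   Finally (e) and (f) both say that [h_n] converges to [h] in the following sense:
   [limsup h_n <= h] locally uniformly, and every value of [h] is approached by
   [h_n] at nearby points. *)
Require Import Defs.
From mathcomp Require Import all_boot all_order all_algebra.
From mathcomp Require Import ring lra.
From mathcomp Require Import all_classical all_reals all_analysis.
Import Order.TTheory GRing.Theory Num.Theory.
Import numFieldNormedType.Exports.
Import ComplexField.Normc.
Set Implicit Arguments.
Unset Strict Implicit.
Unset Printing Implicit Defensive.
Local Open Scope classical_set_scope.
Local Open Scope complex_scope.
Local Open Scope ring_scope.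

(** * Complex exponential and logarithm *)

Section complex_basics.
Variable R : realType.
Implicit Types (z w : R[i]) (x y : R).
Local Notation Re := (@complex.Re R).
Local Notation Im := (@complex.Im R).

(** Passing to [log F (e^s)] makes starlikeness quantitative: the real part of the scalar product of
    [s' - s] and [g s' - g s] is at least [c |s' - s|^2], where [c] depends only on a bound [v < 0]
    for the real parts and not on the data. With the Lipschitz bound of the same nature this makes
    the geometric estimates uniform in [n], so closeness of two maps at one or two points decides
    about whole discs in their images.

    Compactness in (e) is that of positive normalized functionals on continuous functions of the
    angle, not of measures. An ultrafilter limit of such functionals is again one, with no
    representation theorem and no extraction of subsequences; for this reason the theory of [g] is
    written for functionals, and only the last step identifies the limit with integration against
    [dk]. The other parameter [ln A_n] stays bounded because the images lie in the unit disc and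
    eventually contain a fixed disc about 0. *)

Lemma ReD z w : Re (z + w) = Re z + Re w. Proof. by case: z w => ? ? []. Qed.
Lemma ImD z w : Im (z + w) = Im z + Im w. Proof. by case: z w => ? ? []. Qed.
Lemma ReN z : Re (- z) = - Re z. Proof. by case: z. Qed.
Lemma ImN z : Im (- z) = - Im z. Proof. by case: z. Qed.
Lemma ReM z w : Re (z * w) = Re z * Re w - Im z * Im w.
Proof. by case: z w => ? ? []. Qed.
Lemma ImM z w : Im (z * w) = Re z * Im w + Im z * Re w.
Proof. by case: z w => ? ? []. Qed.
Lemma ReV z : Re z^-1 = Re z / (Re z ^+ 2 + Im z ^+ 2).
Proof. by case: z. Qed.
Lemma ImV z : Im z^-1 = - Im z / (Re z ^+ 2 + Im z ^+ 2).
Proof. by case: z => x y /=; rewrite mulNr. Qed.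
Lemma ReJ z : Re z^* = Re z. Proof. by case: z. Qed.
Lemma ImJ z : Im z^* = - Im z. Proof. by case: z. Qed.

Definition ReImE := (ReD, ImD, ReN, ImN, ReM, ImM).

Lemma complexP z w : Re z = Re w -> Im z = Im w -> z = w.
Proof. by case: z w => a b [c d] /= -> ->. Qed.

Lemma normc_ge0 z : 0 <= normc z.
Proof. by case: z => x y /=; exact: sqrtr_ge0. Qed.

Lemma normc_sqr z : normc z ^+ 2 = Re z ^+ 2 + Im z ^+ 2.
Proof. by case: z => x y /=; rewrite sqr_sqrtr// addr_ge0 ?sqr_ge0. Qed.

Lemma normc_gt0 z : (0 < normc z) = (z != 0).
Proof.
rewrite lt_def normc_ge0 andbT; congr negb; apply/eqP/eqP => [/eq0_normc//|->].
exact: normc0.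
Qed.

Lemma normr_Re z : `|Re z| <= normc z.
Proof.
rewrite -(@ler_pXn2r _ 2)// ?nnegrE ?normc_ge0// normc_sqr real_normK ?num_real//.
by rewrite lerDl sqr_ge0.
Qed.

Lemma normr_Im z : `|Im z| <= normc z.
Proof.
rewrite -(@ler_pXn2r _ 2)// ?nnegrE ?normc_ge0// normc_sqr real_normK ?num_real//.
by rewrite lerDr sqr_ge0.
Qed.

Lemma Re_le_normc z : Re z <= normc z.
Proof. exact: le_trans (ler_norm _) (normr_Re z). Qed.

Lemma normc_le_ReIm z : normc z <= `|Re z| + `|Im z|.
Proof.
rewrite -(@ler_pXn2r _ 2)// ?nnegrE ?normc_ge0 ?addr_ge0// normc_sqr sqrrD.
rewrite !real_normK ?num_real// addrAC lerDl mulrn_wge0// mulr_ge0//.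
Qed.

Lemma normc_real x : normc (x%:C) = `|x|.
Proof. by rewrite /= expr0n/= addr0 sqrtr_sqr. Qed.

Lemma normc_imag x : normc (0 +i* x) = `|x|.
Proof. by rewrite /= expr0n/= add0r sqrtr_sqr. Qed.

Lemma normcJ z : normc z^* = normc z.
Proof. by case: z => x y /=; rewrite sqrrN. Qed.

Lemma normcX z n : normc (z ^+ n) = normc z ^+ n.
Proof. by elim: n => [|n IH]; rewrite ?expr0 ?normc1// !exprS normcM IH. Qed.

Lemma normcBC z w : normc (z - w) = normc (w - z).
Proof. by rewrite -normcN opprB. Qed.

Lemma normcB z w : normc (z - w) <= normc z + normc w.
Proof. by rewrite -(normcN w); exact: le_normcD. Qed.

Lemma lerB_normc z w : normc z - normc w <= normc (z - w).
Proof.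
by rewrite lerBlDr; apply: le_trans (le_normcD _ _); rewrite subrK.
Qed.

Lemma lerB_normcD z w : normc z - normc w <= normc (z + w).
Proof. by rewrite -[w]opprK normcN; exact: lerB_normc. Qed.

Lemma normc_dist w z t : normc (z - t) <= normc (z - w) + normc (w - t).
Proof. by apply: le_trans (le_normcD _ _); rewrite addrA subrK. Qed.

Lemma normc_half z : normc (z / 2) = normc z / 2.
Proof.
rewrite normcM; congr (_ * _).
have -> : (2^-1 : R[i]) = (2^-1 : R)%:C by rewrite (fmorphV (real_complex R)) rmorph_nat.
by rewrite normc_real ger0_norm.
Qed.

Lemma real_complexV x : (x^-1)%:C = (x%:C)^-1.
Proof. exact: (fmorphV (real_complex R)). Qed.

Lemma real_complexM x y : (x * y)%:C = x%:C * y%:C.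
Proof. exact: (rmorphM (real_complex R)). Qed.

Lemma real_complexD x y : (x + y)%:C = x%:C + y%:C.
Proof. exact: (rmorphD (real_complex R)). Qed.

Lemma real_complexB x y : (x - y)%:C = x%:C - y%:C.
Proof. exact: (rmorphB (real_complex R)). Qed.

Lemma real_complex_nat n : (n%:R)%:C = n%:R :> R[i].
Proof. exact: (rmorph_nat (real_complex R)). Qed.

Lemma ReZ x z : Re (x%:C * z) = x * Re z.
Proof. by rewrite ReM/= mul0r subr0. Qed.

Lemma ImZ x z : Im (x%:C * z) = x * Im z.
Proof. by rewrite ImM/= mul0r addr0. Qed.

Lemma Re_half z : Re (z / 2) = Re z / 2.
Proof. by rewrite mulrC -(real_complex_nat 2) -real_complexV ReZ mulrC. Qed.

Lemma Im_half z : Im (z / 2) = Im z / 2.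
Proof. by rewrite mulrC -(real_complex_nat 2) -real_complexV ImZ mulrC. Qed.

Lemma mulcJ z : z^* * z = (normc z ^+ 2)%:C.
Proof. by apply: complexP; rewrite !ReImE ReJ ImJ normc_sqr/=; ring. Qed.

Lemma ReJM z w : Re (z^* * w) = Re z * Re w + Im z * Im w.
Proof. by rewrite !ReImE ReJ ImJ; ring. Qed.

Lemma normc_expi x : normc (expi x) = 1 :> R.
Proof. by rewrite /= cos2Dsin2 sqrtr1. Qed.

Lemma normc_cexp z : normc (cexp z) = expR (Re z).
Proof. by rewrite /cexp normcM normc_real normc_expi mulr1 ger0_norm ?expR_ge0. Qed.

Lemma Re_cexp z : Re (cexp z) = expR (Re z) * cos (Im z).
Proof. by rewrite /cexp ReZ. Qed.

Lemma Im_cexp z : Im (cexp z) = expR (Re z) * sin (Im z).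
Proof. by rewrite /cexp ImZ. Qed.

Lemma cexpD z w : cexp (z + w) = cexp z * cexp w :> R[i].
Proof.
apply: complexP; rewrite !(Re_cexp, Im_cexp, ReImE) expRD ?cosD ?sinD; ring.
Qed.

Lemma cexp0 : cexp 0 = 1 :> R[i].
Proof. by apply: complexP; rewrite ?Re_cexp ?Im_cexp/= expR0 mul1r ?cos0 ?sin0. Qed.

Lemma cexp_neq0 z : cexp z != 0 :> R[i].
Proof. by rewrite -normc_gt0 normc_cexp expR_gt0. Qed.

Lemma cexpN z : cexp (- z) = (cexp z)^-1 :> R[i].
Proof.
apply: (mulfI (cexp_neq0 z)); rewrite -cexpD subrr cexp0 divff//; exact: cexp_neq0.
Qed.

Lemma cexpJ z : cexp z^* = (cexp z)^* :> R[i].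
Proof. by apply: complexP; rewrite ?ReJ ?ImJ ?Re_cexp ?Im_cexp ?ReJ ?ImJ ?cosN ?sinN ?mulrN. Qed.

Lemma cexp_real x : cexp x%:C = (expR x)%:C :> R[i].
Proof. by apply: complexP; rewrite ?Re_cexp ?Im_cexp/= ?cos0 ?sin0 ?mulr1 ?mulr0. Qed.

Lemma cexp_imag x : cexp (0 +i* x) = expi x :> R[i].
Proof. by apply: complexP; rewrite ?Re_cexp ?Im_cexp/= expR0 mul1r. Qed.

Lemma sin_eq0_lt_pi x : `|x| < pi -> sin x = 0 -> x = 0.
Proof.
move=> xpi s0; apply/eqP; case: (ltgtP x 0) => // x0.
- have /sin_gt0_pi : 0 < - x < pi by rewrite oppr_gt0 x0 -(ltr0_norm x0).
  by rewrite sinN s0 oppr0 ltxx.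
- have /sin_gt0_pi : 0 < x < pi by rewrite x0 -(gtr0_norm x0).
  by rewrite s0 ltxx.
Qed.

Lemma cos_eq1_lt_2pi x : `|x| < 2 * pi -> cos x = 1 -> x = 0.
Proof.
move=> xpi c1.
have : 1 - cos x = sin (x / 2) ^+ 2 *+ 2.
  have {1}-> : x = (x / 2) *+ 2 by rewrite mulr2n; field.
  by rewrite cos_mulr2n cos2sin2 !mulr2n; ring.
rewrite c1 subrr => /esym/eqP; rewrite mulrn_eq0/= sqrf_eq0 => /eqP s0.
have : x / 2 = 0.
  apply: sin_eq0_lt_pi s0; rewrite normrM [X in _ * X]ger0_norm//.
  by rewrite ltr_pdivrMr// mulrC.
by move/eqP; rewrite mulf_eq0 invr_eq0 pnatr_eq0 orbF => /eqP.
Qed.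

(** This is the tool for identifying branches: two logarithms of the same number agree as soon as
    their arguments are known to be less than a full turn apart. *)
Lemma cexp_inj_strip z w : `|Im z - Im w| < 2 * pi -> cexp z = cexp w -> z = w.
Proof.
move=> zw e.
have e1 : cexp (z - w) = 1 by rewrite cexpD cexpN e divff// cexp_neq0.
have r0 : Re (z - w) = 0.
  by apply: expR_inj; rewrite -normc_cexp e1 normc1 expR0.
have : Re (cexp (z - w)) = 1 by rewrite e1.
rewrite Re_cexp r0 expR0 mul1r => c1.
have i0 : Im (z - w) = 0 by apply: cos_eq1_lt_2pi c1; rewrite !ReImE.
by apply/eqP; rewrite -subr_eq0; apply/eqP; apply: complexP.
Qed.

End complex_basics.

(** * Derivatives of complex-valued functions of a real variable *)

Section curves.
Variable R : realType.
Implicit Types (z w : R[i]) (x y t : R) (f g : R -> R[i]).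
Local Notation Re := (@complex.Re R).
Local Notation Im := (@complex.Im R).

(** Differentiability along a curve, by components, so that the real mean value theorem applies; all
    Taylor and Lipschitz bounds are obtained along segments. *)
Definition cderive f t d :=
  is_derive t 1 (fun x => Re (f x)) (Re d) /\
  is_derive t 1 (fun x => Im (f x)) (Im d).

Lemma is_derive_conv (u : R -> R) t d e : is_derive t 1 u d -> d = e -> is_derive t 1 u e.
Proof. by move=> ? <-. Qed.

Lemma cderiveD f g t d e : cderive f t d -> cderive g t e ->
  cderive (fun x => f x + g x) t (d + e).
Proof.
move=> [f1 f2] [g1 g2]; split.
- rewrite [X in is_derive _ _ X _](_ : _ = (fun x => Re (f x)) \+ (fun x => Re (g x))).
    by rewrite ReD; exact: is_deriveD.
  by apply/funext => x /=; rewrite ReD.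
- rewrite [X in is_derive _ _ X _](_ : _ = (fun x => Im (f x)) \+ (fun x => Im (g x))).
    by rewrite ImD; exact: is_deriveD.
  by apply/funext => x /=; rewrite ImD.
Qed.

Lemma is_derive_lin2 (u v : R -> R) t du dv (a b : R) :
  is_derive t 1 u du -> is_derive t 1 v dv ->
  is_derive t 1 (fun x => a * u x + b * v x) (a * du + b * dv).
Proof. by move=> hu hv; apply: is_deriveD; exact: is_deriveZ. Qed.

Lemma cderiveZ z f t d : cderive f t d -> cderive (fun x => z * f x) t (z * d).
Proof.
move=> [f1 f2]; split.
- rewrite [X in is_derive _ _ X _](_ : _ = fun x => Re z * Re (f x) + (- Im z) * Im (f x)).
    by rewrite ReM -mulNr; exact: is_derive_lin2.
  by apply/funext => x /=; rewrite ReM mulNr.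
- rewrite [X in is_derive _ _ X _](_ : _ = fun x => Re z * Im (f x) + Im z * Re (f x)).
    by rewrite ImM; exact: is_derive_lin2.
  by apply/funext => x /=; rewrite ImM.
Qed.

Lemma cderive_ZX w n t : cderive (fun x => (x ^+ n.+1)%:C * w) t ((n.+1%:R * t ^+ n)%:C * w).
Proof.
have [d1 d2] : cderive (fun x => (x ^+ n.+1)%:C) t ((n.+1%:R * t ^+ n)%:C).
  split; last exact: is_derive_cst.
  rewrite /=.
  have h := @is_deriveX R R id n.+1 t 1 1 (is_derive_id _ _).
  rewrite [X in is_derive _ _ X _](_ : _ = id ^+ n.+1); last by apply/funext => u; rewrite exprfctE.
  by apply: is_derive_conv h _; rewrite -[LHS]/(_ * 1) mulr1.
under [X in cderive X _ _]funext do rewrite mulrC.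
by rewrite mulrC; apply: cderiveZ.
Qed.

Lemma cderive_id w t : cderive (fun x => x%:C * w) t w.
Proof.
have := cderive_ZX w 0 t; rewrite expr0 mulr1 mul1r.
by under [X in cderive X _ _ -> _]funext do rewrite expr1.
Qed.

(* The derivative of [t |-> Re (conj k * f t)], with [k] the increment of [f],
   gives the sharp vector-valued mean value inequality. *)
Lemma cderive_scal f t d k : cderive f t d ->
  is_derive t 1 (fun x => Re (k^* * f x)) (Re (k^* * d)).
Proof. by move=> /(cderiveZ k^*) []. Qed.

Lemma mean_value (u du : R -> R) :
  (forall t, 0 <= t <= 1 -> is_derive t 1 u (du t)) ->
  exists2 t, 0 <= t <= 1 & u 1 - u 0 = du t.
Proof.
move=> h.
have [| |t] := @MVT_segment R u du 0 1 ler01.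
- by move=> x; rewrite in_itv/= => /andP[x0 x1]; apply: h; rewrite !ltW.
- by apply: derivable_within_continuous => x; rewrite in_itv/= => /h[].
- by rewrite in_itv/= => t01 ->; exists t => //; rewrite subr0 mulr1.
Qed.

Lemma cmean_value f (d : R -> R[i]) (M : R) :
  (forall t, 0 <= t <= 1 -> cderive f t (d t)) ->
  (forall t, 0 <= t <= 1 -> normc (d t) <= M) ->
  normc (f 1 - f 0) <= M.
Proof.
move=> fd dM; set k := f 1 - f 0.
have [t t01] := @mean_value (fun x => Re (k^* * f x)) (fun x => Re (k^* * d x))
  (fun t ht => cderive_scal k (fd t ht)).
rewrite -ReN -ReD -mulrN -mulrDr -/k mulcJ/= => e.
have [->|k0] := eqVneq k 0.
  by rewrite normc0; apply: le_trans (dM 0 _); rewrite ?normc_ge0// lexx ler01.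
rewrite -(@ler_pM2l _ (normc k)) ?normc_gt0// -expr2 e.
apply: le_trans (Re_le_normc _) _.
by rewrite normcM normcJ ler_wpM2l ?normc_ge0// dM.
Qed.

Lemma is_derive_scale (a t : R) : is_derive t 1 (fun x => a * x) a.
Proof.
have h := @is_deriveZ _ _ _ id a t 1 1 (is_derive_id _ _).
by apply: is_derive_conv h _; rewrite -[LHS]/(_ * 1) mulr1.
Qed.

Lemma is_derive_1D_scale (a t : R) : is_derive t 1 (fun x => 1 + a * x) a.
Proof.
by rewrite -[X in is_derive _ _ _ X]add0r; apply: is_deriveD; exact: is_derive_scale.
Qed.

Lemma cderive_cexp w t :
  cderive (fun x => cexp (x%:C * w)) t (w * cexp (t%:C * w)).
Proof.
have e1 : is_derive t 1 (fun x => expR (Re w * x)) (expR (Re w * t) * Re w).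
  exact: (@is_derive1_comp R expR (fun x => Re w * x) _ _ _ _ (is_derive_scale _ _)).
have l2 := is_derive_scale (Im w) t.
have e2 : is_derive t 1 (fun x => cos (Im w * x)) (- sin (Im w * t) * Im w).
  exact: (@is_derive1_comp R cos (fun x => Im w * x)).
have e3 : is_derive t 1 (fun x => sin (Im w * x)) (cos (Im w * t) * Im w).
  exact: (@is_derive1_comp R sin (fun x => Im w * x)).
split.
- rewrite [X in is_derive _ _ X _](_ : _ =
    (fun x => expR (Re w * x)) * (fun x => cos (Im w * x))); last first.
    by apply/funext => x; rewrite Re_cexp ReZ ImZ ![x * _]mulrC.
  have h := is_deriveM e1 e2.
  apply: is_derive_conv h _.
  rewrite ReM Re_cexp Im_cexp !ReZ !ImZ ![t * _]mulrC.
  rewrite -[LHS]/(_ * _ + _ * _); ring.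
- rewrite [X in is_derive _ _ X _](_ : _ =
    (fun x => expR (Re w * x)) * (fun x => sin (Im w * x))); last first.
    by apply/funext => x; rewrite Im_cexp ReZ ImZ ![x * _]mulrC.
  have h := is_deriveM e1 e3.
  apply: is_derive_conv h _.
  rewrite ImM Re_cexp Im_cexp !ReZ !ImZ ![t * _]mulrC.
  rewrite -[LHS]/(_ * _ + _ * _); ring.
Qed.

(** The principal branch, in the form valid on the right half plane. That half plane suffices:
    logarithms are taken of [1 - w] with [|w| < 1], or of points rotated into it. *)
Definition clog z : R[i] :=
  (ln (Re z ^+ 2 + Im z ^+ 2) / 2) +i* atan (Im z / Re z).

Lemma sqr_ReIm_gt0 z : 0 < Re z -> 0 < Re z ^+ 2 + Im z ^+ 2.
Proof. by move=> z0; rewrite ltr_wpDr ?sqr_ge0 ?exprn_gt0. Qed.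

Lemma Re_clog z : Re z != 0 \/ Im z != 0 -> Re (clog z) = ln (normc z).
Proof.
move=> z0; rewrite /clog/= -normc_sqr expr2 lnM ?posrE ?normc_gt0//; first lra.
all: by apply/eqP => z00; move: z0; rewrite z00/= eqxx => -[].
Qed.

Lemma Im_clog_lt z : `|Im (clog z)| < pi / 2.
Proof. by rewrite ltr_norml /= atan_gtNpi2 atan_ltpi2. Qed.

Lemma clogK z : 0 < Re z -> cexp (clog z) = z.
Proof.
move=> z0.
have zN0 : Re z != 0 by rewrite gt_eqF.
have nz : 0 < normc z.
  by rewrite normc_gt0; apply: contraTneq z0 => ->; rewrite ltxx.
have er : expR (Re (clog z)) = normc z by rewrite Re_clog ?lnK ?posrE//; left.
have ca : cos (atan (Im z / Re z)) = Re z / normc z.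
  rewrite cos_atan.
  have -> : 1 + (Im z / Re z) ^+ 2 = (normc z / Re z) ^+ 2.
    by rewrite !expr_div_n normc_sqr; field.
  by rewrite sqrtr_sqr ger0_norm ?divr_ge0 ?ltW// invf_div.
have cN0 : cos (atan (Im z / Re z)) != 0 by rewrite ca mulf_neq0// invr_eq0 gt_eqF.
have sa : sin (atan (Im z / Re z)) = Im z / normc z.
  have := atanK (Im z / Re z); rewrite /tan => /(congr1 (fun u => u * cos (atan (Im z / Re z)))).
  rewrite divfK// ca => ->; field; rewrite zN0 gt_eqF//.
by apply: complexP; rewrite ?Re_cexp ?Im_cexp er /= ?ca ?sa mulrC divfK// gt_eqF.
Qed.

(** With all three points in the right half plane the imaginary parts of the two sides differ by
    less than [3 pi / 2], so they lie on the same branch. *)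
Lemma clogM z w : 0 < Re z -> 0 < Re w -> 0 < Re (z * w) ->
  clog (z * w) = clog z + clog w.
Proof.
move=> z0 w0 zw0; apply: cexp_inj_strip; last by rewrite cexpD !clogK.
have := Im_clog_lt z; have := Im_clog_lt w; have := Im_clog_lt (z * w).
rewrite ImD !ltr_norml; have := pi_gt0 R; lra.
Qed.

Lemma clogJ z : clog z^* = (clog z)^*.
Proof. by apply: complexP => /=; rewrite ReJ ImJ ?sqrrN ?mulNr ?atanN. Qed.

Lemma cderive_clog1 w t : 0 < 1 + t * Re w ->
  cderive (fun x => clog (1 + x%:C * w)) t (w / (1 + t%:C * w)).
Proof.
move=> h.
set x := Re w in h *; set y := Im w.
have l1 := is_derive_1D_scale x t; have l2 := is_derive_scale y t.
have hx : 0 < 1 + x * t by rewrite mulrC.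
have n0 : 0 < (1 + x * t) ^+ 2 + (y * t) ^+ 2.
  by rewrite ltr_wpDr ?sqr_ge0 ?exprn_gt0.
split.
- rewrite [X in is_derive _ _ X _](_ : _ = fun u => 2^-1 *
     (@ln R \o (fun u : R => (1 + x * u) * (1 + x * u) + (y * u) * (y * u))) u); last first.
    apply/funext => u; rewrite /clog [LHS]/= [RHS]/= mulrC; congr (_ * ln _).
    by rewrite !ReImE/= -/x -/y; ring.
  have l3 : is_derive t 1 (fun u : R => (1 + x * u) * (1 + x * u) + (y * u) * (y * u))
      (2 * (x * (1 + x * t) + y * (y * t))).
    have h1 := is_deriveM l1 l1; have h2 := is_deriveM l2 l2.
    apply: is_derive_conv (is_deriveD h1 h2) _.
    rewrite -[LHS]/(((1 + x * t) * x + (1 + x * t) * x) + ((y * t) * y + (y * t) * y)).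
    ring.
  have l4 := @is_derive1_comp R (@ln R) _ t _ _ (is_derive1_ln _) l3.
  have {}l4 := is_deriveZ 2^-1 (l4 _).
  apply: is_derive_conv (l4 _) _; first by rewrite -!expr2.
  rewrite -[LHS]/(_ * (_ * _)) ReM ReV ImV !ReImE/= !mul0r !subr0 !addr0 -/x -/y !add0r.
  rewrite ![t * _]mulrC; clearbody x y; field.
  by rewrite gt_eqF// mulrC [t * y]mulrC.
- rewrite [X in is_derive _ _ X _](_ : _ =
     (@atan R \o (fun u : R => (y * u) * (1 + x * u)^-1))); last first.
    apply/funext => u; rewrite /clog [LHS]/= [RHS]/=; congr (atan (_ / _)).
      by rewrite !ReImE/= -/x -/y; ring.
    by rewrite !ReImE/= -/x -/y; ring.
  have l3 : is_derive t 1 (fun u : R => (y * u) * (1 + x * u)^-1) (y / (1 + x * t) ^+ 2).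
    have h0 : 1 + x * t != 0 by rewrite gt_eqF.
    have h1 := @is_deriveV R (fun u => 1 + x * u) t x 1 h0 l1.
    apply: is_derive_conv (is_deriveM l2 h1) _.
    rewrite -[LHS]/((y * t) * ((- (1 + x * t) ^- 2) * x) + (1 + x * t)^-1 * y).
    by field.
  have l4 := @is_derive1_comp R (@atan R) _ t _ _ (is_derive1_atan _) l3.
  apply: is_derive_conv l4 _.
  rewrite ImM ReV ImV !ReImE/= !mul0r !subr0 !addr0 -/x -/y !add0r ![t * _]mulrC.
  clearbody x y; field.
  by rewrite !gt_eqF//= ltr_wpDr ?sqr_ge0 ?exprn_gt0.
Qed.

End curves.

(** * Taylor bounds for the exponential, the logarithm and the kernel *)

Section taylor.
Variable R : realType.
Implicit Types (z w s h : R[i]) (x t u : R).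
Local Notation Re := (@complex.Re R).
Local Notation Im := (@complex.Im R).
Local Notation e1 := (expR 1 : R).

(* A second-order expansion is all that is needed of holomorphy: it gives the
   mean value inequality and the maximum principle [strip_max]. *)
Definition jet2 (f : R[i] -> R[i]) s a b := forall e : R, 0 < e ->
  exists2 d : R, 0 < d & forall h, normc h <= d ->
    normc (f (s + h) - f s - a * h - b * h ^+ 2) <= e * normc h ^+ 2.

Lemma e1_ge1 : 1 <= e1. Proof. by rewrite ltW// expR_gt1. Qed.

Lemma normc_ZR t w : 0 <= t -> normc (t%:C * w) = t * normc w.
Proof. by move=> t0; rewrite normcM normc_real ger0_norm. Qed.

Lemma normc_cexp_le w : normc w <= 1 -> normc (cexp w) <= e1.
Proof.
by move=> w1; rewrite normc_cexp ler_expR; apply: le_trans (Re_le_normc _) w1.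
Qed.

Lemma seg_scal t w (r : R) : 0 <= t <= 1 -> normc w <= r -> normc (t%:C * w) <= r.
Proof.
move=> /andP[t0 t1] wr; rewrite normc_ZR//.
by apply: le_trans wr; rewrite ler_piMl ?normc_ge0.
Qed.

Lemma seg_scal_le t w : 0 <= t <= 1 -> normc (t%:C * w) <= normc w.
Proof. by move=> t01; exact: seg_scal. Qed.

Lemma cexp_taylor0 w : normc w <= 1 -> normc (cexp w - 1) <= e1 * normc w.
Proof.
move=> w1.
have := @cmean_value R (fun t => cexp (t%:C * w)) (fun t => w * cexp (t%:C * w))
  (e1 * normc w).
rewrite mul1r mul0r cexp0; apply => t t01; first exact: cderive_cexp.
by rewrite normcM mulrC ler_wpM2r ?normc_ge0// normc_cexp_le// seg_scal.
Qed.

Lemma cexp_dist z w : normc (w - z) <= 1 ->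
  normc (cexp w - cexp z) <= normc (cexp z) * (e1 * normc (w - z)).
Proof.
move=> wz.
have -> : cexp w - cexp z = cexp z * (cexp (w - z) - 1).
  by rewrite mulrBr mulr1 -cexpD; congr (cexp _ - _); ring.
by rewrite normcM ler_wpM2l ?normc_ge0// cexp_taylor0.
Qed.

(** Along the segment from 0 to [w] the derivative of a Taylor remainder is [w] times the remainder
    of the previous order, so each bound follows from the preceding one by the mean value
    inequality. *)
Lemma cexp_taylor1 w : normc w <= 1 -> normc (cexp w - 1 - w) <= e1 * normc w ^+ 2.
Proof.
move=> w1.
pose f (t : R) : R[i] := cexp (t%:C * w) + (-1) * (t%:C * w).
have -> : cexp w - 1 - w = f 1 - f 0.
  by rewrite /f rmorph1 mul1r rmorph0 mul0r cexp0; ring.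
apply: (@cmean_value R f (fun t => w * cexp (t%:C * w) + (-1) * w)) => t t01.
  exact: cderiveD (cderive_cexp w t) (cderiveZ (-1) (cderive_id w t)).
have -> : w * cexp (t%:C * w) + (-1) * w = w * (cexp (t%:C * w) - 1) by ring.
rewrite normcM expr2 mulrCA ler_wpM2l ?normc_ge0//.
apply: le_trans (cexp_taylor0 _) _; first exact: seg_scal.
by rewrite ler_wpM2l ?expR_ge0// seg_scal_le.
Qed.

Lemma cexp_taylor2 w : normc w <= 1 ->
  normc (cexp w - 1 - w - w ^+ 2 / 2) <= e1 * normc w ^+ 3.
Proof.
move=> w1.
pose f (t : R) : R[i] :=
  cexp (t%:C * w) + (-1) * (t%:C * w) + (- 2^-1) * ((t ^+ 2)%:C * w ^+ 2).
have -> : cexp w - 1 - w - w ^+ 2 / 2 = f 1 - f 0.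
  by rewrite /f expr1n expr0n rmorph1 !mul1r rmorph0 !mul0r cexp0; ring.
apply: (@cmean_value R f (fun t => w * cexp (t%:C * w) + (-1) * w +
    (- 2^-1) * ((2%:R * t ^+ 1)%:C * w ^+ 2))) => t t01.
  exact: cderiveD (cderiveD (cderive_cexp w t) (cderiveZ (-1) (cderive_id w t)))
    (cderiveZ (- 2^-1) (cderive_ZX (w ^+ 2) 1 t)).
have -> : w * cexp (t%:C * w) + (-1) * w + (- 2^-1) * ((2%:R * t ^+ 1)%:C * w ^+ 2) =
    w * (cexp (t%:C * w) - 1 - t%:C * w).
  by rewrite expr1 rmorphM rmorph_nat/=; field.
rewrite normcM [_ ^+ 3]exprS mulrCA ler_wpM2l ?normc_ge0//.
apply: le_trans (cexp_taylor1 _) _; first exact: seg_scal.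
by rewrite ler_wpM2l ?expR_ge0// lerXn2r ?nnegrE ?normc_ge0// seg_scal_le.
Qed.

Lemma half_le_normc_1D t w : 0 <= t <= 1 -> normc w <= 1 / 2 ->
  1 / 2 <= normc (1 + t%:C * w).
Proof.
move=> t01 w2; have := lerB_normcD 1 (t%:C * w); rewrite normc1.
have := seg_scal t01 w2; lra.
Qed.

Lemma Re_1D_gt0 t w : 0 <= t <= 1 -> normc w <= 1 / 2 -> 0 < 1 + t * Re w.
Proof.
move=> t01 w2; have := le_trans (normr_Re _) (seg_scal t01 w2).
rewrite ReZ ler_norml; lra.
Qed.

Lemma clog_taylor0 w : normc w <= 1 / 2 -> normc (clog (1 + w)) <= 2 * normc w.
Proof.
move=> w2.
have := @cmean_value R (fun t => clog (1 + t%:C * w)) (fun t => w / (1 + t%:C * w))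
  (2 * normc w).
rewrite mul1r mul0r addr0 => h.
have <- : clog (1 + w) - clog 1 = clog (1 + w).
  have -> : clog 1 = 0 :> R[i].
    by rewrite /clog /= expr1n expr0n addr0 ln1 !mul0r atan0.
  by rewrite subr0.
apply: h => t t01; first by apply: cderive_clog1; exact: Re_1D_gt0.
have h := half_le_normc_1D t01 w2.
have h0 : 0 < normc (1 + t%:C * w) by apply: lt_le_trans h; lra.
rewrite normcM normcV mulrC ler_wpM2r ?normc_ge0//.
rewrite -[2]invrK lef_pV2 ?posrE//; lra.
Qed.

(** The derivative of the remainder along the segment is exactly [(t w)^2 w / (1 + t w)], and
    [|1 + t w| >= 1 / 2]. *)
Lemma clog_taylor2 w : normc w <= 1 / 2 ->
  normc (clog (1 + w) - w + w ^+ 2 / 2) <= 2 * normc w ^+ 3.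
Proof.
move=> w2.
pose f (t : R) : R[i] :=
  clog (1 + t%:C * w) + (-1) * (t%:C * w) + 2^-1 * ((t ^+ 2)%:C * w ^+ 2).
have -> : clog (1 + w) - w + w ^+ 2 / 2 = f 1 - f 0.
  rewrite /f expr1n expr0n rmorph1 !mul1r rmorph0 !mul0r addr0.
  have -> : clog 1 = 0 :> R[i].
    by rewrite /clog /= expr1n expr0n addr0 ln1 !mul0r atan0.
  by ring.
apply: (@cmean_value R f (fun t => w / (1 + t%:C * w) + (-1) * w +
    2^-1 * ((2%:R * t ^+ 1)%:C * w ^+ 2))) => t t01.
  exact: cderiveD (cderiveD (cderive_clog1 (Re_1D_gt0 t01 w2))
    (cderiveZ (-1) (cderive_id w t))) (cderiveZ 2^-1 (cderive_ZX (w ^+ 2) 1 t)).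
have h := half_le_normc_1D t01 w2.
have h0 : 0 < normc (1 + t%:C * w) by apply: lt_le_trans h; lra.
have hN0 : 1 + t%:C * w != 0 by rewrite -normc_gt0.
have -> : w / (1 + t%:C * w) + (-1) * w + 2^-1 * ((2%:R * t ^+ 1)%:C * w ^+ 2) =
    (t%:C * w) ^+ 2 * w / (1 + t%:C * w).
  by rewrite expr1 rmorphM rmorph_nat/=; field.
rewrite normcM [normc (_ * w)]normcM normcX normcV mulrC ler_pM ?invr_ge0 ?normc_ge0//.
- by rewrite mulr_ge0 ?exprn_ge0 ?normc_ge0.
- rewrite -[2]invrK lef_pV2 ?posrE//; lra.
- rewrite [_ ^+ 3]exprSr ler_wpM2r ?normc_ge0// lerXn2r ?nnegrE ?normc_ge0//.
  exact: seg_scal_le.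
Qed.

Lemma normc_cexp_lt1 s : Re s < 0 -> normc (cexp s) < 1.
Proof. by move=> s0; rewrite normc_cexp expR_lt1. Qed.

Lemma Re_1B_gt0 z : normc z < 1 -> 0 < Re (1 - z).
Proof. by move=> z1; rewrite !ReImE subr_gt0; apply: le_lt_trans (Re_le_normc _) z1. Qed.

(* With [zeta = e^s], [t = - 2 cos x] and [z = - zeta - 1 / zeta], the function
   [- ln (t - z)] splits as [kappa (s + i x) + kappa (s - i x)]; the derivative
   [kappa1] of [kappa] is half the Poisson-Schwarz kernel. *)
Definition kappa s : R[i] := s / 2 - clog (1 - cexp s).
Definition nu s : R[i] := cexp s / (1 - cexp s).
Definition kappa1 s : R[i] := 1 / 2 + nu s.
(** Half the derivative of [kappa1], since [nu' = nu + nu^2]; hence the second Taylor coefficient of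
    [kappa]. *)
Definition kappa2 s : R[i] := (nu s + nu s ^+ 2) / 2.

Lemma normc_1B_ge s : 1 - expR (Re s) <= normc (1 - cexp s).
Proof. by have := lerB_normc 1 (cexp s); rewrite normc1 normc_cexp. Qed.

Lemma oneB_cexp_neq0 s : Re s < 0 -> 1 - cexp s != 0.
Proof.
move=> s0; rewrite -normc_gt0; apply: lt_le_trans (normc_1B_ge s).
by rewrite subr_gt0 expR_lt1.
Qed.

Lemma normc_nu s u : u < 0 -> Re s <= u -> normc (nu s) <= (1 - expR u)^-1.
Proof.
move=> u0 su.
have s0 : Re s < 0 by exact: le_lt_trans su u0.
have u1 : 0 < 1 - expR u by rewrite subr_gt0 expR_lt1.
rewrite /nu normcM normcV.
rewrite -[leRHS]mul1r ler_pM ?invr_ge0 ?normc_ge0//.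
  by rewrite ltW// normc_cexp_lt1.
rewrite lef_pV2 ?posrE ?normc_gt0 ?oneB_cexp_neq0//.
apply: le_trans (normc_1B_ge s); by rewrite lerD2l lerN2 ler_expR.
Qed.

(** The constants depend only on [u], hence not on the angle when [s] is replaced by [s + i x]: this
    is what allows the expansion to be averaged. The identity behind it is
    [1 - e^(s+h) = (1 - e^s) (1 + w)] with [w = - nu s (e^h - 1)]. *)
Lemma kappa_jet u : u < 0 -> exists C d : R, [/\ 0 <= C, 0 < d & forall s h,
  Re s <= u -> normc h <= d ->
  normc (kappa (s + h) - kappa s - kappa1 s * h - kappa2 s * h ^+ 2) <=
    C * normc h ^+ 3].
Proof.
move=> u0; set N := (1 - expR u)^-1; set K := e1.
have N0 : 0 < N by rewrite invr_gt0 subr_gt0 expR_lt1.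
have K1 : 1 <= K := e1_ge1.
have K0 : 0 < K by exact: lt_le_trans K1.
have NK0 : 0 < N * K by exact: mulr_gt0.
exists (2 * (N * K) ^+ 3 + N * K + N ^+ 2 * (K * (K + 1))).
(* The three bounds on [|h|] serve respectively the Taylor bounds of the exponential, the condition
   [Re (s + h) < 0], and [|w| <= 1 / 2]. *)
exists (Num.min (Num.min 1 (- u / 2)) (1 / 2 / (N * K))).
split.
- by rewrite !addr_ge0// ?mulr_ge0 ?exprn_ge0 ?addr_ge0 ?ltW// ltW// mulr_gt0.
- by rewrite !lt_min ltr01 !divr_gt0 ?oppr_gt0.
move=> s h su; rewrite !le_min => /andP[/andP[h1 hu] hNK].
have s0 : Re s < 0 by exact: le_lt_trans su u0.
have sh0 : Re (s + h) < 0.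
  rewrite ReD; have := le_trans (Re_le_normc h) hu; lra.
have nuN : normc (nu s) <= N by exact: normc_nu.
have H0 : 0 <= normc h := normc_ge0 h.
set E := cexp h - 1; pose w := - nu s * E.
have E1 : normc E <= K * normc h by exact: cexp_taylor0.
have E2 : normc (E - h) <= K * normc h ^+ 2 by exact: cexp_taylor1.
have E3 : normc (E - h - h ^+ 2 / 2) <= K * normc h ^+ 3 by exact: cexp_taylor2.
have w1 : normc w <= N * K * normc h.
  by rewrite normcM normcN -mulrA ler_pM ?normc_ge0.
have w2 : normc w <= 1 / 2.
  apply: le_trans w1 _.
  by rewrite mulrC -ler_pdivlMr.
have nz : 1 - cexp s != 0 := oneB_cexp_neq0 s0.
have ew : 1 - cexp (s + h) = (1 - cexp s) * (1 + w).
  by rewrite /w /nu /E cexpD; field.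
have lw : clog (1 - cexp (s + h)) = clog (1 - cexp s) + clog (1 + w).
  rewrite ew; apply: clogM.
  - exact/Re_1B_gt0/normc_cexp_lt1.
  - have -> : Re (1 + w) = 1 + 1 * Re w by rewrite ReD mul1r.
    apply: Re_1D_gt0 => //.
    by rewrite ler01 lexx.
  - by rewrite -ew; exact/Re_1B_gt0/normc_cexp_lt1.
(* The remainder is the remainder of the logarithm at [w], that of the exponential at [h], and the
   error in replacing [w^2] by [(nu s * h)^2]; the three terms of the constant bound them in this
   order. *)
have -> : kappa (s + h) - kappa s - kappa1 s * h - kappa2 s * h ^+ 2 =
  - (clog (1 + w) - w + w ^+ 2 / 2) + nu s * (E - h - h ^+ 2 / 2)
   + nu s ^+ 2 / 2 * ((E - h) * (E + h)).
  by rewrite /kappa lw /kappa1 /kappa2 /w; field.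
rewrite [leRHS]mulrDl [X in _ <= X + _]mulrDl.
apply: le_trans (le_normcD _ _) _; apply: lerD.
  apply: le_trans (le_normcD _ _) _; apply: lerD.
    rewrite normcN; apply: le_trans (clog_taylor2 w2) _.
    rewrite -mulrA -[_ ^+ 3 * _]exprMn ler_wpM2l// lerXn2r// nnegrE ?normc_ge0//.
    by rewrite mulr_ge0// ltW.
  by rewrite normcM -[leRHS]mulrA ler_pM ?normc_ge0.
rewrite normcM normc_half normcX [normc (_ * (E + h))]normcM.
have -> : N ^+ 2 * (K * (K + 1)) * normc h ^+ 3 =
  N ^+ 2 * ((K * normc h ^+ 2) * ((K + 1) * normc h)) by ring.
apply: ler_pM.
- by rewrite divr_ge0 ?exprn_ge0 ?normc_ge0.
- by rewrite mulr_ge0 ?normc_ge0.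
- have : normc (nu s) ^+ 2 <= N ^+ 2 by rewrite lerXn2r ?nnegrE ?normc_ge0// ltW.
  have : 0 <= normc (nu s) ^+ 2 by rewrite exprn_ge0 ?normc_ge0.
  lra.
- rewrite ler_pM ?normc_ge0// mulrDl mul1r.
  by apply: le_trans (le_normcD _ _) _; rewrite lerD2r.
Qed.

Lemma kappa1E s : Re s < 0 -> kappa1 s = (1 + cexp s) / (1 - cexp s) / 2.
Proof. by move=> s0; rewrite /kappa1 /nu; have := oneB_cexp_neq0 s0 => ?; field. Qed.

(** With [r = |e^s|], the real part is half the Poisson kernel [(1 - r^2) / |1 - e^s|^2], and
    [|1 - e^s| <= 1 + r]. *)
Lemma Re_kappa1_ge s : Re s < 0 ->
  (1 - expR (Re s)) / (1 + expR (Re s)) / 2 <= Re (kappa1 s).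
Proof.
move=> s0; have nz := oneB_cexp_neq0 s0.
have n0 : 0 < normc (1 - cexp s) by rewrite normc_gt0.
set r := expR (Re s).
have r0 : 0 < r := expR_gt0 _.
have r1 : r < 1 by rewrite expR_lt1.
have -> : kappa1 s = (((1 - r ^+ 2) / normc (1 - cexp s) ^+ 2 / 2)%:C +
   'i * (Im (cexp s) / normc (1 - cexp s) ^+ 2)%:C).
  rewrite kappa1E//; apply: (mulIf (_ : ((2 * normc (1 - cexp s) ^+ 2)%:C != 0))).
    by rewrite (fmorph_eq0 (real_complex R)) mulf_neq0 ?expf_neq0 ?gt_eqF//.
  have -> : (1 + cexp s) / (1 - cexp s) / 2 * (2 * normc (1 - cexp s) ^+ 2)%:C =
     (1 + cexp s) * (1 - cexp s)^*.
    by rewrite real_complexM -mulcJ real_complex_nat; field.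
  rewrite [RHS]mulrDl -['i * _ * _]mulrA -!real_complexM.
  have -> : (1 - r ^+ 2) / normc (1 - cexp s) ^+ 2 / 2 * (2 * normc (1 - cexp s) ^+ 2)
     = 1 - r ^+ 2 by field; rewrite gt_eqF.
  have -> : Im (cexp s) / normc (1 - cexp s) ^+ 2 * (2 * normc (1 - cexp s) ^+ 2)
     = 2 * Im (cexp s) by field; rewrite gt_eqF.
  rewrite /r -normc_cexp normc_sqr.
  by apply: complexP; rewrite !(ReJ, ImJ, ReImE)/=; ring.
have ReE (a b : R) : Re (a%:C + 'i * b%:C) = a by rewrite !ReImE/=; ring.
rewrite ReE ler_wpM2r ?invr_ge0//.
rewrite ler_pdivlMr ?exprn_gt0// mulrAC ler_pdivrMr; last by lra.
have -> : (1 - r ^+ 2) * (1 + r) = (1 - r) * (1 + r) ^+ 2 by ring.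
rewrite ler_wpM2l ?subr_ge0 ?(ltW r1)// lerXn2r ?nnegrE ?normc_ge0//; first lra.
by have := normcB 1 (cexp s); rewrite normc1 normc_cexp.
Qed.

Lemma normc_kappa1_le s : Re s < 0 ->
  normc (kappa1 s) <= (1 + expR (Re s)) / (1 - expR (Re s)) / 2.
Proof.
move=> s0; rewrite kappa1E// normc_half ler_wpM2r ?invr_ge0// normcM normcV.
have h : 0 < 1 - expR (Re s) by rewrite subr_gt0 expR_lt1.
apply: ler_pM; rewrite ?invr_ge0 ?normc_ge0//.
  by have := le_normcD 1 (cexp s); rewrite normc1 normc_cexp.
by rewrite lef_pV2 ?posrE ?normc_gt0 ?oneB_cexp_neq0 ?normc_1B_ge.
Qed.

Lemma Re_kappa_ge s : Re s < 0 -> Re s / 2 - ln 2 <= Re (kappa s).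
Proof.
move=> s0; rewrite /kappa ReD ReN Re_half lerD2l.
rewrite lerN2 Re_clog; last first.
  by left; rewrite gt_eqF//; exact/Re_1B_gt0/normc_cexp_lt1.
rewrite ler_ln ?posrE ?normc_gt0 ?oneB_cexp_neq0//.
apply: le_trans (normcB _ _) _; rewrite normc1 normc_cexp.
have : expR (Re s) < 1 by rewrite expR_lt1.
lra.
Qed.

Lemma kappa_asymp s : expR (Re s) <= 1 / 2 ->
  normc (kappa s - s / 2) <= 2 * expR (Re s).
Proof.
move=> h; have -> : kappa s - s / 2 = - clog (1 + - cexp s) by rewrite /kappa; ring.
rewrite normcN; apply: le_trans (clog_taylor0 _) _; by rewrite normcN normc_cexp.
Qed.

Lemma cexpD2pi s : cexp (s + (0 +i* (2 * pi))) = cexp s :> R[i].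
Proof.
rewrite cexpD cexp_imag /expi mulr_natl cos2pi sin2pi.
by rewrite -[_ +i* 0]/(1 : R[i]) mulr1.
Qed.

Lemma kappaD2pi s : kappa (s + (0 +i* (2 * pi))) = kappa s + (0 +i* pi).
Proof.
rewrite /kappa cexpD2pi mulrDl addrAC; congr (_ + _).
apply: complexP; rewrite !(Re_half, Im_half, ReImE)/=; first by field.
by field.
Qed.

Lemma kappaJ s : kappa s^* = (kappa s)^*.
Proof.
rewrite /kappa cexpJ.
have -> : (s / 2 - clog (1 - cexp s))^* = (s / 2)^* - (clog (1 - cexp s))^*.
  by rewrite rmorphB.
rewrite -clogJ; congr (_ - clog _).
  by rewrite rmorphM; congr (_ * _); rewrite fmorphV rmorph_nat.
by rewrite rmorphB rmorph1.
Qed.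

End taylor.

(** * Starlike maps of the left half plane *)

Section starlike.
Variable R : realType.
Implicit Types (z w s h : R[i]) (x y t u v : R).
Local Notation Re := (@complex.Re R).
Local Notation Im := (@complex.Im R).

(** With [r = e^u], these are the Harnack bounds of the Schwarz kernel [(1 + zeta) / (1 - zeta)] on
    [|zeta| = r]: the least real part, and the greatest modulus with a spare factor 2. *)
Definition poisson_lb u : R := (1 - expR u) / (1 + expR u).
Definition poisson_ub u : R := 2 * ((1 + expR u) / (1 - expR u)).

Lemma poisson_lb_gt0 u : u < 0 -> 0 < poisson_lb u.
Proof.
move=> u0; rewrite /poisson_lb divr_gt0 ?subr_gt0 ?expR_lt1//.
Qed.

Lemma poisson_lb_le u v : u <= v -> v < 0 -> poisson_lb v <= poisson_lb u.
Proof.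
move=> uv v0; have u0 := le_lt_trans uv v0.
have eu : expR u <= expR v by rewrite ler_expR.
have ev : expR v < 1 by rewrite expR_lt1.
have eu0 := expR_gt0 u; have ev0 := expR_gt0 v.
rewrite /poisson_lb; apply: ler_pM; rewrite ?invr_ge0; [lra|lra|lra|].
by rewrite lef_pV2 ?posrE; lra.
Qed.

Lemma poisson_ub_le u v : u <= v -> v < 0 -> poisson_ub u <= poisson_ub v.
Proof.
move=> uv v0; have u0 := le_lt_trans uv v0.
have eu : expR u <= expR v by rewrite ler_expR.
have ev : expR v < 1 by rewrite expR_lt1.
have eu0 := expR_gt0 u; have ev0 := expR_gt0 v.
rewrite /poisson_ub ler_pM2l//; apply: ler_pM; rewrite ?invr_ge0; [lra|lra|lra|].
by rewrite lef_pV2 ?posrE; lra.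
Qed.

Lemma poisson_ub_gt0 u : u < 0 -> 0 < poisson_ub u.
Proof.
move=> u0; rewrite /poisson_ub mulr_gt0// divr_gt0 ?subr_gt0 ?expR_lt1//.
Qed.

(* The properties used of [g s = log F (e^s)] on the left half plane, with [lA]
   standing for [ln A]; the bounds on [g'] are those of the Poisson kernel. *)
Record starlike_map (lA : R) (g : R[i] -> R[i]) : Prop := StarlikeMap {
  sm_jet : forall s, Re s < 0 -> exists a b, [/\ jet2 g s a b,
    poisson_lb (Re s) <= Re a & normc a <= poisson_ub (Re s)] ;
  sm_periodic : forall s, Re s < 0 -> g (s + (0 +i* (2 * pi))) = g s + (0 +i* (2 * pi)) ;
  sm_conj : forall s, Re s < 0 -> g s^* = (g s)^* ;
  sm_lower : forall s, Re s < 0 -> lA + Re s - 2 * ln 2 <= Re (g s) ;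
  sm_asymp : forall s, expR (Re s) <= 1 / 2 ->
    normc (g s - s - lA%:C) <= 8 * expR (Re s) }.

Lemma is_derive_of_bound (f : R -> R) t d :
  (forall e : R, 0 < e -> exists2 r : R, 0 < r & forall h : R, `|h| <= r ->
    `|f (t + h) - f t - d * h| <= e * `|h|) ->
  is_derive t 1 f d.
Proof.
move=> H.
have cv : h^-1 *: (f (h *: (1 : R) + t) - f t) @[h --> 0^'] --> d.
  apply/cvgrPdist_le => e e0; have [r r0 hr] := H e e0.
  near=> h.
  have h0 : h != 0 by near: h; exact: nbhs_dnbhs_neq.
  have hle : `|h| <= r.
    near: h; apply: dnbhs0_le => //.
  have := hr _ hle; rewrite -ler_pdivrMr ?normr_gt0// -normf_div.
  suff -> : `|d - h^-1 *: (f (h *: 1 + t) - f t)| = `|(f (t + h) - f t - d * h) / h| by [].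
  rewrite distrC [h *: 1](_ : _ = h); last exact: mulr1.
  rewrite [h + t]addrC; congr (`|_|).
  by rewrite -[_ *: _]/(_ * _); field.
apply: DeriveDef; first by apply/cvg_ex; exists d.
exact: cvg_lim cv.
Unshelve. all: by end_near. Qed.

Lemma jet2_lin (f : R[i] -> R[i]) s a b : jet2 f s a b ->
  exists C d : R, [/\ 0 < C, 0 < d & forall h, normc h <= d ->
    normc (f (s + h) - f s - a * h) <= C * normc h ^+ 2].
Proof.
move=> /(_ 1 ltr01)[d d0 hd]; exists (1 + normc b), d; split => //.
  by rewrite ltr_wpDr ?normc_ge0.
move=> h /hd hh.
have -> : f (s + h) - f s - a * h = (f (s + h) - f s - a * h - b * h ^+ 2) + b * h ^+ 2 by ring.
apply: le_trans (le_normcD _ _) _; rewrite mulrDl lerD//.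
by rewrite normcM normcX.
Qed.

Lemma jet2_lipschitz (f : R[i] -> R[i]) s a b : jet2 f s a b ->
  exists C d : R, [/\ 0 < C, 0 < d & forall h, normc h <= d ->
    normc (f (s + h) - f s) <= C * normc h].
Proof.
move=> /jet2_lin[C [d [C0 d0 H]]]; exists (normc a + C * d), d; split => //.
  by rewrite ltr_wpDl ?normc_ge0// mulr_gt0.
move=> h hd.
have -> : f (s + h) - f s = (f (s + h) - f s - a * h) + a * h by ring.
apply: le_trans (le_normcD _ _) _; rewrite normcM addrC mulrDl lerD2l.
apply: le_trans (H _ hd) _.
by rewrite expr2 mulrA ler_wpM2r ?normc_ge0// ler_pM2l.
Qed.

Lemma cderive_of_bound (f : R[i] -> R[i]) s a (D : R[i]) t :
  (exists C d : R, [/\ 0 < C, 0 < d & forall h, normc h <= d ->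
    normc (f (s + t%:C * D + h) - f (s + t%:C * D) - a * h) <= C * normc h ^+ 2]) ->
  cderive (fun x => f (s + x%:C * D)) t (a * D).
Proof.
move=> [C [d [C0 d0 H]]].
set n := 1 + normc D.
have n0 : 0 < n by rewrite ltr_wpDr ?normc_ge0.
have key (P : R[i] -> R) (PN : forall z, `|P z| <= normc z)
    (PB : forall z w, P (z - w) = P z - P w)
    (PZ : forall x z, P (x%:C * z) = x * P z) :
  is_derive t 1 (fun x => P (f (s + x%:C * D))) (P (a * D)).
  apply: is_derive_of_bound => e e0.
  exists (Num.min (d / n) (e / (C * n ^+ 2))).
    by rewrite lt_min !divr_gt0// mulr_gt0// exprn_gt0.
  move=> h; rewrite le_min => /andP[hd he].
  have nD : normc D <= n by rewrite lerDr.
  have hD : normc (h%:C * D) <= `|h| * n.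
    by rewrite normcM normc_real ler_wpM2l.
  have hD' : normc (h%:C * D) <= d.
    by apply: le_trans hD _; rewrite -ler_pdivlMr.
  have := H _ hD'.
  have -> : s + t%:C * D + h%:C * D = s + (t + h)%:C * D by rewrite real_complexD; ring.
  move=> Hh.
  have -> : P (f (s + (t + h)%:C * D)) - P (f (s + t%:C * D)) - P (a * D) * h =
    P (f (s + (t + h)%:C * D) - f (s + t%:C * D) - a * (h%:C * D)).
    have -> : a * (h%:C * D) = h%:C * (a * D) by ring.
    by rewrite !PB PZ [h * _]mulrC.
  apply: le_trans (PN _) _; apply: le_trans Hh _.
  apply: (@le_trans _ _ (C * (`|h| * n) ^+ 2)).
    by rewrite ler_pM2l// lerXn2r ?nnegrE ?normc_ge0 ?mulr_ge0// ltW.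
  have -> : C * (`|h| * n) ^+ 2 = (`|h| * (C * n ^+ 2)) * `|h| by ring.
  by rewrite ler_wpM2r// -ler_pdivlMr// mulr_gt0 ?exprn_gt0.
split.
- apply: key; [exact: normr_Re|by move=> z w; rewrite ReD ReN|exact: ReZ].
- apply: key; [exact: normr_Im|by move=> z w; rewrite ImD ImN|exact: ImZ].
Qed.

Lemma jet2_cderive (f : R[i] -> R[i]) s (D : R[i]) t a b :
  jet2 f (s + t%:C * D) a b -> cderive (fun x => f (s + x%:C * D)) t (a * D).
Proof. by move=> /jet2_lin H; exact: cderive_of_bound. Qed.

Lemma mean_value_ge (f : R -> R) (m : R) :
  (forall t, 0 <= t <= 1 -> exists2 d, is_derive t 1 f d & m <= d) ->
  m <= f 1 - f 0.
Proof.
move=> H.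
have /choice [d dP] : forall t, exists d, 0 <= t <= 1 -> is_derive t 1 f d /\ m <= d.
  move=> t; have [/H[d ? ?]|_] := boolP (0 <= t <= 1); last by exists 0.
  by exists d.
have [t t01|t t01 ->] := @mean_value R f d; first by case: (dP t t01).
by case: (dP t t01).
Qed.

Lemma cmean_value_ex (f : R -> R[i]) (M : R) :
  (forall t, 0 <= t <= 1 -> exists2 d, cderive f t d & normc d <= M) ->
  normc (f 1 - f 0) <= M.
Proof.
move=> H.
have /choice [d dP] : forall t, exists d, 0 <= t <= 1 -> cderive f t d /\ normc d <= M.
  move=> t; have [/H[d ? ?]|_] := boolP (0 <= t <= 1); last by exists 0.
  by exists d.
by apply: (@cmean_value R f d) => t t01; case: (dP t t01).
Qed.

Lemma Re_segment s s' v t : Re s <= v -> Re s' <= v -> 0 <= t <= 1 ->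
  Re (s + t%:C * (s' - s)) <= v.
Proof.
move=> sv s'v /andP[t0 t1]; rewrite ReD ReZ ReD ReN.
have -> : Re s + t * (Re s' - Re s) = (1 - t) * Re s + t * Re s' by ring.
have -> : v = (1 - t) * v + t * v by ring.
by rewrite lerD// ler_wpM2l// subr_ge0.
Qed.

Section starlike_map_theory.
Variables (lA : R) (g : R[i] -> R[i]).
Hypothesis G : starlike_map lA g.

Lemma segment1 s s' : s + 1%:C * (s' - s) = s'.
Proof. by rewrite -[1%:C]/(1 : R[i]) mul1r addrC subrK. Qed.

Lemma segment0 s s' : s + 0%:C * (s' - s) = s.
Proof. by rewrite -[0%:C]/(0 : R[i]) mul0r addr0. Qed.

(** Along the segment the scalar product with [D = s' - s] has derivative [|D|^2 Re g'], and the
    lower bound of [Re g'] increases to the left. The constant is the same for all starlike maps. *)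
Lemma sm_monotone s s' v : v < 0 -> Re s <= v -> Re s' <= v ->
  poisson_lb v * normc (s' - s) ^+ 2 <= Re ((s' - s)^* * (g s' - g s)).
Proof.
move=> v0 sv s'v; set D := s' - s.
have := @mean_value_ge (fun t => Re (D^* * g (s + t%:C * D))) (poisson_lb v * normc D ^+ 2).
rewrite segment1 segment0 -ReN -ReD -mulrN -mulrDr; apply => t t01.
have tv : Re (s + t%:C * D) <= v by exact: Re_segment.
have [a [b [J a1 _]]] := sm_jet G (le_lt_trans tv v0).
exists (Re (D^* * (a * D))).
  by apply: cderive_scal; exact: jet2_cderive J.
have -> : D^* * (a * D) = (D^* * D) * a by ring.
rewrite mulcJ ReZ mulrC ler_wpM2l ?exprn_ge0 ?normc_ge0//.
by apply: le_trans a1; exact: poisson_lb_le.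
Qed.

Lemma sm_lipschitz s s' v : v < 0 -> Re s <= v -> Re s' <= v ->
  normc (g s' - g s) <= poisson_ub v * normc (s' - s).
Proof.
move=> v0 sv s'v; set D := s' - s.
have := @cmean_value_ex (fun t => g (s + t%:C * D)) (poisson_ub v * normc D).
rewrite segment1 segment0; apply => t t01.
have tv : Re (s + t%:C * D) <= v by exact: Re_segment.
have [a [b [J _ a1]]] := sm_jet G (le_lt_trans tv v0).
exists (a * D); first exact: jet2_cderive J.
rewrite normcM ler_wpM2r ?normc_ge0//.
by apply: le_trans a1 _; exact: poisson_ub_le.
Qed.

Lemma sm_inj s s' : Re s < 0 -> Re s' < 0 -> g s = g s' -> s = s'.
Proof.
move=> s0 s'0 e.
have v0 : Num.max (Re s) (Re s') < 0 by rewrite gt_max s0.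
have := @sm_monotone s s' _ v0; rewrite !le_max !lexx orbT /= e subrr mulr0 => /(_ isT isT).
rewrite pmulr_rle0 ?poisson_lb_gt0// => h.
have : normc (s' - s) ^+ 2 = 0 by apply/eqP; rewrite eq_le h exprn_ge0 ?normc_ge0.
by move/eqP; rewrite sqrf_eq0 => /eqP/eq0_normc/eqP; rewrite subr_eq0 => /eqP.
Qed.

Lemma Re_scal_le (D w : R[i]) : Re (D^* * w) <= normc D * normc w.
Proof. by apply: le_trans (Re_le_normc _) _; rewrite normcM normcJ. Qed.

(** Nothing is known beforehand about where [s'] lies, and monotonicity degenerates near the
    imaginary axis. If [s'] were farther than [d] from [s], the first piece of the segment, of
    length [d], stays in [Re <= Re s / 2] and already moves the image by [c d] in the direction of
    [D]; the other piece cannot undo this, as its contribution is nonnegative. So a small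
    displacement of the image forces the first case. *)
Lemma sm_inv_lipschitz s s' : Re s < 0 -> Re s' < 0 ->
  normc (g s' - g s) < poisson_lb (Re s / 2) * (- Re s / 2) ->
  poisson_lb (Re s / 2) * normc (s' - s) <= normc (g s' - g s).
Proof.
move=> s0 s'0; set c := poisson_lb _; set d := - Re s / 2; set D := s' - s.
have h0 : Re s / 2 < 0 by lra.
have c0 : 0 < c by exact: poisson_lb_gt0.
have d0 : 0 < d by rewrite /d; lra.
have sv : Re s <= Re s / 2 by lra.
have [Dd|dD] := leP (normc D) d.
  move=> _; have [->|D0] := eqVneq D 0; first by rewrite normc0 mulr0 normc_ge0.
  have s'v : Re s' <= Re s / 2.
    have := Re_le_normc D; rewrite {1}/D ReD ReN; move: Dd; rewrite /d; lra.
  have := sm_monotone h0 sv s'v; rewrite -/c -/D => h.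
  rewrite -(@ler_pM2l _ (normc D)) ?normc_gt0//.
  by apply: le_trans (Re_scal_le _ _); apply: le_trans h; rewrite mulrCA -expr2.
have D0 : 0 < normc D by exact: lt_trans dD.
have t0 : 0 < d / normc D by exact: divr_gt0.
have t1 : d / normc D < 1 by rewrite ltr_pdivrMr// mul1r.
set t := d / normc D in t0 t1; pose s2 := s + t%:C * D.
have n2 : normc (s2 - s) = d.
  by rewrite /s2 addrAC subrr add0r normc_ZR ?(ltW t0)// /t divfK// gt_eqF.
have s2v : Re s2 <= Re s / 2.
  have := Re_le_normc (s2 - s); rewrite n2 /d ReD ReN; lra.
have := sm_monotone h0 sv s2v; rewrite n2 -/c.
have -> : s2 - s = t%:C * D by rewrite /s2; ring.
have v0 : Num.max (Re s2) (Re s') < 0 by rewrite gt_max s'0 andbT; lra.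
have := @sm_monotone s2 s' _ v0; rewrite !le_max !lexx orbT /= => /(_ isT isT).
have -> : s' - s2 = (1 - t)%:C * D by rewrite /s2 /D real_complexB; ring.
have conjZ x z : (x%:C * z)^* = x%:C * z^*.
  by apply: complexP; rewrite !(ReJ, ImJ, ReZ, ImZ)// mulrN.
have ReZM x z w : Re (x%:C * z * w) = x * Re (z * w) by rewrite -mulrA ReZ.
rewrite !conjZ !ReZM => h1 h2; rewrite ltNge => /negP; case.
have {}h1 : 0 <= Re (D^* * (g s' - g s2)).
  rewrite -(@pmulr_rge0 _ (1 - t)) ?subr_gt0//; apply: le_trans h1.
  by rewrite mulr_ge0 ?exprn_ge0 ?normc_ge0// ltW// poisson_lb_gt0.
have {}h2 : normc D * (c * d) <= Re (D^* * (g s2 - g s)).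
  rewrite -(@ler_pM2l _ t)//; apply: le_trans h2.
  have -> : t * (normc D * (c * d)) = c * d * (t * normc D) by ring.
  have -> : t * normc D = d by rewrite /t divfK// gt_eqF.
  by rewrite -mulrA -expr2.
rewrite -(@ler_pM2l _ (normc D))//; apply: le_trans (Re_scal_le _ _).
have -> : g s' - g s = (g s' - g s2) + (g s2 - g s) by ring.
rewrite mulrDr ReD; lra.
Qed.

Lemma sm_Im_real u : u < 0 -> Im (g (u%:C)) = 0.
Proof.
move=> u0; have := @sm_conj _ _ G u%:C u0.
have -> : (u%:C)^* = u%:C :> R[i] by apply: complexP; rewrite ?ReJ ?ImJ/= ?oppr0.
by move=> /(congr1 Im); rewrite ImJ; lra.
Qed.

Lemma sm_Re_vertical u x y : u < 0 ->
  poisson_lb u * (y - x) ^+ 2 <= (y - x) * (Im (g (u +i* y)) - Im (g (u +i* x))).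
Proof.
move=> u0; have := @sm_monotone (u +i* x) (u +i* y) u u0 (lexx _) (lexx _).
have -> : (u +i* y) - (u +i* x) = 0 +i* (y - x) by apply: complexP; rewrite !ReImE/= ?subrr.
by rewrite normc_imag real_normK ?num_real// ReJM/= mul0r add0r ImD ImN.
Qed.

Lemma sm_lip_vertical u x y : u < 0 ->
  normc (g (u +i* y) - g (u +i* x)) <= poisson_ub u * `|y - x|.
Proof.
move=> u0; have := @sm_lipschitz (u +i* x) (u +i* y) u u0 (lexx _) (lexx _).
have -> : (u +i* y) - (u +i* x) = 0 +i* (y - x) by apply: complexP; rewrite !ReImE/= ?subrr.
by rewrite normc_imag.
Qed.

Lemma lipschitz_continuousR (f : R -> R) (K : R) :
  (forall x y, `|f y - f x| <= K * `|y - x|) -> continuous f.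
Proof.
move=> H x; apply/cvgrPdist_le => e e0.
have K0 : 0 < 1 + `|K| by rewrite ltr_wpDr.
near=> y; rewrite (le_trans (H _ _))//.
apply: (@le_trans _ _ ((1 + `|K|) * `|x - y|)).
  by rewrite ler_wpM2r// (le_trans (ler_norm _))// lerDr.
rewrite -ler_pdivlMl//; near: y; apply: cvgr_dist_le => //.
by rewrite mulr_gt0// invr_gt0.
Unshelve. all: by end_near. Qed.

Lemma IVT_continuous (f : R -> R) (a b v : R) : a <= b -> continuous f ->
  f a <= v -> v <= f b -> exists2 c, a <= c <= b & f c = v.
Proof.
move=> ab cf fa fb; have := @IVT R f a b v ab.
case; first exact: continuous_subspaceT.
  by rewrite ge_min fa le_max fb orbT.
by move=> c; rewrite in_itv/= => ? ?; exists c.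
Qed.

(** On a vertical line [Im g] vanishes at the real point and grows at least linearly in both
    directions, by monotonicity; the rest is the intermediate value theorem. *)
Lemma sm_angle u y : u < 0 -> exists t, Im (g (u +i* t)) = y.
Proof.
move=> u0; set f := fun t => Im (g (u +i* t)).
have f0 : f 0 = 0 by exact: sm_Im_real.
have cf : continuous f.
  apply: (@lipschitz_continuousR _ (poisson_ub u)) => x z.
  apply: le_trans (sm_lip_vertical x z u0).
  by rewrite /f -ImN -ImD; exact: normr_Im.
have c0 := poisson_lb_gt0 u0.
set M := `|y| / poisson_lb u.
have M0 : 0 <= M by rewrite divr_ge0// ltW.
have key t : 0 <= t -> poisson_lb u * t <= f t /\ f (- t) <= - (poisson_lb u * t).
  rewrite le_eqVlt => /predU1P[<-|t0]; first by rewrite mulr0 oppr0 f0.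
  split.
  - have := sm_Re_vertical 0 t u0; rewrite -/(f 0) -/(f t) f0 !subr0.
    by rewrite expr2 mulrCA ler_pM2l.
  - have := sm_Re_vertical 0 (- t) u0; rewrite -/(f 0) -/(f (- t)) f0 !subr0.
    by rewrite sqrrN expr2 mulrCA mulNr -mulrN ler_pM2l// lerNr.
have [h1 h2] := key M M0.
have cM : poisson_lb u * M = `|y| by rewrite /M mulrC divfK// gt_eqF.
rewrite cM in h1 h2.
have [|||c _ fc] := @IVT_continuous f (- M) M y _ cf.
- lra.
- by apply: le_trans h2 _; have := ler_norm (- y); rewrite normrN; lra.
- by apply: le_trans h1; exact: ler_norm.
- by exists c.
Qed.

Lemma dist_min_le (x y z : R) : `|Num.min x z - Num.min y z| <= `|x - y|.
Proof.
have h1 := ler_norm (x - y); have h2 := ler_norm (y - x); rewrite distrC in h2.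
by rewrite ler_norml; case: (leP x z) => ?; case: (leP y z) => ?; lra.
Qed.

Lemma normc_Complex_le x y : normc (x +i* y) <= `|x| + `|y|.
Proof. exact: (normc_le_ReIm (x +i* y)). Qed.

Lemma ln2_le1 : ln 2 <= 1 :> R.
Proof. by have := @le_ln1Dx R 1; rewrite (_ : 1 + 1 = 2)//; apply; lra. Qed.

Lemma expRN1_half : expR (- 1) <= 1 / 2 :> R.
Proof.
rewrite expRN div1r lef_pV2 ?posrE ?expR_gt0//.
have := @expR_ge1Dx R 1; lra.
Qed.

(** The curve of points [u + i tau u] is the preimage of the horizontal line at height [a]. The
    images of two of its points differ by the real number [X v - X u], so monotonicity says that [X]
    increases. That [X] takes every value to the left of [X u] is the starlikeness of the
    exponential of the image. *)
Lemma sm_ray (a : R) : exists tau X : R -> R,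
  [/\ forall u, u < 0 -> g (u +i* tau u) = X u +i* a,
      forall u v, u < v -> v < 0 -> X u < X v,
      forall u, u < 0 -> lA + u - 2 * ln 2 <= X u &
      forall u x, u < 0 -> x <= X u -> exists2 v, v <= u & X v = x].
Proof.
have /choice[tau tauP] : forall u, exists t, u < 0 -> Im (g (u +i* t)) = a.
  move=> u; have [u0|] := ltP u 0; last by exists 0.
  by have [t ht] := sm_angle a u0; exists t.
pose X u := Re (g (u +i* tau u)).
have gX u : u < 0 -> g (u +i* tau u) = X u +i* a.
  by move=> u0; apply: complexP => //=; rewrite tauP.
have tau_lip v u u' : v < 0 -> u <= v -> u' <= v ->
    poisson_lb v * `|tau u' - tau u| <= poisson_ub v * `|u' - u|.
  move=> v0 uv u'v.
  have u0 := le_lt_trans uv v0; have u'0 := le_lt_trans u'v v0.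
  have h1 := sm_Re_vertical (tau u) (tau u') u'0.
  have h2 := @sm_lipschitz (u +i* tau u) (u' +i* tau u) v v0 uv u'v.
  have e1 : normc ((u' +i* tau u) - (u +i* tau u)) = `|u' - u|.
    have -> : (u' +i* tau u) - (u +i* tau u) = (u' - u)%:C.
      by apply: complexP; rewrite !ReImE/= ?subrr.
    exact: normc_real.
  rewrite e1 in h2; apply: le_trans h2.
  apply: (@le_trans _ _ `|Im (g (u' +i* tau u) - g (u +i* tau u))|); last exact: normr_Im.
  rewrite ImD ImN (tauP u)// -(tauP u')// [leRHS]distrC.
  have [->|n0] := eqVneq (tau u') (tau u); first by rewrite subrr normr0 mulr0.
  rewrite -(@ler_pM2l _ `|tau u' - tau u|) ?normr_gt0 ?subr_eq0//.
  rewrite -normrM; apply: le_trans (ler_norm _); apply: le_trans h1.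
  rewrite mulrCA -expr2 real_normK ?num_real// ler_wpM2r ?sqr_ge0//.
  exact: poisson_lb_le.
have Xlip v : v < 0 -> exists K, forall u u', u <= v -> u' <= v ->
    `|X u' - X u| <= K * `|u' - u|.
  move=> v0; have c0 := poisson_lb_gt0 v0.
  exists (poisson_ub v * (1 + poisson_ub v / poisson_lb v)) => u u' uv u'v.
  have := @sm_lipschitz (u +i* tau u) (u' +i* tau u') v v0 uv u'v.
  rewrite !gX ?(le_lt_trans uv)// ?(le_lt_trans u'v)//.
  have -> : (X u' +i* a) - (X u +i* a) = (X u' - X u)%:C.
    by apply: complexP; rewrite !ReImE/= ?subrr.
  rewrite normc_real => h; apply: le_trans h _.
  rewrite -[leRHS]mulrA ler_pM2l ?poisson_ub_gt0//.
  have -> : (u' +i* tau u') - (u +i* tau u) = (u' - u) +i* (tau u' - tau u).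
    by apply: complexP; rewrite !ReImE.
  apply: le_trans (normc_Complex_le _ _) _; rewrite mulrDl mul1r lerD2l.
  by rewrite mulrAC ler_pdivlMr// mulrC; exact: tau_lip.
exists tau, X; split => //.
- move=> u v uv v0; have u0 := lt_trans uv v0.
  have := @sm_monotone (u +i* tau u) (v +i* tau v) v v0 (ltW uv) (lexx _).
  set n := normc _; have n0 : 0 < n.
    by rewrite normc_gt0; apply/eqP => /(congr1 Re); rewrite !ReImE/=; lra.
  clearbody n; rewrite !gX// ReJM !ReImE/= subrr mulr0 addr0 => h.
  rewrite -subr_gt0 -(@pmulr_rgt0 _ (v - u)) ?subr_gt0//.
  by apply: lt_le_trans h; rewrite mulr_gt0 ?poisson_lb_gt0 ?exprn_gt0.
- by move=> u u0; exact: (@sm_lower _ _ G (u +i* tau u)).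
- move=> u x u0 xX.
  have [K HK] := Xlip u u0.
  (* At [w <= -1] the asymptotic bound is at most [8 / 2 = 4], so [X w <= w + lA + 4], which the
     last entry makes at most [x]. *)
  set w := Num.min (Num.min u (-1)) (x - lA - 4).
  have wu : w <= u by rewrite !ge_min lexx.
  have w1 : w <= - 1 by rewrite !ge_min lexx orbT.
  have wx : w <= x - lA - 4 by rewrite !ge_min lexx orbT.
  have Xw : X w <= x.
    have ew : expR w <= 1 / 2 by apply: le_trans expRN1_half; rewrite ler_expR.
    have := @sm_asymp _ _ G (w +i* tau w) ew; rewrite gX ?(le_lt_trans wu)//= -/(normc _).
    move=> h.
    have := Re_le_normc ((X w +i* a) - (w +i* tau w) - lA%:C); rewrite !ReImE/=.
    by have := expR_gt0 w; lra.
  (* [X] is known to be Lipschitz only to the left of [u]; the truncation by [u] makes it continuous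
     on the whole line without changing it on [[w, u]]. *)
  have [|||c /andP[c1 c2] Xc] := @IVT_continuous (fun v => X (Num.min v u)) w u x wu.
  + apply: (@lipschitz_continuousR _ `|K|) => y z.
    apply: le_trans (HK _ _ _ _) _; rewrite ?ge_min ?lexx ?orbT//.
    apply: (@le_trans _ _ (`|K| * `|Num.min z u - Num.min y u|)).
      by rewrite ler_wpM2r// ler_norm.
    by rewrite ler_wpM2l// dist_min_le.
  + by rewrite min_l.
  + by rewrite minxx.
  + by exists c => //; rewrite -Xc min_l.
Qed.

End starlike_map_theory.
End starlike.

(** * Maximum principle in a periodic strip, and second-order expansion of inverses *)

Section strip_maximum.
Variable R : realType.
Implicit Types (z s h : R[i]) (x y t u : R).
Local Notation Re := (@complex.Re R).
Local Notation Im := (@complex.Im R).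

Lemma cexp_surj z : z != 0 -> exists s : R[i], cexp s = z.
Proof.
move=> z0; have [r0|r0|r0] := ltgtP (Re z) 0.
- exists (clog (- z) + (0 +i* pi)).
  rewrite cexpD clogK ?ReN ?oppr_gt0// cexp_imag /expi cospi sinpi.
  by apply: complexP; rewrite !ReImE/=; ring.
- by exists (clog z); rewrite clogK.
- have i0 : Im z != 0 by apply: contraNneq z0 => i0; apply/eqP; exact: complexP.
  have [i1|i1|/eqP] := ltgtP (Im z) 0; last by rewrite (negbTE i0).
  + exists (clog ('i * z) + (0 +i* (- (pi / 2)))).
    rewrite cexpD clogK; last by rewrite !ReImE/=; lra.
    rewrite cexp_imag /expi cosN sinN cos_pihalf sin_pihalf.
    by apply: complexP; rewrite !ReImE/=; ring.
  + exists (clog (- 'i * z) + (0 +i* (pi / 2))).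
    rewrite cexpD clogK; last by rewrite !ReImE/=; lra.
    rewrite cexp_imag /expi cos_pihalf sin_pihalf.
    by apply: complexP; rewrite !ReImE/=; ring.
Qed.

Lemma shift2pi (a t : R) : exists k : int, a <= t + k%:~R * (2 * pi) <= a + 2 * pi.
Proof.
have p0 : 0 < 2 * pi :> R by rewrite mulr_gt0 ?pi_gt0.
exists (- Num.floor ((t - a) / (2 * pi))).
have /andP[h1 h2] := floor_itv ((t - a) / (2 * pi)).
rewrite ler_pdivlMr// in h1; rewrite ltr_pdivrMr// in h2.
rewrite rmorphN/= mulNr; rewrite rmorphD/= mulrDl mul1r in h2.
lra.
Qed.

Lemma periodic_shift (T : Type) (f : R -> T) (p : R) :
  (forall t, f (t + p) = f t) -> forall (k : int) t, f (t + k%:~R * p) = f t.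
Proof.
move=> fp.
have nat_case n t : f (t + n%:R * p) = f t.
  elim: n t => [|n IH] t; first by rewrite mul0r addr0.
  by rewrite -[n.+1%:R]natr1 mulrDl mul1r addrA fp IH.
case=> n t; first exact: nat_case.
by rewrite NegzE rmorphN/= mulNr -[in RHS](subrK (n.+1%:R * p) t) nat_case.
Qed.

Lemma jet2_sub (f g : R[i] -> R[i]) s a b a' b' :
  jet2 f s a b -> jet2 g s a' b' -> jet2 (fun z => f z - g z) s (a - a') (b - b').
Proof.
move=> Jf Jg e e0; have e2 : 0 < e / 2 by rewrite divr_gt0.
have [d1 d10 H1] := Jf _ e2; have [d2 d20 H2] := Jg _ e2.
exists (Num.min d1 d2); first by rewrite lt_min d10.
move=> h; rewrite le_min => /andP[/H1 h1 /H2 h2].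
have -> : f (s + h) - g (s + h) - (f s - g s) - (a - a') * h - (b - b') * h ^+ 2 =
  (f (s + h) - f s - a * h - b * h ^+ 2) - (g (s + h) - g s - a' * h - b' * h ^+ 2) by ring.
by apply: le_trans (normcB _ _) _; lra.
Qed.

Lemma jet2_linear (c : R[i]) s : jet2 (fun z => c * z) s c 0.
Proof.
move=> e e0; exists 1 => // h _.
have -> : c * (s + h) - c * s - c * h - 0 * h ^+ 2 = 0 by ring.
by rewrite normc0 mulr_ge0 ?sqr_ge0// ltW.
Qed.

Lemma jet2_cexp (c : R[i]) s : jet2 (fun z => c + cexp z) s (cexp s) (cexp s / 2).
Proof.
move=> e e0.
set n := normc (cexp s : R[i]); have n0 : 0 < n by rewrite normc_gt0 cexp_neq0.
have k0 : 0 < n * expR 1 by rewrite mulr_gt0 ?expR_gt0.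
exists (Num.min 1 (e / (n * expR 1))); first by rewrite lt_min ltr01 divr_gt0.
move=> h; rewrite le_min => /andP[h1]; rewrite ler_pdivlMr// => he.
have -> : c + cexp (s + h) - (c + cexp s) - cexp s * h - cexp s / 2 * h ^+ 2 =
  cexp s * (cexp h - 1 - h - h ^+ 2 / 2) by rewrite cexpD; field.
rewrite normcM -/n; apply: (@le_trans _ _ (n * (expR 1 * normc h ^+ 3))).
  by rewrite ler_pM2l// cexp_taylor2.
have -> : n * (expR 1 * normc h ^+ 3) = (normc h * (n * expR 1)) * normc h ^+ 2 by ring.
by rewrite ler_wpM2r ?sqr_ge0.
Qed.

Lemma continuous_of_jet2 (f : R[i] -> R[i]) (p : R * R) a b :
  jet2 f (p.1 +i* p.2) a b -> {for p, continuous (fun q : R * R => Re (f (q.1 +i* q.2)))}.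
Proof.
move=> /jet2_lipschitz[C [d [C0 d0 H]]]; apply/cvgrPdist_le => e e0.
have k0 : 0 < Num.min (d / 2) (e / (2 * C)) by rewrite lt_min !divr_gt0// mulr_gt0.
near=> q.
have h1 : `|p.1 - q.1| <= Num.min (d / 2) (e / (2 * C)).
  by near: q; apply: (@cvgr_dist_le _ _ _ (nbhs p) _ fst p.1 _ _ k0); exact: cvg_fst.
have h2 : `|p.2 - q.2| <= Num.min (d / 2) (e / (2 * C)).
  by near: q; apply: (@cvgr_dist_le _ _ _ (nbhs p) _ snd p.2 _ _ k0); exact: cvg_snd.
pose h : R[i] := (q.1 - p.1) +i* (q.2 - p.2).
have hE : q.1 +i* q.2 = (p.1 +i* p.2) + h by apply: complexP; rewrite !ReImE/=; ring.
have hn : normc h <= `|p.1 - q.1| + `|p.2 - q.2|.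
  by rewrite [`|p.1 - _|]distrC [`|p.2 - _|]distrC; exact: normc_Complex_le.
move: h1 h2; rewrite !le_min => /andP[h1 h1'] /andP[h2 h2'].
rewrite distrC hE -ReN -ReD; apply: le_trans (normr_Re _) _.
apply: le_trans (H _ _) _; first by lra.
apply: (@le_trans _ _ (C * (e / (2 * C) + e / (2 * C)))).
  by rewrite ler_pM2l//; lra.
by have -> : C * (e / (2 * C) + e / (2 * C)) = e by field; rewrite gt_eqF.
Unshelve. all: by end_near. Qed.

(* Perturbing the harmonic function [Re Q] to [Re Q + e u^2] makes the four-point
   average [h in {t, -t, it, -it}] strictly exceed the value at an interior
   maximum: the first- and second-order terms of [Q] cancel in this average. *)
Lemma strip_max (Q : R[i] -> R[i]) (a b M : R) :
  (forall s, a <= Re s <= b -> exists c d, jet2 Q s c d) ->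
  (forall s, a <= Re s <= b -> Re (Q (s + (0 +i* (2 * pi)))) = Re (Q s)) ->
  (forall s, Re s = a \/ Re s = b -> Re (Q s) <= M) ->
  forall s, a <= Re s <= b -> Re (Q s) <= M.
Proof.
move=> J per bd s sab.
have ab : a <= b by case/andP: sab; exact: le_trans.
suff key (e : R) : 0 < e -> Re (Q s) <= M + e * (a ^+ 2 + b ^+ 2).
  set B := a ^+ 2 + b ^+ 2 in key.
  have B0 : 0 <= B by rewrite addr_ge0 ?sqr_ge0.
  apply/ler_addgt0Pr => e e0.
  apply: le_trans (key (e / (1 + B)) _) _; first by rewrite divr_gt0// ltr_wpDr.
  rewrite lerD2l mulrAC ler_pdivrMr ?ltr_wpDr// ler_wpM2l// ?(ltW e0)//.
  by rewrite lerDr.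
move=> e0.
pose f (p : R * R) := Re (Q (p.1 +i* p.2)) + e * (p.1 * p.1).
pose K : set (R * R) := `[a, b]%classic `*` `[0, 2 * pi]%classic.
have p0 : 0 < 2 * pi :> R by rewrite mulr_gt0 ?pi_gt0.
have Kne : K !=set0.
  by exists (a, 0); split => /=; rewrite in_itv/= lexx ?ab ?(ltW p0).
have Kc : compact K by apply: compact_setX; exact: segment_compact.
have fc : {within K, continuous f}.
  apply: continuous_in_subspaceT => p; rewrite inE => -[]; rewrite /= !in_itv/= => p1 p2.
  have [c [d Jp]] := J (p.1 +i* p.2) p1.
  apply: cvgD; first exact: continuous_of_jet2 Jp.
  by apply: cvgMr; apply: cvgM; exact: cvg_fst.
have [p] := compact_EVT_max Kne Kc fc.
rewrite inE => -[]; rewrite /= !in_itv/= => p1 p2 pmax.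
have {}pmax x y : a <= x <= b -> f (x, y) <= f p.
  move=> xab; have [k hk] := shift2pi 0 y; rewrite add0r in hk.
  have -> : f (x, y) = f (x, y + k%:~R * (2 * pi)).
    apply/esym; apply: (@periodic_shift _ (fun y => f (x, y))) => t.
    rewrite /f/=; congr (_ + _); rewrite -(per (x +i* t))//; congr (Re (Q _)).
    by apply: complexP; rewrite !ReImE/= ?addr0.
  by apply: pmax; rewrite inE; split; rewrite /= in_itv.
have fpM : f p <= M + e * (a ^+ 2 + b ^+ 2).
  have bdry : p.1 = a \/ p.1 = b -> f p <= M + e * (a ^+ 2 + b ^+ 2).
    move=> pab; rewrite /f lerD ?bd// ler_pM2l// -expr2.
    by case: pab => ->; rewrite ?lerDl ?lerDr sqr_ge0.
  have [pa|pa] := eqVneq p.1 a; first by apply: bdry; left.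
  have [pb|pb] := eqVneq p.1 b; first by apply: bdry; right.
  exfalso.
  have {}pa : a < p.1 by rewrite lt_neqAle eq_sym pa; case/andP: p1.
  have {}pb : p.1 < b by rewrite lt_neqAle pb; case/andP: p1.
  set s0 := p.1 +i* p.2.
  have [c [d Jp]] := J s0 p1.
  (* With remainders of size [e / 4 t^2] the four-point sum of [Re Q] falls below four times the
     central value by at most [e t^2], whereas maximality of the perturbed function demands a drop
     of at least [2 e t^2]. *)
  have e4 : 0 < e / 4 by rewrite divr_gt0.
  have [r r0 Hr] := Jp _ e4.
  set t := Num.min r (Num.min (p.1 - a) (b - p.1)).
  have t0 : 0 < t by rewrite !lt_min r0 !subr_gt0 pa.
  have tr : t <= r by rewrite ge_min lexx.
  have ta : t <= p.1 - a by rewrite !ge_min lexx orbT.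
  have tb : t <= b - p.1 by rewrite !ge_min lexx !orbT.
  pose rem h := Re (Q (s0 + h) - Q s0 - c * h - d * h ^+ 2).
  have remle h : normc h = t -> - (e / 4 * t ^+ 2) <= rem h.
    move=> ht; have := le_trans (normr_Re _) (Hr h _); rewrite ht tr => /(_ isT).
    by rewrite ler_norml => /andP[].
  have n1 : normc (t%:C) = t by rewrite normc_real gtr0_norm.
  have n2 : normc (0 +i* t) = t by rewrite normc_imag gtr0_norm.
  have r1 := remle _ n1.
  have := remle (- t%:C); rewrite normcN => /(_ n1) r2.
  have r3 := remle _ n2.
  have := remle (- (0 +i* t)); rewrite normcN => /(_ n2) r4.
  have sumE : rem t%:C + rem (- t%:C) + rem (0 +i* t) + rem (- (0 +i* t)) =
    Re (Q (s0 + t%:C)) + Re (Q (s0 - t%:C)) + Re (Q (s0 + (0 +i* t)))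
      + Re (Q (s0 - (0 +i* t))) - 4 * Re (Q s0).
    rewrite /rem -!ReD.
    have -> : 4 * Re (Q s0) = Re (4 * Q s0).
      by rewrite -(real_complex_nat R 4) ReZ.
    rewrite -ReN -ReD; congr Re.
    have -> : (0 +i* t) = 'i * t%:C.
      by apply: complexP; rewrite !ReImE/=; ring.
    have i2 : 'i * 'i = -1 :> R[i] by rewrite -expr2 sqr_i.
    have -> : ('i * t%:C) ^+ 2 = - t%:C ^+ 2 by rewrite exprMn expr2 i2 mulN1r.
    have -> : (- ('i * t%:C)) ^+ 2 = - t%:C ^+ 2 by rewrite sqrrN exprMn expr2 i2 mulN1r.
    ring.
  have m1 := pmax (p.1 + t) p.2; have m2 := pmax (p.1 - t) p.2.
  have m3 := pmax p.1 (p.2 + t); have m4 := pmax p.1 (p.2 - t).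
  have e1 : (p.1 + t) +i* p.2 = s0 + t%:C by apply: complexP; rewrite !ReImE/= ?addr0.
  have e2 : (p.1 - t) +i* p.2 = s0 - t%:C by apply: complexP; rewrite !ReImE/= ?subr0.
  have e3 : p.1 +i* (p.2 + t) = s0 + (0 +i* t) by apply: complexP; rewrite !ReImE/= ?addr0.
  have e5 : p.1 +i* (p.2 - t) = s0 - (0 +i* t) by apply: complexP; rewrite !ReImE/= ?subr0.
  rewrite /f/= -!expr2 e1 -/s0 in m1; rewrite /f/= -!expr2 e2 -/s0 in m2.
  rewrite /f/= -!expr2 e3 -/s0 in m3; rewrite /f/= -!expr2 e5 -/s0 in m4.
  have {}m1 : Re (Q (s0 + t%:C)) + e * (p.1 + t) ^+ 2 <= Re (Q s0) + e * p.1 ^+ 2.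
    by apply: m1; clear -p1 t0 tb; lra.
  have {}m2 : Re (Q (s0 - t%:C)) + e * (p.1 - t) ^+ 2 <= Re (Q s0) + e * p.1 ^+ 2.
    by apply: m2; clear -p1 t0 ta; lra.
  have {}m3 := m3 p1; have {}m4 := m4 p1.
  have sq : e * (p.1 + t) ^+ 2 + e * (p.1 - t) ^+ 2 = 2 * (e * p.1 ^+ 2) + 2 * (e * t ^+ 2) by ring.
  have t2 : 0 < e * t ^+ 2 by rewrite mulr_gt0 ?exprn_gt0.
  have e4t : e / 4 * t ^+ 2 = e * t ^+ 2 / 4 by ring.
  rewrite e4t in r1 r2 r3 r4.
  lra.
apply: le_trans fpM; apply: le_trans (pmax (Re s) (Im s) sab).
rewrite /f/=; have -> : Re s +i* Im s = s by apply: complexP.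
by rewrite lerDl mulr_ge0 ?(ltW e0)// -expr2 sqr_ge0.
Qed.

(** Here [psi] is a branch of [g^-1 o f]. Its increment [k] satisfies
    [a k + b k^2 = al h + be h^2 + o(h^2)], from which both coefficients are read off; the Lipschitz
    hypothesis provides the initial information [k = O(h)]. *)
Lemma jet2_implicit (f g psi : R[i] -> R[i]) (sigma s a b al be : R[i]) (C d : R) :
  psi sigma = s -> a != 0 -> jet2 g s a b -> jet2 f sigma al be -> 0 <= C -> 0 < d ->
  (forall h, normc h <= d -> g (psi (sigma + h)) = f (sigma + h) /\
     normc (psi (sigma + h) - s) <= C * normc (f (sigma + h) - f sigma)) ->
  jet2 psi sigma (al / a) ((be - b * (al / a) ^+ 2) / a).
Proof.
move=> es a0 Jg Jf C0 d0 H.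
have gf : g s = f sigma.
  have [|] := H 0; first by rewrite normc0 ltW.
  by rewrite addr0 es.
have [L [dL [L0 dL0 HL]]] := jet2_lipschitz Jf.
set m := al / a; set P := C * L; set na := normc a.
have na0 : 0 < na by rewrite normc_gt0.
have P0 : 0 <= P by rewrite mulr_ge0// ltW.
have [d1 d10 H1] := Jg 1 ltr01; have [d2 d20 H2] := Jf 1 ltr01.
(* [W] is the constant in [|k - m h| <= W |h|^2], obtained from the expansions with remainders at
   most [|k|^2] and [|h|^2]. *)
set W := (normc be + 1 + P ^+ 2 + normc b * P ^+ 2) / na.
have W0 : 0 <= W.
  by rewrite divr_ge0 ?(ltW na0)// !addr_ge0 ?normc_ge0 ?sqr_ge0// mulr_ge0 ?normc_ge0 ?sqr_ge0.
move=> e e0.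
set e' := e * na / (2 * (1 + P ^+ 2)).
have P21 : 0 < 1 + P ^+ 2 by rewrite ltr_wpDr ?sqr_ge0.
have e'0 : 0 < e' by rewrite divr_gt0 ?mulr_gt0.
have [d3 d30 H3] := Jg _ e'0; have [d4 d40 H4] := Jf _ e'0.
(* [V |h|^3] bounds the error in replacing [b k^2] by [b (m h)^2], through the factors [k - m h] and
   [k + m h]. *)
set V := normc b * (W * (P + normc m)).
have V0 : 0 <= V.
  by apply: mulr_ge0; rewrite ?normc_ge0//; apply: mulr_ge0 => //; rewrite addr_ge0 ?normc_ge0.
have P1 : 0 < 1 + P by rewrite ltr_wpDr.
have V1 : 0 < 1 + V by rewrite ltr_wpDr.
exists (Num.min (Num.min (Num.min d dL) (Num.min d2 d4))
  (Num.min (Num.min (d1 / (1 + P)) (d3 / (1 + P))) (e * na / 2 / (1 + V)))).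
  by rewrite !lt_min d0 dL0 d20 d40 !divr_gt0// mulr_gt0.
move=> h; rewrite !le_min => /andP[/andP[/andP[hd hL] /andP[hd2 hd4]]].
rewrite !ler_pdivlMr// => /andP[/andP[hd1 hd3] hV].
have [gp pf] := H h hd.
set k := psi (sigma + h) - s in pf.
have pk : psi (sigma + h) = s + k by rewrite /k; ring.
have h0 := normc_ge0 h.
have kP : normc k <= P * normc h.
  apply: le_trans pf _; rewrite -mulrA ler_wpM2l//; exact: HL.
have Ph : P * normc h <= normc h * (1 + P).
  by rewrite mulrDr mulr1 mulrC lerDr.
have kd1 : normc k <= d1 by apply: le_trans kP _; apply: le_trans Ph hd1.
have kd3 : normc k <= d3 by apply: le_trans kP _; apply: le_trans Ph hd3.
have k2 : normc k ^+ 2 <= P ^+ 2 * normc h ^+ 2.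
  by rewrite -exprMn lerXn2r ?nnegrE ?normc_ge0// mulr_ge0.
have {}H1 := H1 _ kd1; have {}H3 := H3 _ kd3.
have {}H2 := H2 _ hd2; have {}H4 := H4 _ hd4.
set r1 := g (s + k) - g s - a * k - b * k ^+ 2 in H1 H3.
set r2 := f (sigma + h) - f sigma - al * h - be * h ^+ 2 in H2 H4.
have eqn : a * k + b * k ^+ 2 + r1 = al * h + be * h ^+ 2 + r2.
  have -> : a * k + b * k ^+ 2 + r1 = g (s + k) - g s by rewrite /r1; ring.
  by rewrite -pk gp gf /r2; ring.
have kmh : k - m * h = (be * h ^+ 2 + r2 - r1 - b * k ^+ 2) / a.
  apply: (mulfI a0); rewrite [RHS]mulrC divfK// mulrBr /m.
  have -> : a * (al / a * h) = al * h by field.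
  have -> : a * k = al * h + be * h ^+ 2 + r2 - r1 - b * k ^+ 2.
    by rewrite -eqn; ring.
  ring.
have kmh_le : normc (k - m * h) <= W * normc h ^+ 2.
  rewrite kmh normcM normcV -/na mulrC /W mulrAC [leRHS]mulrC ler_wpM2l ?invr_ge0 ?(ltW na0)//.
  apply: le_trans (normcB _ _) _; rewrite mulrDl; apply: lerD; last first.
    by rewrite normcM normcX -mulrA ler_wpM2l ?normc_ge0.
  apply: le_trans (normcB _ _) _; rewrite mulrDl; apply: lerD; last first.
    by apply: le_trans H1 _; rewrite mul1r.
  apply: le_trans (le_normcD _ _) _; rewrite mulrDl; apply: lerD => //.
  by rewrite normcM normcX.
have -> : psi (sigma + h) - psi sigma - m * h - (be - b * m ^+ 2) / a * h ^+ 2 =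
  (r2 - r1 - b * ((k - m * h) * (k + m * h))) / a.
  rewrite es pk; apply: (mulfI a0); rewrite [RHS]mulrC divfK//.
  have -> : a * (s + k - s - m * h - (be - b * m ^+ 2) / a * h ^+ 2) =
    a * (k - m * h) - (be - b * m ^+ 2) * h ^+ 2 by field.
  have -> : a * (k - m * h) = be * h ^+ 2 + r2 - r1 - b * k ^+ 2.
    by rewrite kmh mulrC divfK.
  ring.
rewrite normcM normcV -/na ler_pdivrMr//.
have T1 : normc (r2 - r1) <= e * na / 2 * normc h ^+ 2.
  apply: le_trans (normcB _ _) _.
  apply: (@le_trans _ _ (e' * normc h ^+ 2 + e' * (P ^+ 2 * normc h ^+ 2))).
    by apply: lerD => //; apply: le_trans H3 _; rewrite ler_pM2l.
  have -> : e' * normc h ^+ 2 + e' * (P ^+ 2 * normc h ^+ 2) =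
     e' * (1 + P ^+ 2) * normc h ^+ 2 by ring.
  rewrite ler_wpM2r ?sqr_ge0//.
  have -> // : e' * (1 + P ^+ 2) = e * na / 2.
  by rewrite /e'; field; rewrite gt_eqF.
have T2 : normc (b * ((k - m * h) * (k + m * h))) <= e * na / 2 * normc h ^+ 2.
  apply: (@le_trans _ _ ((normc h * (1 + V)) * normc h ^+ 2)); last first.
    by rewrite ler_wpM2r ?sqr_ge0// ler_pdivlMr.
  apply: (@le_trans _ _ ((normc h * V) * normc h ^+ 2)); last first.
    by rewrite ler_wpM2r ?sqr_ge0// ler_wpM2l// lerDr.
  rewrite normcM.
  have -> : normc h * V * normc h ^+ 2 =
    normc b * ((W * normc h ^+ 2) * ((P + normc m) * normc h)) by rewrite /V; ring.
  rewrite ler_wpM2l ?normc_ge0// normcM ler_pM ?normc_ge0//.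
  by apply: le_trans (le_normcD _ _) _; rewrite mulrDl normcM lerD2r.
apply: le_trans (normcB _ _) _.
have -> : e * normc h ^+ 2 * na = e * na / 2 * normc h ^+ 2 + e * na / 2 * normc h ^+ 2 by field.
exact: lerD.
Qed.

End strip_maximum.

(** * Geometry of the images of starlike maps *)

Section starlike_domains.
Variable R : realType.
Implicit Types (y z s h : R[i]) (x t u v lA : R) (g : R[i] -> R[i]).
Local Notation Re := (@complex.Re R).
Local Notation Im := (@complex.Im R).

Definition sm_image g : set R[i] := [set y | exists2 s, Re s < 0 & g s = y].

Lemma sm_vertical_inj lA g : starlike_map lA g -> forall u t t', u < 0 ->
  Im (g (u +i* t)) = Im (g (u +i* t')) -> t = t'.
Proof.
move=> G u t t' u0 e; have := sm_Re_vertical G t t' u0.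
rewrite e subrr mulr0 pmulr_rle0 ?poisson_lb_gt0// => h.
have : (t' - t) ^+ 2 = 0 by apply/eqP; rewrite eq_le h sqr_ge0.
by move/eqP; rewrite sqrf_eq0 subr_eq0 => /eqP.
Qed.

Lemma sm_star lA g : starlike_map lA g -> forall s x, Re s < 0 -> x <= Re (g s) ->
  exists2 s', Re s' <= Re s & g s' = x +i* Im (g s).
Proof.
move=> G s x s0 xg; have [tau [X [gX _ _ XI]]] := sm_ray G (Im (g s)).
have ts : tau (Re s) = Im s.
  apply: (sm_vertical_inj G s0); rewrite gX//=.
  by congr (Im (g _)); apply: complexP.
have Xs : X (Re s) = Re (g s).
  have := gX _ s0; rewrite ts (_ : Re s +i* Im s = s); last exact: complexP.
  by move=> ->.
have [|v vs Xv] := XI (Re s) x s0; first by rewrite Xs.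
by exists (v +i* tau v) => //; rewrite gX ?Xv//; exact: le_lt_trans s0.
Qed.

Lemma sm_image_star lA g : starlike_map lA g -> forall (y : R[i]) x,
  sm_image g y -> x <= Re y -> sm_image g (x +i* Im y).
Proof.
move=> G y x [s s0 <-] xy; have [s' s's gs'] := sm_star G s0 xy.
by exists s' => //; exact: le_lt_trans s0.
Qed.

(** The image of the line [Re s = -1] meets every height, to the right of the given abscissa by
    [sm_lower]; the leftward ray from there reaches [y]. *)
Lemma sm_image_small lA g : starlike_map lA g -> forall y : R[i],
  Re y <= lA - 1 - 2 * ln 2 -> sm_image g y.
Proof.
move=> G y yl.
have u0 : -1 < 0 :> R by lra.
have [t ht] := sm_angle G (Im y) u0.
have := sm_lower G (s := -1 +i* t) u0 => /= hl.
have [|s' s'l gs'] := sm_star G (s := -1 +i* t) (x := Re y) u0; first by lra.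
exists s'; first exact: le_lt_trans u0.
by rewrite gs' ht; exact: complexP.
Qed.

(* The image of the vertical line through [s1] passes to the right of [g s0], for
   [g] and for every [g'] close to [g] at the single point [s1]. *)
Lemma sm_hurwitz lA g : starlike_map lA g -> forall s0, Re s0 < 0 ->
  exists d s1, [/\ 0 < d, Re s1 < 0 & forall lA' g', starlike_map lA' g' ->
    normc (g' s1 - g s1) <= d -> forall y : R[i], normc (y - g s0) <= d -> sm_image g' y].
Proof.
move=> G s0 s00; have [tau [X [gX Xmono _ _]]] := sm_ray G (Im (g s0)).
have ts : tau (Re s0) = Im s0.
  apply: (sm_vertical_inj G s00); rewrite gX//=.
  by congr (Im (g _)); apply: complexP.
have Xs : X (Re s0) = Re (g s0).
  have := gX _ s00; rewrite ts (_ : Re s0 +i* Im s0 = s0); last exact: complexP.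
  by move=> ->.
set u1 := Re s0 / 2.
have u10 : u1 < 0 by rewrite /u1; lra.
have X1 : X (Re s0) < X u1 by apply: Xmono => //; rewrite /u1; lra.
set c := poisson_lb u1; have c0 : 0 < c := poisson_lb_gt0 u10.
set C := poisson_ub u1; have C0 : 0 < C := poisson_ub_gt0 u10.
(* Error budget: [2 d] for the distances of [y] and of [g' s1] to their models, and [C (2 d / c)]
   for sliding along the vertical line to the height of [y]. In total [d K], the gap [x1] between
   the two abscissas. *)
set K := 2 + 2 * (C / c).
have Cc0 : 0 < C / c by exact: divr_gt0.
have K0 : 0 < K by rewrite /K; lra.
set x1 := X u1 - X (Re s0).
have x10 : 0 < x1 by rewrite subr_gt0.
exists (x1 / K), (u1 +i* tau u1); split => //; first exact: divr_gt0.
set d := x1 / K => lA' g' G' gd y yd.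
have d0 : 0 < d by exact: divr_gt0.
have dK : d * 2 + 2 * (C / c * d) = x1.
  have <- : d * K = x1 by rewrite divfK// gt_eqF.
  by rewrite /K; ring.
have [t ht] := sm_angle G' (Im y) u10.
have g1 := gX _ u10.
have h1 : c * `|t - tau u1| <= 2 * d.
  have h2 := sm_Re_vertical G' (tau u1) t u10; rewrite -/c in h2.
  have h3 : `|Im (g' (u1 +i* t)) - Im (g' (u1 +i* tau u1))| <= 2 * d.
    have e1 := le_trans (normr_Im _) yd; have e2 := le_trans (normr_Im _) gd.
    move: e1 e2; rewrite g1 !ImD !ImN/= ht !ler_norml => /andP[? ?] /andP[? ?].
    by apply/andP; split; lra.
  have [->|n0] := eqVneq t (tau u1).
    by rewrite subrr normr0 mulr0; lra.
  apply: le_trans h3; rewrite -(@ler_pM2l _ `|t - tau u1|) ?normr_gt0 ?subr_eq0//.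
  rewrite -normrM; apply: le_trans (ler_norm _); apply: le_trans h2.
  by rewrite mulrCA -expr2 real_normK ?num_real.
have h2 : normc (g' (u1 +i* t) - g' (u1 +i* tau u1)) <= 2 * (C / c * d).
  apply: le_trans (sm_lip_vertical G' _ _ u10) _; rewrite -/C.
  have -> : 2 * (C / c * d) = C * (2 * d / c) by field; rewrite gt_eqF.
  by rewrite ler_pM2l// ler_pdivlMr// mulrC.
have h3 : Re y <= Re (g' (u1 +i* t)).
  have e1 := le_trans (normr_Re _) yd; have e2 := le_trans (normr_Re _) gd.
  have e3 := le_trans (normr_Re _) h2.
  move: e1 e2 e3; rewrite g1 !ReD !ReN/= -Xs !ler_norml => /andP[? ?] /andP[? ?] /andP[? ?].
  rewrite /x1 in dK; lra.
have [s' s'l gs'] := sm_star G' (s := u1 +i* t) u10 h3.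
exists s'; first exact: le_lt_trans u10.
by rewrite gs' ht; exact: complexP.
Qed.

(** No continuity of [psi] is assumed, only that it selects preimages in the half plane:
    [sm_inv_lipschitz] supplies the Lipschitz estimate that [jet2_implicit] requires. Pointwise
    choice is therefore enough to build inverse branches. *)
Lemma sm_inverse_jet lA g : starlike_map lA g ->
  forall (f psi : R[i] -> R[i]) (sig al be : R[i]) (d : R), jet2 f sig al be -> 0 < d ->
  (forall h, normc h <= d -> Re (psi (sig + h)) < 0 /\ g (psi (sig + h)) = f (sig + h)) ->
  exists a b, jet2 psi sig a b.
Proof.
move=> G f psi sig al be d Jf d0 H.
have [s0 gs] : Re (psi sig) < 0 /\ g (psi sig) = f sig.
  by have := H 0; rewrite normc0 addr0; apply; exact: ltW.
have [a [b [Jg a1 _]]] := sm_jet G s0.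
have a0 : a != 0.
  apply: contraTneq a1 => ->; rewrite -ltNge; exact: poisson_lb_gt0.
have [L [dL [L0 dL0 HL]]] := jet2_lipschitz Jf.
set c := poisson_lb (Re (psi sig) / 2).
have c0 : 0 < c by apply: poisson_lb_gt0; lra.
set k := c * (- Re (psi sig) / 2).
have k0 : 0 < k by rewrite mulr_gt0//; lra.
exists (al / a), ((be - b * (al / a) ^+ 2) / a).
apply: (@jet2_implicit R f g psi sig (psi sig) a b al be c^-1
  (Num.min (Num.min d dL) (k / 2 / L))) => //; first by rewrite invr_ge0 ltW.
  by rewrite !lt_min d0 dL0 !divr_gt0.
move=> h; rewrite !le_min => /andP[/andP[hd hL]]; rewrite ler_pdivlMr// => hk.
have [sh0 gsh] := H h hd; split => //.
rewrite -gsh -gs mulrC ler_pdivlMr// mulrC; apply: (sm_inv_lipschitz G) => //.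
rewrite gsh gs -/c -/k; apply: le_lt_trans (HL _ hL) _; rewrite mulrC; lra.
Qed.

(* Near a boundary point of the image of [g], the level [- Re (g'^-1)] of a map
   [g'] close to [g] is bounded below on a small disc; the annulus barrier
   [log (rho / |y - y1|)] propagates this bound to the boundary point, where
   [- Re (g^-1)] vanishes. *)
Lemma sm_nonkernel lA g : starlike_map lA g -> forall (y : R[i]) (d : R), ~ sm_image g y -> 0 < d ->
  exists e s1 s2, [/\ 0 < e, Re s1 < 0, Re s2 < 0 &
    forall lA' g', starlike_map lA' g' ->
      normc (g' s1 - g s1) <= e -> normc (g' s2 - g s2) <= e ->
      ~ (forall y' : R[i], normc (y' - y) <= d -> sm_image g' y')].
Proof.
move=> G y d yg d0.
have [tau [X [gX Xmono _ XI]]] := sm_ray G (Im y).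
have Xy u : u < 0 -> X u < Re y.
  move=> u0; rewrite ltNge; apply/negP => yX.
  have [v vu Xv] := XI u (Re y) u0 yX.
  apply: yg; exists (v +i* tau v); first exact: le_lt_trans u0.
  by rewrite gX ?Xv ?(le_lt_trans vu)//; exact: complexP.
pose S : set R := [set X u | u in [set u : R | u < 0]].
have S0 : S !=set0 by exists (X (-1)), (-1) => //=; lra.
have Sub : ubound S (Re y) by move=> _ [u u0 <-]; exact/ltW/Xy.
have Ss : has_sup S by split => //; exists (Re y).
(* The point of abscissa [H] at the height of [y] is the boundary point met by the leftward ray from
   [y]; the argument takes place there. *)
set H := sup S.
have Hy : H <= Re y by exact: ge_sup.
have XH u : u < 0 -> X u <= H by move=> u0; apply: ub_le_sup; [exists (Re y)|exists u].
have d4 : 0 < d / 4 by rewrite divr_gt0.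
have [_ [u1 /= u10 <-] hu1] := sup_adherent d4 Ss.
rewrite -/H in hu1.
set s1 := u1 +i* tau u1; set c1 := poisson_lb (u1 / 2).
have u120 : u1 / 2 < 0 by lra.
have c10 : 0 < c1 by exact: poisson_lb_gt0.
set m : R := - u1 / 2; have m0 : 0 < m by rewrite /m; lra.
set kap := Num.min (c1 * m / 2) (d / 16).
have kap0 : 0 < kap.
  have cm0 : 0 < c1 * m by exact: mulr_gt0.
  by rewrite lt_min; apply/andP; split; lra.
have kd : kap <= d / 16 by rewrite ge_min lexx orbT.
have kc : kap <= c1 * m / 2 by rewrite ge_min lexx.
(* The centre [y1] is within [d / 16 + d / 4] of the boundary point, so the disc of radius
   [rho2 = 11 d / 16] about it stays in the disc of radius [d]. The barrier uses the smaller [rho],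
   which leaves room for expansions at its outer circle; [g' s2] is within [3 d / 8] of [y1]. *)
set rho := 5 * d / 8.
have rho0 : 0 < rho by rewrite /rho; lra.
have kr : kap < rho by rewrite /rho; lra.
set rho2 := 11 * d / 16.
have rho20 : 0 < rho2 by rewrite /rho2; lra.
have rr : ln rho < ln rho2 by rewrite ltr_ln ?posrE// /rho /rho2; lra.
set L := ln rho - ln kap.
have L0 : 0 < L by rewrite subr_gt0 ltr_ln ?posrE.
(* [c0] is the value at distance [3 d / 8] of the barrier equal to [m] at [kap] and 0 at [rho]. The
   point [s2] is then taken with [Re s2 > - c0], which the barrier forbids. *)
set c0 : R := m / L * (ln rho - ln (3 * d / 8)).
have c00 : 0 < c0.
  apply: mulr_gt0; first exact: divr_gt0.
  by rewrite subr_gt0 ltr_ln ?posrE// /rho; lra.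
have c0m : c0 <= m.
  rewrite /c0 mulrAC ler_pdivrMr// ler_pM2l// /L lerD2l lerN2 ler_ln ?posrE//; lra.
set u2 := Num.max (u1 / 2) (- c0 / 2).
have u20 : u2 < 0 by rewrite gt_max u120/=; lra.
have u12 : u1 < u2 by rewrite lt_max; apply/orP; left; lra.
have u2c : - c0 < u2 by rewrite lt_max; apply/orP; right; lra.
set s2 := u2 +i* tau u2.
exists (d / 16), s1, s2; split => //; first by rewrite divr_gt0.
move=> lA' g' G' h1 h2 Hd.
have X12 := Xmono _ _ u12 u20.
have X2H := XH _ u20.
pose ys : R[i] := H +i* Im y.
(* Starlikeness moves the covered disc to the left, from [y] to the boundary point. *)
have Hd' y' : normc (y' - ys) <= d -> sm_image g' y'.
  move=> hy'.
  have /(sm_image_star G') : sm_image g' (y' + (Re y - H)%:C).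
    apply: Hd; apply: le_trans hy'; rewrite le_eqVlt; apply/orP; left; apply/eqP.
    by congr normc; apply: complexP; rewrite !ReImE/=; ring.
  move=> /(_ (Re y')); rewrite !ReImE/= addr0.
  have -> : Re y' +i* Im y' = y' by exact: complexP.
  by apply; lra.
set y1 := g' s1.
have g1 : g s1 = X u1 +i* Im y by exact: gX.
have g2 : g s2 = X u2 +i* Im y by exact: gX.
have y1ys : normc (y1 - ys) <= d / 16 + d / 4.
  apply: le_trans (normc_dist (g s1) _ _) _; apply: lerD => //.
  rewrite g1 /ys.
  have -> : (X u1 +i* Im y) - (H +i* Im y) = (X u1 - H)%:C.
    by apply: complexP; rewrite !ReImE/= ?subrr.
  by rewrite normc_real ler_norml; lra.
have y21 : normc (g' s2 - y1) <= 3 * d / 8.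
  apply: le_trans (normc_dist (g s2) _ _) _.
  have : normc (g s2 - y1) <= normc (g s2 - g s1) + normc (g s1 - y1) by exact: normc_dist.
  rewrite (normcBC (g s1)) g1 g2.
  have -> : (X u2 +i* Im y) - (X u1 +i* Im y) = (X u2 - X u1)%:C.
    by apply: complexP; rewrite !ReImE/= ?subrr.
  rewrite normc_real gtr0_norm ?subr_gt0//.
  move: h1 h2; rewrite -/y1 g1 g2 => ? ?; lra.
have inner s : Re s < 0 -> normc (g' s - y1) <= kap -> Re s <= - m.
  move=> s0 hs.
  have hlt : normc (g' s - g' s1) < c1 * m.
    apply: le_lt_trans hs _; apply: le_lt_trans kc _.
    by have cm0 := mulr_gt0 c10 m0; lra.
  have := @sm_inv_lipschitz _ _ _ G' s1 s u10 s0; rewrite -/c1 -/m => /(_ hlt) h3.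
  have : normc (s - s1) <= m.
    rewrite -(@ler_pM2l _ c1)//; apply: le_trans h3 _; exact: ltW.
  move=> /(le_trans (Re_le_normc _)); rewrite !ReImE/= /m; lra.
clear Xy S0 Sub Ss hu1 X12 X2H h1 h2 g1 g2 c10 kc u12 u120 Hd XH Hy XI Xmono yg.
have /choice[psi psiP] : forall sig, exists s, Re sig <= ln rho2 ->
    Re s < 0 /\ g' s = y1 + cexp sig.
  move=> sig; have [hs|_] := leP (Re sig) (ln rho2); last by exists 0.
  have [|s s0 gs] := Hd' (y1 + cexp sig); last by exists s.
  have -> : y1 + cexp sig - ys = (y1 - ys) + cexp sig by ring.
  apply: le_trans (le_normcD _ _) _; rewrite normc_cexp.
  have : expR (Re sig) <= rho2 by rewrite -[rho2]lnK ?posrE// ler_expR.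
  rewrite /rho2; lra.
clear y1ys Hd' kd d4 rho20.
pose Q (sig : R[i]) := psi sig - (m / L)%:C * sig.
have ReQ sig : Re (Q sig) = Re (psi sig) - m / L * Re sig.
  by rewrite /Q ReD ReN ReZ.
have mL : m = m / L * (ln rho - ln kap) by rewrite -/L divfK// gt_eqF.
have mL0 : 0 < m / L by exact: divr_gt0.
have barrier sig : ln kap <= Re sig <= ln rho -> Re (Q sig) <= - (m / L * ln rho).
  move=> hsig; apply: (@strip_max R Q (ln kap) (ln rho)) => //.
  - move=> s /andP[_ sr].
    have [| |a [b J]] := @sm_inverse_jet _ _ G' _ psi s _ _ (ln rho2 - ln rho)
        (jet2_cexp y1 s).
    + by rewrite subr_gt0.
    + move=> h hh; apply: psiP; rewrite ReD; have := Re_le_normc h; lra.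
    + exists (a - (m / L)%:C), (b - 0); apply: jet2_sub => //; exact: jet2_linear.
  - move=> s /andP[_ sr]; rewrite !ReQ ReD/= addr0; congr (_ - _); congr Re.
    have [p1 e1] := psiP s (le_trans sr (ltW rr)).
    have [|p2 e2] := psiP (s + (0 +i* (2 * pi))).
      by rewrite ReD/= addr0; exact: le_trans sr (ltW rr).
    by apply: (sm_inj G') => //; rewrite e1 e2 cexpD2pi.
  - move=> s [] hs; rewrite ReQ hs; last first.
      have [|p1 _] := psiP s; first by rewrite hs ltW.
      lra.
    have [|p1 e1] := psiP s; first by rewrite hs; apply: le_trans (ltW rr); rewrite ler_ln ?posrE// ltW.
    have : Re (psi s) <= - m.
      apply: inner => //; rewrite e1 addrC addKr normc_cexp hs lnK//.
    by rewrite mulrBr in mL; lra.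
have [hk|hk] := leP (normc (g' s2 - y1)) kap.
  by have := inner s2 u20 hk; rewrite /s2/=; lra.
clear inner c0m u10 L0 mL.
have y20 : 0 < normc (g' s2 - y1) by exact: lt_trans hk.
have [sig hsig] := cexp_surj (eq_ind _ is_true y20 _ (normc_gt0 _)).
have Resig : Re sig = ln (normc (g' s2 - y1)) by rewrite -hsig normc_cexp expRK.
have sig1 : ln kap <= Re sig by rewrite Resig ler_ln ?posrE// ltW.
have sig2 : Re sig <= ln (3 * d / 8) by rewrite Resig ler_ln ?posrE//; lra.
have rr3 : ln (3 * d / 8) < ln rho.
  by rewrite ltr_ln ?posrE ?divr_gt0 ?mulr_gt0// /rho; clear -d0; lra.
have [|p1 e1] := psiP sig; first by lra.
have psis2 : psi sig = s2.
  by apply: (sm_inj G') => //; rewrite e1 hsig; ring.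
have := barrier sig; rewrite ReQ psis2 /= => hb.
have {}hb : u2 - m / L * Re sig <= - (m / L * ln rho) by apply: hb; lra.
have hc0 : c0 <= m / L * (ln rho - Re sig) by rewrite /c0 ler_pM2l//; lra.
rewrite mulrBr in hc0; lra.
Qed.

(* Schwarz lemma for [psi = g^-1 \o f]: the maximum principle is applied to
   [psi z - (1 - dl) z], which is negative far to the left. *)
Lemma sm_lindelof lA g (f : R[i] -> R[i]) (B : R) : starlike_map lA g ->
  (forall s, Re s < 0 -> exists c d, jet2 f s c d) ->
  (forall s, Re s < 0 -> f (s + (0 +i* (2 * pi))) = f s + (0 +i* (2 * pi))) ->
  (forall s, Re s <= -1 -> Re (f s) <= Re s + B) ->
  (forall s, Re s < 0 -> sm_image g (f s)) ->
  forall s s', Re s < 0 -> Re s' < 0 -> g s' = f s -> Re s' <= Re s.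
Proof.
move=> G Jf fper fB fim.
have /choice[psi psiP] : forall s, exists s', Re s < 0 -> Re s' < 0 /\ g s' = f s.
  move=> s; have [s0|_] := ltP (Re s) 0; last by exists 0.
  by have [s' s'0 e] := fim s s0; exists s'.
suff key s : Re s < 0 -> Re (psi s) <= Re s.
  move=> s s' s0 s'0 e; have [p0 pe] := psiP s s0.
  by rewrite (_ : s' = psi s) ?key//; apply: (sm_inj G) => //; rewrite e pe.
move=> s0.
(* [e] keeps the right edge inside the open half plane, where [Re psi < 0] is all that is known;
   [dl] gives a linear gain that absorbs the constant [B'] at the left edge. Both are then sent to
   0. *)
suff key2 (e dl : R) : 0 < e -> e <= - Re s -> 0 < dl ->
    Re (psi s) - Re s + dl * Re s <= e.
  apply/ler_addgt0Pr => e e0.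
  set e1 := Num.min (e / 2) (- Re s).
  have e10 : 0 < e1 by rewrite lt_min divr_gt0//=; lra.
  have e1e : e1 <= e / 2 by rewrite ge_min lexx.
  have e1s : e1 <= - Re s by rewrite ge_min lexx orbT.
  have dl0 : 0 < e / 2 / (- Re s) by rewrite divr_gt0 ?divr_gt0//; lra.
  have := key2 e1 _ e10 e1s dl0.
  have -> : e / 2 / - Re s * Re s = - (e / 2) by field; lra.
  lra.
move=> e0 es dl0.
set b := Re s in s0 es *.
pose Q z : R[i] := psi z - (1 - dl)%:C * z.
have ReQ z : Re (Q z) = Re (psi z) - (1 - dl) * Re z by rewrite /Q ReD ReN ReZ.
have -> : Re (psi s) - b + dl * b = Re (Q s) by rewrite ReQ -/b; ring.
set B' := B - lA + 2 * ln 2.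
have upper z : Re z <= -1 -> Re (psi z) <= Re z + B'.
  move=> z1; have z0 : Re z < 0 by lra.
  have [p0 pe] := psiP z z0; have := sm_lower G p0; rewrite pe.
  have := fB z z1; rewrite /B'; lra.
(* The left edge must lie in the range of [upper], to the left of [s], and so far that
   [B' + dl a <= 0]. *)
set a := - (Num.max 1 (Num.max (- b) (B' / dl))).
have a1 : a <= - 1 by rewrite /a lerN2 le_max lexx.
have ab : a <= b by rewrite /a lerNl !le_max lexx orbT.
have aB : B' <= dl * (- a).
  by rewrite /a opprK mulrC -ler_pdivrMr// !le_max lexx !orbT.
apply: (@strip_max R Q a (- e)); last by rewrite -/b; lra.
- move=> z /andP[_ ze].
  have z0 : Re z < 0 by lra.
  have [c [d Jz]] := Jf z z0.
  have [| |a' [b' J]] := @sm_inverse_jet _ _ G _ psi z _ _ (e / 2) Jz.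
  + by rewrite divr_gt0.
  + move=> h hh; apply: psiP; rewrite ReD; have := Re_le_normc h; lra.
  + exists (a' - (1 - dl)%:C), (b' - 0); apply: jet2_sub => //; exact: jet2_linear.
- move=> z /andP[_ ze]; have z0 : Re z < 0 by lra.
  rewrite !ReQ ReD/= addr0; congr (_ - _).
  have [p1 e1] := psiP z z0.
  have z20 : Re (z + (0 +i* (2 * pi))) < 0 by rewrite ReD/= addr0.
  have [p2 e2] := psiP _ z20.
  have -> : psi (z + (0 +i* (2 * pi))) = psi z + (0 +i* (2 * pi)).
    apply: (sm_inj G) => //; first by rewrite ReD/= addr0.
    by rewrite e2 fper// (sm_periodic G)// e1.
  by rewrite ReD/= addr0.
- move=> z [] hz; rewrite ReQ hz.
  + by have := upper z; rewrite hz => /(_ a1); lra.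
  + have [|p1 _] := psiP z; first by rewrite hz; lra.
    have : 0 < dl * e by rewrite mulr_gt0.
    lra.
Qed.

End starlike_domains.

(** * Averages of the logarithmic kernel *)

Section expectations.
Variable R : realType.
Implicit Types (z w s h : R[i]) (x y t u : R) (E : (R -> R) -> R).
Local Notation Re := (@complex.Re R).
Local Notation Im := (@complex.Im R).

(* Test functions are parametrized by the angle [phi] with [t = - 2 cos phi];
   only the values on [0, pi] matter. *)
Record expectation E : Prop := Expectation {
  expectD : forall f g : R -> R, continuous f -> continuous g ->
    E (fun x => f x + g x) = E f + E g ;
  expectZ : forall a (f : R -> R), continuous f -> E (fun x => a * f x) = a * E f ;
  expect_le : forall f g : R -> R, continuous f -> continuous g ->
    (forall x, 0 <= x <= pi -> f x <= g x) -> E f <= E g ;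
  expect1 : E (fun=> 1) = 1 }.

Definition ccontinuous (f : R -> R[i]) :=
  continuous (fun x => Re (f x)) /\ continuous (fun x => Im (f x)).

Lemma ccontinuous_cst z : ccontinuous (fun=> z).
Proof. by split => x; exact: cvg_cst. Qed.

Lemma ccontinuousD f g : ccontinuous f -> ccontinuous g ->
  ccontinuous (fun x => f x + g x).
Proof.
move=> [f1 f2] [g1 g2]; split => x.
- under eq_fun do rewrite ReD; apply: cvgD; [exact: f1|exact: g1].
- under eq_fun do rewrite ImD; apply: cvgD; [exact: f2|exact: g2].
Qed.

Lemma ccontinuousM f g : ccontinuous f -> ccontinuous g ->
  ccontinuous (fun x => f x * g x).
Proof.
move=> [f1 f2] [g1 g2]; split => x.
- under eq_fun do rewrite ReM.
  by apply: cvgB; apply: cvgM; [exact: f1|exact: g1|exact: f2|exact: g2].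
- under eq_fun do rewrite ImM.
  by apply: cvgD; apply: cvgM; [exact: f1|exact: g2|exact: f2|exact: g1].
Qed.

Lemma ccontinuousZ z f : ccontinuous f -> ccontinuous (fun x => z * f x).
Proof. by move=> ?; apply: ccontinuousM => //; exact: ccontinuous_cst. Qed.

Lemma ccontinuousB f g : ccontinuous f -> ccontinuous g ->
  ccontinuous (fun x => f x - g x).
Proof.
move=> cf cg; have := ccontinuousD cf (ccontinuousZ (-1) cg).
by under [X in ccontinuous X -> _]eq_fun do rewrite mulN1r.
Qed.

Lemma ccontinuous_conj f : ccontinuous f -> ccontinuous (fun x => (f x)^*).
Proof.
move=> [f1 f2]; split => x.
- under eq_fun do rewrite ReJ; exact: f1.
- under eq_fun do rewrite ImJ; apply: cvgN; exact: f2.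
Qed.

Lemma ccontinuous_line : ccontinuous (fun x => 0 +i* x).
Proof. by split => x; [exact: cvg_cst|exact: cvg_id]. Qed.

Lemma continuous_sqr_ReIm f : ccontinuous f ->
  continuous (fun x => Re (f x) ^+ 2 + Im (f x) ^+ 2).
Proof.
move=> [f1 f2] x; under eq_fun do rewrite !expr2.
by apply: cvgD; apply: cvgM; [exact: f1|exact: f1|exact: f2|exact: f2].
Qed.

Lemma ccontinuousV f : ccontinuous f -> (forall x, f x != 0) ->
  ccontinuous (fun x => (f x)^-1).
Proof.
move=> cf f0; have [f1 f2] := cf.
have nc x : (Re (f y) ^+ 2 + Im (f y) ^+ 2)^-1 @[y --> x] -->
    (Re (f x) ^+ 2 + Im (f x) ^+ 2)^-1.
  apply: cvgV; last exact: continuous_sqr_ReIm.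
  by rewrite -normc_sqr sqrf_eq0 gt_eqF// normc_gt0.
split => x.
- by under eq_fun do rewrite ReV; apply: cvgM; [exact: f1|exact: nc].
- under eq_fun do rewrite ImV.
  by apply: cvgM; [apply: cvgN; exact: f2|exact: nc].
Qed.

Lemma ccontinuous_cexp f : ccontinuous f -> ccontinuous (fun x => cexp (f x)).
Proof.
move=> [f1 f2]; split => x.
- under eq_fun do rewrite Re_cexp; apply: cvgM.
    exact: (cvg_comp _ _ (f1 x) (@continuous_expR R _)).
  exact: (cvg_comp _ _ (f2 x) (@continuous_cos R _)).
- under eq_fun do rewrite Im_cexp; apply: cvgM.
    exact: (cvg_comp _ _ (f1 x) (@continuous_expR R _)).
  exact: (cvg_comp _ _ (f2 x) (@continuous_sin R _)).
Qed.

Lemma ccontinuous_clog f : ccontinuous f -> (forall x, 0 < Re (f x)) ->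
  ccontinuous (fun x => clog (f x)).
Proof.
move=> cf f0; have [f1 f2] := cf; split => x; rewrite /clog/=.
- have c := continuous_ln (sqr_ReIm_gt0 (f0 x)).
  by apply: cvgMl; exact: (cvg_comp _ _ (@continuous_sqr_ReIm _ cf x) c).
- have c : Im (f y) / Re (f y) @[y --> x] --> Im (f x) / Re (f x).
    by apply: cvgM; [exact: f2|apply: cvgV; [rewrite gt_eqF|exact: f1]].
  exact: (cvg_comp _ _ c (@continuous_atan R _)).
Qed.

Lemma ccontinuous_1B_cexp f : ccontinuous f -> ccontinuous (fun x => 1 - cexp (f x)).
Proof.
by move=> cf; apply: ccontinuousB; [exact: ccontinuous_cst|exact: ccontinuous_cexp].
Qed.

Lemma ccontinuous_kappa f : ccontinuous f -> (forall x, Re (f x) < 0) ->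
  ccontinuous (fun x => kappa (f x)).
Proof.
move=> cf f0; apply: ccontinuousB.
  by apply: ccontinuousM => //; exact: ccontinuous_cst.
apply: ccontinuous_clog; first exact: ccontinuous_1B_cexp.
by move=> x; exact/Re_1B_gt0/normc_cexp_lt1.
Qed.

Lemma ccontinuous_nu f : ccontinuous f -> (forall x, Re (f x) < 0) ->
  ccontinuous (fun x => nu (f x)).
Proof.
move=> cf f0; apply: ccontinuousM; first exact: ccontinuous_cexp.
by apply: ccontinuousV => [|x]; [exact: ccontinuous_1B_cexp|exact: oneB_cexp_neq0].
Qed.

Definition cexpect E (f : R -> R[i]) : R[i] :=
  E (fun x => Re (f x)) +i* E (fun x => Im (f x)).

Section expectation_theory.
Variable E : (R -> R) -> R.
Hypothesis HE : expectation E.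

Lemma expect_cst c : E (fun=> c) = c.
Proof.
have := @expectZ _ HE c (fun=> 1) (fun x => cvg_cst _).
by rewrite (expect1 HE) mulr1 => h; rewrite -[RHS]h; congr E.
Qed.

Lemma expectB (f g : R -> R) : continuous f -> continuous g ->
  E (fun x => f x - g x) = E f - E g.
Proof.
move=> cf cg.
have := @expectD _ HE f (fun x => -1 * g x) cf (fun x => cvgMr (cg x)).
rewrite (expectZ HE)// mulN1r => <-.
by congr E; apply/funext => x; rewrite mulN1r.
Qed.

Lemma expect_abs_le (f : R -> R) (M : R) : continuous f ->
  (forall x, 0 <= x <= pi -> `|f x| <= M) -> `|E f| <= M.
Proof.
move=> cf fM; rewrite ler_norml; apply/andP; split.
- rewrite -(expect_cst (- M)); apply: (expect_le HE) => // [x|x /fM].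
    exact: cvg_cst.
  by rewrite ler_norml => /andP[].
- rewrite -(expect_cst M); apply: (expect_le HE) => // [x|x /fM].
    exact: cvg_cst.
  by rewrite ler_norml => /andP[].
Qed.

Lemma cexpect_cst z : cexpect E (fun=> z) = z.
Proof. by apply: complexP; rewrite /= expect_cst. Qed.

Lemma cexpectD f g : ccontinuous f -> ccontinuous g ->
  cexpect E (fun x => f x + g x) = cexpect E f + cexpect E g.
Proof.
move=> [f1 f2] [g1 g2]; apply: complexP; rewrite !ReImE/= -(expectD HE)//;
  by congr E; apply/funext => x; rewrite ReImE.
Qed.

Lemma cexpectZ z f : ccontinuous f ->
  cexpect E (fun x => z * f x) = z * cexpect E f.
Proof.
move=> [f1 f2]; apply: complexP; rewrite !ReImE/=.
- rewrite -!(expectZ HE)// -expectB => [|x|x]; last 2 first.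
  + exact: cvgMr (f1 x).
  + exact: cvgMr (f2 x).
  by congr E; apply/funext => x; rewrite ReM.
- rewrite -!(expectZ HE)// -(expectD HE) => [|x|x]; last 2 first.
  + exact: cvgMr (f2 x).
  + exact: cvgMr (f1 x).
  by congr E; apply/funext => x; rewrite ImM.
Qed.

Lemma cexpectB f g : ccontinuous f -> ccontinuous g ->
  cexpect E (fun x => f x - g x) = cexpect E f - cexpect E g.
Proof.
move=> cf cg; rewrite -mulN1r -cexpectZ// -cexpectD//; last exact: ccontinuousZ.
by congr cexpect; apply/funext => x; rewrite mulN1r.
Qed.

Lemma cexpectJ f : ccontinuous f ->
  cexpect E (fun x => (f x)^*) = (cexpect E f)^*.
Proof.
move=> [f1 f2]; apply: complexP; rewrite ?ReJ ?ImJ/=.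
  by congr E; apply/funext => x; rewrite ReJ.
rewrite -mulN1r -(expectZ HE)//.
by congr E; apply/funext => x; rewrite ImJ mulN1r.
Qed.

(** Testing against the conjugate of the mean [k] itself gives [|k|^2 = E (Re (conj k f)) <= |k| M],
    without the loss of a bound by components. *)
Lemma cexpect_le f (M : R) : ccontinuous f ->
  (forall x, 0 <= x <= pi -> normc (f x) <= M) -> normc (cexpect E f) <= M.
Proof.
move=> cf fM; set k := cexpect E f.
have [->|k0] := eqVneq k 0.
  by rewrite normc0; apply: le_trans (fM 0 _); rewrite ?normc_ge0// lexx pi_ge0.
have n0 : 0 < normc k by rewrite normc_gt0.
rewrite -(@ler_pM2l _ (normc k))// -expr2.
have -> : normc k ^+ 2 = Re (k^* * k) by rewrite mulcJ.
rewrite {2}/k -cexpectZ//= -(expect_cst (normc k * M)).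
have cc := ccontinuousZ k^* cf.
apply: (expect_le HE) => [||x x01]; [exact: cc.1|by move=> x; exact: cvg_cst|].
apply: le_trans (Re_scal_le _ _) _; rewrite ler_pM2l//; exact: fM.
Qed.

Lemma Re_cexpect_ge f (m : R) : ccontinuous f ->
  (forall x, 0 <= x <= pi -> m <= Re (f x)) -> m <= Re (cexpect E f).
Proof.
move=> [f1 f2] fm; rewrite /= -[m]expect_cst.
by apply: (expect_le HE) => // x; exact: cvg_cst.
Qed.

End expectation_theory.

Definition kernel (k : R[i] -> R[i]) s x : R[i] := k (s + (0 +i* x)) + k (s - (0 +i* x)).

Definition gmap (lA : R) E s : R[i] := lA%:C + cexpect E (kernel (@kappa R) s).

Lemma Re_kernel_arg s x : Re (s + (0 +i* x)) = Re s /\ Re (s - (0 +i* x)) = Re s.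
Proof. by rewrite !ReImE/= addr0 subr0. Qed.

Lemma ccontinuous_kernel (k : R[i] -> R[i]) s : Re s < 0 ->
  (forall f, ccontinuous f -> (forall x, Re (f x) < 0) -> ccontinuous (fun x => k (f x))) ->
  ccontinuous (kernel k s).
Proof.
move=> s0 H; apply: ccontinuousD; apply: H => [|x];
  try by have [e1 e2] := Re_kernel_arg s x; rewrite ?e1 ?e2.
- by apply: ccontinuousD; [exact: ccontinuous_cst|exact: ccontinuous_line].
- by apply: ccontinuousB; [exact: ccontinuous_cst|exact: ccontinuous_line].
Qed.

Lemma ccontinuous_kernel_kappa s : Re s < 0 -> ccontinuous (kernel (@kappa R) s).
Proof. by move=> s0; apply: ccontinuous_kernel => //; exact: ccontinuous_kappa. Qed.

Lemma ccontinuous_kernel1 s : Re s < 0 -> ccontinuous (kernel (@kappa1 R) s).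
Proof.
move=> s0; apply: ccontinuous_kernel => // f cf f0.
by apply: ccontinuousD; [exact: ccontinuous_cst|exact: ccontinuous_nu].
Qed.

Lemma ccontinuous_kernel2 s : Re s < 0 -> ccontinuous (kernel (@kappa2 R) s).
Proof.
move=> s0; apply: ccontinuous_kernel => // f cf f0.
have cn := ccontinuous_nu cf f0.
apply: ccontinuousM; last exact: ccontinuous_cst.
by apply: ccontinuousD => //; under eq_fun do rewrite expr2; exact: ccontinuousM.
Qed.

(** Every property passes from the kernel to its average. The two halves [s + i x] and [s - i x]
    each contribute [pi i] to the period and are exchanged by conjugation; the expansion can be
    averaged because its cubic remainder is uniform in the angle. *)
Lemma gmap_starlike (lA : R) E : expectation E -> starlike_map lA (gmap lA E).
Proof.
move=> HE; split.
- move=> s s0.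
  have [C [d [C0 d0 H]]] := kappa_jet s0.
  have ck := ccontinuous_kernel_kappa s0.
  have ck1 := ccontinuous_kernel1 s0; have ck2 := ccontinuous_kernel2 s0.
  exists (cexpect E (kernel (@kappa1 R) s)), (cexpect E (kernel (@kappa2 R) s)); split.
  + move=> e e0; set C2 := 2 * C + 1.
    have C20 : 0 < C2 by rewrite /C2; lra.
    exists (Num.min (Num.min d (- Re s / 2)) (e / C2)).
      by rewrite !lt_min d0/=; apply/andP; split; [lra|exact: divr_gt0].
    move=> h; rewrite !le_min => /andP[/andP[hd hs]]; rewrite ler_pdivlMr// => he.
    have sh0 : Re (s + h) < 0 by rewrite ReD; have := Re_le_normc h; lra.
    have ckh := ccontinuous_kernel_kappa sh0.
    have c1 := ccontinuousB ckh ck.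
    have c2 := ccontinuousB c1 (ccontinuousZ h ck1).
    have c3 := ccontinuousZ (h ^+ 2) ck2.
    have -> : gmap lA E (s + h) - gmap lA E s - cexpect E (kernel (@kappa1 R) s) * h -
        cexpect E (kernel (@kappa2 R) s) * h ^+ 2 =
      cexpect E (fun x => kernel (@kappa R) (s + h) x - kernel (@kappa R) s x
         - h * kernel (@kappa1 R) s x - h ^+ 2 * kernel (@kappa2 R) s x).
      rewrite (cexpectB HE c2 c3) (cexpectB HE c1 (ccontinuousZ h ck1)).
      by rewrite (cexpectB HE ckh ck) !(cexpectZ HE)// /gmap; ring.
    apply: (@le_trans _ _ (C2 * normc h ^+ 3)); last first.
      have -> : C2 * normc h ^+ 3 = normc h * C2 * normc h ^+ 2 by ring.
      by rewrite ler_wpM2r ?sqr_ge0.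
    apply: (cexpect_le HE) => [|x _]; first exact: ccontinuousB.
    have [r1 r2] := Re_kernel_arg s x.
    have := H (s + (0 +i* x)) h; have := H (s - (0 +i* x)) h.
    rewrite r1 r2 lexx => /(_ isT hd) h1 /(_ isT hd) h2.
    rewrite /kernel.
    have -> : s + h + (0 +i* x) = s + (0 +i* x) + h by ring.
    have -> : s + h - (0 +i* x) = s - (0 +i* x) + h by ring.
    set k1 := normc _ in h1; set k2 := normc _ in h2.
    apply: (@le_trans _ _ (k2 + k1)).
      apply: le_trans (le_normcD _ _); rewrite le_eqVlt; apply/orP; left; apply/eqP.
      by congr normc; ring.
    have := exprn_ge0 3 (normc_ge0 h); rewrite /C2; lra.
  + apply: (Re_cexpect_ge HE) => // x _.
    have [r1 r2] := Re_kernel_arg s x.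
    have := @Re_kappa1_ge R (s + (0 +i* x)); have := @Re_kappa1_ge R (s - (0 +i* x)).
    by rewrite r1 r2 /kernel ReD -/(poisson_lb _) => /(_ s0) h1 /(_ s0) h2; lra.
  + apply: (cexpect_le HE) => // x _.
    have [r1 r2] := Re_kernel_arg s x.
    have := @normc_kappa1_le R (s + (0 +i* x)); have := @normc_kappa1_le R (s - (0 +i* x)).
    rewrite r1 r2 /kernel => /(_ s0) h1 /(_ s0) h2.
    apply: le_trans (le_normcD _ _) _.
    have : 0 < poisson_ub (Re s) by exact: poisson_ub_gt0.
    rewrite /poisson_ub; lra.
- move=> s s0; rewrite /gmap -addrA; congr (_ + _).
  rewrite -[X in _ = _ + X](cexpect_cst HE) -cexpectD//; last 2 first.
    exact: ccontinuous_kernel_kappa.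
    exact: ccontinuous_cst.
  congr cexpect; apply/funext => x; rewrite /kernel.
  have -> : s + (0 +i* (2 * pi)) + (0 +i* x) = s + (0 +i* x) + (0 +i* (2 * pi)) by ring.
  have -> : s + (0 +i* (2 * pi)) - (0 +i* x) = s - (0 +i* x) + (0 +i* (2 * pi)) by ring.
  by rewrite !kappaD2pi; apply: complexP; rewrite !ReImE/=; ring.
- move=> s s0; rewrite /gmap.
  have -> : (lA%:C + cexpect E (kernel (@kappa R) s))^* =
      lA%:C + (cexpect E (kernel (@kappa R) s))^*.
    by apply: complexP; rewrite !(ReJ, ImJ, ReImE)/= ?add0r.
  congr (_ + _); rewrite -(cexpectJ HE); last exact: ccontinuous_kernel_kappa.
  congr cexpect; apply/funext => x; rewrite /kernel.
  have -> : s^* + (0 +i* x) = (s - (0 +i* x))^*.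
    by apply: complexP; rewrite !(ReJ, ImJ, ReImE)/=; ring.
  have -> : s^* - (0 +i* x) = (s + (0 +i* x))^*.
    by apply: complexP; rewrite !(ReJ, ImJ, ReImE)/=; ring.
  by rewrite !kappaJ; apply: complexP; rewrite !(ReJ, ImJ, ReImE); ring.
- move=> s s0; rewrite /gmap ReD/= -addrA lerD2l.
  rewrite -[leRHS]/(Re (cexpect E (kernel (@kappa R) s))).
  apply: (Re_cexpect_ge HE) => [|x _]; first exact: ccontinuous_kernel_kappa.
  have [r1 r2] := Re_kernel_arg s x.
  have := @Re_kappa_ge R (s + (0 +i* x)); have := @Re_kappa_ge R (s - (0 +i* x)).
  by rewrite r1 r2 /kernel ReD => /(_ s0) h1 /(_ s0) h2; lra.
- move=> s hs.
  have s0 : Re s < 0 by rewrite -expR_lt1; apply: le_lt_trans hs _; lra.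
  have -> : gmap lA E s - s - lA%:C = cexpect E (fun x => kernel (@kappa R) s x - s).
    rewrite cexpectB//; last 2 first.
      exact: ccontinuous_kernel_kappa.
      exact: ccontinuous_cst.
    by rewrite cexpect_cst// /gmap; ring.
  apply: (cexpect_le HE) => [|x _].
    apply: ccontinuousD; [exact: ccontinuous_kernel_kappa|exact: ccontinuous_cst].
  have [r1 r2] := Re_kernel_arg s x.
  have := @kappa_asymp R (s + (0 +i* x)); have := @kappa_asymp R (s - (0 +i* x)).
  rewrite r1 r2 /kernel => /(_ hs) h1 /(_ hs) h2.
  set k1 := kappa _; set k2 := kappa _.
  have -> : k1 + k2 - s = (k1 - (s + (0 +i* x)) / 2) + (k2 - (s - (0 +i* x)) / 2) by field.
  apply: le_trans (le_normcD _ _) _; rewrite /k1 /k2.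
  have := expR_gt0 (Re s); lra.
Qed.

End expectations.

(** * Probability measures on the segment as functionals of the angle *)

Section integral_expectation.
Variable R : realType.
Implicit Types (x y t : R).
Local Notation seg := (@segment R).
Local Notation prob := (probability (measurableTypeR R) R).

Definition angle t : R := acos (- t / 2).
Definition of_angle x : R := - 2 * cos x.

Lemma angleK t : -2 <= t <= 2 -> of_angle (angle t) = t.
Proof.
by move=> t2; rewrite /of_angle /angle acosK ?in_itv/=; [field|lra].
Qed.

Lemma of_angleK x : 0 <= x <= pi -> angle (of_angle x) = x.
Proof.
move=> x01; rewrite /of_angle /angle.
have -> : - (- 2 * cos x) / 2 = cos x by field.
by rewrite cosK// in_itv.
Qed.

Lemma angle_itv t : -2 <= t <= 2 -> 0 <= angle t <= pi.
Proof. by move=> t2; rewrite /angle acos_ge0 ?acos_lepi//; lra. Qed.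

Lemma of_angle_itv x : -2 <= of_angle x <= 2.
Proof. by rewrite /of_angle; have := cos_le1 x; have := cos_geN1 x; lra. Qed.

Lemma continuous_of_angle : continuous of_angle.
Proof. by move=> x; apply: cvgMr; exact: continuous_cos. Qed.

Lemma continuous_angle : {within seg, continuous angle}.
Proof.
have := @segment_can_le_continuous R 0 pi of_angle angle (pi_ge0 _).
have e0 : of_angle 0 = -2 by rewrite /of_angle cos0 mulr1.
have e1 : of_angle pi = 2 by rewrite /of_angle cospi mulrN1 opprK.
rewrite e0 e1; apply.
- exact/continuous_subspaceT/continuous_of_angle.
- by move=> x; rewrite in_itv/= => /of_angleK.
Qed.

Lemma continuous_comp_angle (f : R -> R) : continuous f ->
  {within seg, continuous (f \o angle)}.
Proof. by move=> cf; apply: within_continuous_comp continuous_angle => x _; exact: cf. Qed.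

Lemma continuous_comp_segment (f c : R -> R) : {within seg, continuous f} ->
  continuous c -> (forall x, -2 <= c x <= 2) -> continuous (f \o c).
Proof.
move=> cf cc c2 x; apply/cvgrPdist_le => e e0.
have segc y : seg (c y) by rewrite /segment/= in_itv/= c2.
have /cvgrPdist_le/(_ e e0) := cf (c x).
move=> h; have {h} : within seg (nbhs (c x)) (fun y => `|f (c x) - f y| <= e).
  by rewrite nbhs_subspace_in.
rewrite /within/= => /cc h.
have {}h : \forall y \near x, seg (c y) -> `|f (c x) - f (c y)| <= e by exact: h.
by near=> y; have := near h y; apply.
Unshelve. all: by end_near. Qed.

Lemma continuous_segment_of_angle (f : R -> R) :
  {within seg, continuous f} -> continuous (f \o of_angle).
Proof.
by move=> cf; apply: continuous_comp_segment => //; [exact: continuous_of_angle|exact: of_angle_itv].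
Qed.

(** Integration against the image of [mu] under [angle]. *)
Definition integral_expect (mu : prob) (f : R -> R) : R :=
  \int[mu]_(t in seg) f (angle t).

Lemma measurable_segment : measurable (seg : set (measurableTypeR R)).
Proof. exact: measurable_itv. Qed.

Lemma integrable_segment (mu : prob) (f : R -> R) :
  {within seg, continuous f} -> mu.-integrable (seg) (EFin \o f).
Proof.
move=> cf; apply: measurable_bounded_integrable.
- exact: measurable_segment.
- exact: le_lt_trans (probability_le1 _ measurable_segment) (ltry _).
- by apply: measurable_realfun.subspace_continuous_measurable_fun => //; exact: measurable_segment.
- have [M [_ hM]] := compact_bounded (continuous_compact cf (@segment_compact R (-2) 2)).
  exists M; split; first exact: num_real.
  by move=> x Mx t tS; apply: hM Mx _ _; exists t.
Qed.

Lemma integral_expectation (mu : prob) : mu (seg) = 1%E ->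
  expectation (integral_expect mu).
Proof.
move=> mu1; have mS := measurable_segment; split.
- move=> f g cf cg; apply: RintegralD => //; apply: integrable_segment;
    exact: continuous_comp_angle.
- move=> a f cf; apply: RintegralZl => //; apply: integrable_segment;
    exact: continuous_comp_angle.
- move=> f g cf cg fg; apply: le_Rintegral => //.
  + by apply: integrable_segment; exact: continuous_comp_angle.
  + by apply: integrable_segment; exact: continuous_comp_angle.
  + move=> t; rewrite /segment/= in_itv/= => /angle_itv; exact: fg.
- by rewrite /integral_expect Rintegral_cst//= mul1r mu1.
Qed.

Lemma integral_of_angle (mu : prob) (f : R -> R) :
  \int[mu]_(t in seg) f t = integral_expect mu (f \o of_angle).
Proof.
apply: eq_Rintegral => t; rewrite inE /segment/= in_itv/= => t2.
by rewrite angleK.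
Qed.

Lemma eq_integral_angle (mu : prob) (f g : R -> R) :
  (forall x, 0 <= x <= pi -> f (of_angle x) = g x) ->
  \int[mu]_(t in seg) f t = integral_expect mu g.
Proof.
move=> fg; apply: eq_Rintegral => t; rewrite inE /segment/= in_itv/= => t2.
by rewrite -fg ?angle_itv// angleK.
Qed.

End integral_expectation.

(** * Identification of [w] and [F] with the averaged kernel *)

Section conformal_map.
Variable R : realType.
Implicit Types (z w s h : R[i]) (x t : R).
Local Notation Re := (@complex.Re R).
Local Notation Im := (@complex.Im R).
Local Notation seg := (@segment R).
Local Notation prob := (probability (measurableTypeR R) R).

(** By symmetry and periodicity [g] maps the lines of height 0 and [pi] to themselves; monotonicity
    on vertical segments keeps the points in between strictly between. This is what pins down the
    branch of the logarithm. *)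
Lemma sm_Im_strip lA (g : R[i] -> R[i]) : starlike_map lA g -> forall s,
  Re s < 0 -> 0 < Im s < pi -> 0 < Im (g s) < pi.
Proof.
move=> G s s0 /andP[i0 ip].
have c0 := poisson_lb_gt0 s0.
have sE : Re s +i* Im s = s by exact: complexP.
have g0 : Im (g (Re s +i* 0)) = 0 by exact: (sm_Im_real G s0).
have gp : Im (g (Re s +i* pi)) = pi.
  have h1 := sm_periodic G (s := Re s +i* (- pi)) s0.
  have e1 : (Re s +i* (- pi)) + (0 +i* (2 * pi)) = Re s +i* pi.
    by apply: complexP; rewrite !ReImE/=; ring.
  have e2 : Re s +i* (- pi) = (Re s +i* pi)^* by [].
  rewrite e1 e2 (sm_conj G) // in h1.
  by have := congr1 Im h1; rewrite ImD ImJ/=; lra.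
apply/andP; split.
- have := sm_Re_vertical G 0 (Im s) s0; rewrite g0 sE !subr0 => h.
  rewrite -(@pmulr_rgt0 _ (Im s))//; apply: lt_le_trans h.
  by rewrite mulr_gt0// exprn_gt0.
- have := sm_Re_vertical G (Im s) pi s0; rewrite gp sE => h.
  rewrite -subr_gt0 -(@pmulr_rgt0 _ (pi - Im s)) ?subr_gt0//; apply: lt_le_trans h.
  by rewrite mulr_gt0// exprn_gt0// subr_gt0.
Qed.

(** Point masses. Through them the theory applies to a single kernel, which fixes the branch in
    [cln_lower_kernel]. *)
Lemma eval_expectation x : 0 <= x <= pi -> expectation (fun f : R -> R => f x).
Proof. by move=> x01; split => // f g _ _; apply. Qed.

(** With [zeta = e^s] this is the factorization [t + zeta + 1 / zeta = (1 - e^(i x) zeta) (1 - e^(-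
    i x) zeta) / zeta] for [t = - 2 cos x]. *)
Lemma cexp_kernel s x : Re s < 0 ->
  cexp (- kernel (@kappa R) s x) = (of_angle x)%:C + cexp s + (cexp s)^-1.
Proof.
move=> s0; have [r1 r2] := Re_kernel_arg s x.
have l1 : 0 < Re (1 - cexp (s + (0 +i* x))).
  by apply/Re_1B_gt0/normc_cexp_lt1; rewrite r1.
have l2 : 0 < Re (1 - cexp (s - (0 +i* x))).
  by apply/Re_1B_gt0/normc_cexp_lt1; rewrite r2.
have -> : - kernel (@kappa R) s x =
  - s + clog (1 - cexp (s + (0 +i* x))) + clog (1 - cexp (s - (0 +i* x))).
  by rewrite /kernel /kappa; field.
rewrite (cexpD (- s + _)) (cexpD (- s)) !clogK// cexpN !cexpD cexpN !cexp_imag.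
have z0 := cexp_neq0 s.
have e0 : expi x != 0 :> R[i] by rewrite -cexp_imag cexp_neq0.
have eV : (expi x)^-1 = expi (- x) :> R[i].
  by rewrite -!cexp_imag -cexpN; congr cexp; apply: complexP; rewrite !ReImE/= ?oppr0.
have e2 : expi x + (expi x)^-1 = - (of_angle x)%:C.
  by rewrite eV; apply: complexP; rewrite !ReImE/= /of_angle ?cosN ?sinN; ring.
have <- : - (expi x + (expi x)^-1) = (of_angle x)%:C by rewrite e2 opprK.
by field; rewrite z0.
Qed.

Lemma cln_lower_unique z w : - pi < Im w < 0 -> cexp w = z -> cln_lower z = w.
Proof.
move=> w0 e.
have z0 : Im z < 0.
  rewrite -e Im_cexp pmulr_rlt0 ?expR_gt0// -oppr_gt0 -sinN.
  by apply: sin_gt0_pi; lra.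
have [i0 e'] := cln_lowerP z0.
apply: cexp_inj_strip; last by rewrite e' e.
by rewrite ltr_norml; lra.
Qed.

Definition joukowski s : R[i] := - cexp s - (cexp s)^-1.

Lemma cln_lower_kernel s x : Re s < 0 -> 0 < Im s < pi -> 0 <= x <= pi ->
  cln_lower ((of_angle x)%:C - joukowski s) = - kernel (@kappa R) s x.
Proof.
move=> s0 si x01; apply: cln_lower_unique; last first.
  by rewrite cexp_kernel// /joukowski; ring.
have := sm_Im_strip (gmap_starlike 0 (eval_expectation x01)) s0 si.
have -> : gmap 0 (fun f : R -> R => f x) s = kernel (@kappa R) s x.
  by apply: complexP; rewrite /gmap !ReImE/= add0r.
by rewrite ImN; lra.
Qed.

Lemma w_of_gmap (A : R) (dk : prob) s : dk seg = 1%E -> Re s < 0 -> 0 < Im s < pi ->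
  w_of A dk (joukowski s) = gmap (ln A) (integral_expect dk) s.
Proof.
move=> dk1 s0 si.
have HE := integral_expectation dk1.
have [c1 c2] := ccontinuous_kernel_kappa s0.
rewrite /w_of /gmap; congr (_ + _).
apply: complexP.
- rewrite ReN -[X in - X]/(\int[dk]_(t in seg) Re (cln_lower (t%:C - joukowski s))).
  rewrite (@eq_integral_angle _ dk _ (fun x => -1 * Re (kernel (@kappa R) s x))).
    by rewrite (expectZ HE) ?mulN1r ?opprK.
  by move=> x x01; rewrite cln_lower_kernel// ReN mulN1r.
- rewrite ImN -[X in - X]/(\int[dk]_(t in seg) Im (cln_lower (t%:C - joukowski s))).
  rewrite (@eq_integral_angle _ dk _ (fun x => -1 * Im (kernel (@kappa R) s x))).
    by rewrite (expectZ HE) ?mulN1r ?opprK.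
  by move=> x x01; rewrite cln_lower_kernel// ImN mulN1r.
Qed.

Lemma nbhs_normc (z : Cplx R) (W : set (Cplx R)) :
  nbhs z W <-> exists2 d : R, 0 < d & forall w, normc (w - z) < d -> W w.
Proof.
have normE (w : Cplx R) : `|w| = (normc w)%:C by case: w.
split.
- rewrite -nbhs_nbhs_norm => -[e /= e0 H].
  have eE : e = (Re e)%:C.
    by apply: complexP => //=; move: e0; rewrite ltcE => /andP[/eqP] /=.
  exists (Re e); first by move: e0; rewrite {1}eE ltcR.
  move=> w wz; apply: H; rewrite /ball_ /= distrC normE eE ltcR//.
- move=> [d d0 H]; rewrite -nbhs_nbhs_norm; exists (d%:C) => /=.
    by rewrite ltcR.
  by move=> w; rewrite /ball_ /= distrC normE ltcR => /H.
Qed.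

Lemma disk_normc (z w : Cplx R) (r : R) : disk z r w <-> normc (w - z) < r.
Proof.
have normE (v : Cplx R) : `|v| = (normc v)%:C by case: v.
by rewrite /disk/= normE ltcR.
Qed.

Lemma unit_disk_normc (w : Cplx R) : unit_disk w <-> normc w < 1.
Proof. by rewrite /unit_disk disk_normc subr0. Qed.

Lemma holomorphic_continuous (U : set (Cplx R)) (F : Cplx R -> Cplx R) z :
  holomorphic_on U F -> U z -> forall e : R, 0 < e ->
  exists2 d : R, 0 < d & forall w, normc (w - z) < d -> normc (F w - F z) < e.
Proof.
move=> hF Uz e e0.
have cF : {for z, continuous F}.
  by apply: differentiable_continuous; apply/derivable1_diffP; exact: hF.
have : nbhs (F z) [set w | normc (w - F z) < e].
  by apply/nbhs_normc; exists e.
by move/cF/nbhs_normc.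
Qed.

Lemma unit_disk_cexp s : Re s < 0 -> unit_disk (cexp s).
Proof. by move=> s0; apply/unit_disk_normc/normc_cexp_lt1. Qed.

Section F_theory.
Variables (A : R) (dk : prob) (F : Cplx R -> Cplx R).
Hypotheses (dk1 : dk seg = 1%E) (HF : is_F A dk F).
Let g := gmap (ln A) (integral_expect dk).

Let G : starlike_map (ln A) g.
Proof. exact/gmap_starlike/integral_expectation. Qed.

Let F_upper s : Re s < 0 -> 0 < Im s < pi -> F (cexp s) = cexp (g s).
Proof.
move=> s0 /[dup] si /andP[i0 ip]; have [_ _ ->] := HF.
  by rewrite -[X in w_of _ _ X]/(joukowski s) w_of_gmap.
split; first exact: unit_disk_cexp.
by suff : 0 < Im (cexp s) by []; rewrite Im_cexp mulr_gt0 ?expR_gt0// sin_gt0_pi.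
Qed.

Let F_continuous s (e : R) : Re s < 0 -> 0 < e -> exists2 d : R, 0 < d &
  forall h, normc h < d -> normc (F (cexp (s + h)) - F (cexp s)) < e.
Proof.
move=> s0 e0; have [hF _ _] := HF.
have [d d0 H] := holomorphic_continuous hF (unit_disk_cexp s0) e0.
have K0 := expR_gt0 (1 : R).
exists (Num.min 1 (d / expR 1)); first by rewrite lt_min ltr01 divr_gt0.
move=> h; rewrite lt_min ltr_pdivlMr// => /andP[h1 hd]; apply: H.
have sh : s + h - s = h by ring.
apply: le_lt_trans (cexp_dist _) _; rewrite sh ?(ltW h1)//; apply: le_lt_trans hd.
rewrite -[leRHS]mul1r [_ * expR 1]mulrC ler_wpM2r ?mulr_ge0 ?normc_ge0 ?(ltW K0)//.
exact/ltW/normc_cexp_lt1.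
Qed.

Let cexpg_continuous s (e : R) : Re s < 0 -> 0 < e -> exists2 d : R, 0 < d &
  forall h, normc h < d -> normc (cexp (g (s + h)) - cexp (g s)) < e.
Proof.
move=> s0 e0; have [a [b [J _ _]]] := sm_jet G s0.
have [C [d [C0 d0 H]]] := jet2_lipschitz J.
set n := normc (cexp (g s)).
have n0 : 0 < n by rewrite /n normc_cexp expR_gt0.
have K0 := expR_gt0 (1 : R).
have m0 : 0 < C * (n * expR 1) by rewrite !mulr_gt0.
exists (Num.min d (Num.min (1 / C) (e / (C * (n * expR 1))))).
  by rewrite !lt_min d0 !divr_gt0.
move=> h; rewrite !lt_min => /andP[hd]; rewrite !ltr_pdivlMr// => /andP[h1 he].
set k := g (s + h) - g s.
have kh : normc k <= C * normc h by apply: H; exact: ltW.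
apply: le_lt_trans he; rewrite -/n.
apply: le_trans (cexp_dist _) _; rewrite -/k -/n.
  by apply: le_trans kh _; rewrite mulrC; exact: ltW.
have -> : normc h * (C * (n * expR 1)) = n * (expR 1 * (C * normc h)) by ring.
by rewrite !ler_pM2l.
Qed.

(* On the real diameter [F] is only determined by continuity from above. *)
Let F_closed s : Re s < 0 -> 0 <= Im s <= pi -> F (cexp s) = cexp (g s).
Proof.
move=> s0 /andP[i0 ip].
suff key (e : R) : 0 < e -> normc (F (cexp s) - cexp (g s)) <= e.
  apply/eqP; rewrite -subr_eq0; apply/eqP/eq0_normc/eqP.
  rewrite eq_le normc_ge0 andbT; apply/ler_addgt0Pr => e e0; rewrite add0r; exact: key.
move=> e0; have e2 : 0 < e / 2 by rewrite divr_gt0.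
have [d1 d10 H1] := F_continuous s0 e2.
have [d2 d20 H2] := cexpg_continuous s0 e2.
have p0 := pi_gt0 R.
pose q := Num.min (Num.min d1 d2) (pi : R) / 4.
have q0 : 0 < q by rewrite divr_gt0// !lt_min d10 d20.
have qm : q * 4 = Num.min (Num.min d1 d2) pi by rewrite divfK.
have q1 : q * 4 <= d1 by rewrite qm !ge_min lexx.
have q2 : q * 4 <= d2 by rewrite qm !ge_min lexx orbT.
have q3 : q * 4 <= pi by rewrite qm !ge_min lexx orbT.
(* The perturbation goes up from the lower half of the strip and down from the upper half, so that
   it ends in the open strip. *)
have [sg [sgq si]] : exists sg : R, `|sg| = q /\ 0 < Im s + sg < pi.
  have [hs|hs] := leP (Im s) (pi / 2).
  - by exists q; split; [rewrite gtr0_norm|lra].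
  - by exists (- q); split; [rewrite normrN gtr0_norm|lra].
pose h : R[i] := 0 +i* sg.
have hn : normc h = q by rewrite normc_imag.
have Fs : F (cexp (s + h)) = cexp (g (s + h)).
  by apply: F_upper; rewrite !ReImE/= ?addr0.
have h1 : normc (F (cexp (s + h)) - F (cexp s)) < e / 2 by apply: H1; rewrite hn; lra.
have h2 : normc (cexp (g (s + h)) - cexp (g s)) < e / 2 by apply: H2; rewrite hn; lra.
rewrite normcBC in h1; rewrite -Fs in h2.
have := normc_dist (F (cexp (s + h))) (F (cexp s)) (cexp (g s)); lra.
Qed.

(** The closed strip [0 <= Im s <= pi] covers the upper half disc and the punctured diameter;
    conjugation gives the strip below, and periodicity the rest. *)
Lemma F_cexp s : Re s < 0 -> F (cexp s) = cexp (g s).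
Proof.
move=> s0.
have strip x : - pi <= x <= pi -> F (cexp (Re s +i* x)) = cexp (g (Re s +i* x)).
  move=> x01; have [x0|x0] := leP 0 x; first by apply: F_closed => //=; lra.
  have e1 : Re s +i* x = (Re s +i* (- x))^* by apply: complexP => //=; rewrite opprK.
  have s1 : Re (Re s +i* (- x)) < 0 by [].
  have [_ Fc _] := HF; rewrite e1 cexpJ Fc; last exact: unit_disk_cexp.
  by rewrite (sm_conj G)// cexpJ F_closed//=; lra.
have [k hk] := shift2pi (- pi) (Im s).
have h2 : - pi <= Im s + k%:~R * (2 * pi) <= pi by lra.
have := strip _ h2.
rewrite (@periodic_shift R _ (fun x => F (cexp (Re s +i* x)))); last first.
  move=> t; rewrite -(cexpD2pi (Re s +i* t)); congr (F (cexp _)).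
  by apply: complexP; rewrite !ReImE/= ?addr0.
rewrite (@periodic_shift R _ (fun x => cexp (g (Re s +i* x)))); last first.
  move=> t; have e1 : Re s +i* (t + 2 * pi) = (Re s +i* t) + (0 +i* (2 * pi)).
    by apply: complexP; rewrite !ReImE/= ?addr0.
  have e2 := sm_periodic G (s := Re s +i* t) s0.
  by rewrite e1 e2 cexpD2pi.
by have -> : Re s +i* Im s = s by exact: complexP.
Qed.

(** The origin is not of the form [e^s]; its value is the limit along the negative real axis, where
    [Re g] tends to [-oo]. *)
Lemma F_0 : F 0 = 0.
Proof.
apply: eq0_normc; apply/eqP; rewrite eq_le normc_ge0 andbT.
apply/ler_addgt0Pr => e e0; rewrite add0r.
have e2 : 0 < e / 2 by rewrite divr_gt0.
have [hF _ _] := HF.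
have u0 : unit_disk (0 : Cplx R) by apply/unit_disk_normc; rewrite normc0 ltr01.
have [d d0 H] := holomorphic_continuous hF u0 e2.
pose u := Num.min (-1) (Num.min (ln (d / 2)) (ln (e / 2) - ln A - 8)).
have u1 : u <= -1 by rewrite ge_min lexx.
have u2 : u <= ln (d / 2) by rewrite !ge_min lexx orbT.
have u3 : u <= ln (e / 2) - ln A - 8 by rewrite !ge_min lexx !orbT.
have s0 : Re (u%:C) < 0 by rewrite /=; lra.
have eu : expR u <= 1 / 2 by apply: le_trans (expRN1_half R); rewrite ler_expR.
have h1 : normc (F (cexp u%:C) - F 0) < e / 2.
  apply: H; rewrite subr0 normc_cexp/=.
  apply: (@le_lt_trans _ _ (d / 2)); last by lra.
  by rewrite -[d / 2]lnK ?posrE ?divr_gt0// ler_expR.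
have h2 : normc (F (cexp u%:C)) <= e / 2.
  rewrite F_cexp// normc_cexp -[e / 2]lnK ?posrE// ler_expR.
  have := sm_asymp G (s := u%:C) eu => /(le_trans (Re_le_normc _)); rewrite !ReImE/=.
  lra.
have := lerB_normc (F 0) (F (cexp u%:C)); rewrite normcBC; lra.
Qed.

Lemma F_image : F @` @unit_disk R = [set z | z = 0 \/ exists2 y, sm_image g y & cexp y = z].
Proof.
apply/seteqP; split => z.
- move=> [zeta /unit_disk_normc hz <-].
  have [->|z0] := eqVneq zeta 0; first by left; exact: F_0.
  right; have [s hs] := cexp_surj z0; rewrite -hs in hz *.
  have s0 : Re s < 0 by rewrite -expR_lt1 -normc_cexp.
  by exists (g s); [exists s|rewrite F_cexp].
- move=> [->|[y [s s0 <-] <-]].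
  + by exists 0; [apply/unit_disk_normc; rewrite normc0 ltr01|exact: F_0].
  + by exists (cexp s); [exact: unit_disk_cexp|rewrite F_cexp].
Qed.

End F_theory.

(* [cexp] identifies logarithms up to [2 pi i], under which the image of a
   starlike map is invariant. *)
Lemma sm_image_cexp lA (g : R[i] -> R[i]) : starlike_map lA g -> forall y : R[i],
  (exists2 y', sm_image g y' & cexp y' = cexp y) -> sm_image g y.
Proof.
move=> G y [y' [s s0 gs] e].
have [k hk] := shift2pi (- pi) (Im y' - Im y).
have shift_cexp : cexp (y' + (0 +i* (k%:~R * (2 * pi)))) = cexp y'.
  have := @periodic_shift R _ (fun x => cexp (y' + (0 +i* x))) (2 * pi) _ k 0.
  rewrite add0r => ->; first by congr cexp; apply: complexP; rewrite !ReImE/= ?addr0.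
  move=> x; rewrite -(cexpD2pi (y' + (0 +i* x))); congr cexp.
  by apply: complexP; rewrite !ReImE/=; ring.
have shift_g : g (s + (0 +i* (k%:~R * (2 * pi)))) - (0 +i* (k%:~R * (2 * pi))) = g s.
  have := @periodic_shift R _ (fun x => g (s + (0 +i* x)) - (0 +i* x)) (2 * pi) _ k 0.
  rewrite add0r => -> //.
    have -> : 0 +i* 0 = 0 :> R[i] by [].
    by rewrite addr0 subr0.
  move=> x.
  have -> : s + (0 +i* (x + 2 * pi)) = s + (0 +i* x) + (0 +i* (2 * pi)).
    by apply: complexP; rewrite !ReImE/=; ring.
  rewrite (sm_periodic G); last by rewrite ReD/= addr0.
  by apply: complexP; rewrite !ReImE/=; ring.
exists (s + (0 +i* (k%:~R * (2 * pi)))); first by rewrite ReD/= addr0.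
have -> : g (s + (0 +i* (k%:~R * (2 * pi)))) = y' + (0 +i* (k%:~R * (2 * pi))).
  by rewrite -gs -[in RHS]shift_g subrK.
apply: cexp_inj_strip; last by rewrite shift_cexp.
rewrite !ReImE/= ltr_norml; have := pi_gt0 R; lra.
Qed.

End conformal_map.

(** * Weak convergence from values on the real axis *)

Section extraction.
Variable R : realType.
Implicit Types (x y t : R).

Lemma cvg_sum_ord (T : Type) (F : set_system T) (FF : Filter F) k
    (u : T -> nat -> R) (v : nat -> R) :
  (forall j, (j < k)%N -> u n j @[n --> F] --> v j) ->
  \sum_(j < k) u n j @[n --> F] --> \sum_(j < k) v j.
Proof.
elim: k => [|k IH] H.
  by under eq_fun do rewrite big_ord0; rewrite big_ord0; exact: cvg_cst.
under eq_fun do rewrite big_ord_recr/=; rewrite big_ord_recr/=.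
by apply: cvgD; [apply: IH => j jk; apply: H; exact: ltnW|exact: H].
Qed.

(** Triangular induction: once the coefficients below [k] converge, subtracting them leaves
    [b k y^k] up to [C k y^(k+1)]. One fixes [y] with [C k y <= e / 4] and only then lets [n] grow,
    which is legitimate because [C] does not depend on [n]. *)
Lemma coef_extract (b_ : nat -> nat -> R) (b : nat -> R) (Phi_ : nat -> R -> R)
    (Phi : R -> R) (S : set R) (C : nat -> R) :
  (forall d : R, 0 < d -> exists2 y, S y & 0 < y < d) ->
  (forall y, S y -> Phi_ n y @[n --> \oo] --> Phi y) ->
  (forall k n y, S y -> `|Phi_ n y - \sum_(j < k.+1) b_ n j * y ^+ j| <= C k * y ^+ k.+1) ->
  (forall k y, S y -> `|Phi y - \sum_(j < k.+1) b j * y ^+ j| <= C k * y ^+ k.+1) ->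
  forall k, b_ n k @[n --> \oo] --> b k.
Proof.
move=> S0 Phic H_ H k; elim/ltn_ind: k => k IH.
apply/cvgrPdist_le => e e0.
have e4 : 0 < e / 4 / (1 + `|C k|) by rewrite !divr_gt0// ltr_wpDr.
have [y Sy /andP[y0 yd]] := S0 _ e4.
have yk : 0 < y ^+ k by exact: exprn_gt0.
have Cy : C k * y <= e / 4.
  apply: le_trans (_ : `|C k| * y <= _); first by rewrite ler_wpM2r ?(ltW y0)// ler_norm.
  rewrite ltr_pdivlMr ?ltr_wpDr// in yd; apply: le_trans (ltW yd).
  by rewrite mulrC ler_wpM2l ?(ltW y0)// lerDr.
pose r_ n := Phi_ n y - \sum_(j < k) b_ n j * y ^+ j.
pose r := Phi y - \sum_(j < k) b j * y ^+ j.
have rc : r_ n @[n --> \oo] --> r.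
  apply: cvgB; first exact: Phic.
  apply: (@cvg_sum_ord _ _ _ k (fun n j => b_ n j * y ^+ j) (fun j => b j * y ^+ j)) => j jk.
  by apply: cvgMl; exact: IH.
have ek : 0 < e / 2 * y ^+ k by rewrite mulr_gt0 ?divr_gt0.
near=> n.
have h1 : `|r - r_ n| <= e / 2 * y ^+ k.
  by near: n; move/cvgrPdist_le: rc; exact.
have h2 := H_ k n y Sy; have h3 := H k y Sy.
rewrite big_ord_recr/= opprD addrA -/(r_ n) in h2.
rewrite big_ord_recr/= opprD addrA -/r in h3.
rewrite -(@ler_pM2r _ (y ^+ k))// -[X in _ * X]gtr0_norm// -normrM.
have -> : (b k - b_ n k) * y ^+ k =
  (r_ n - b_ n k * y ^+ k) - (r - b k * y ^+ k) + (r - r_ n) by ring.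
have Ck : C k * y ^+ k.+1 <= e / 4 * y ^+ k.
  by rewrite exprS mulrA ler_pM2r.
apply: le_trans (ler_normD _ _) _.
apply: le_trans (lerD (ler_normB _ _) (lexx _)) _.
have -> : e * y ^+ k = e / 4 * y ^+ k + e / 4 * y ^+ k + e / 2 * y ^+ k by field.
lra.
Unshelve. all: by end_near. Qed.

(** The polynomial has a geometric sum for derivative, so the remainder has derivative
    [x (- t x)^N / (1 + t x)], with denominator at least [1 / 2]. *)
Lemma ln1D_taylor x N : `|x| <= 1 / 2 ->
  `|ln (1 + x) - \sum_(j < N) (- 1) ^+ j * x ^+ j.+1 / j.+1%:R| <= 2 * `|x| ^+ N.+1.
Proof.
move=> x2.
pose q : {poly R} := \sum_(j < N) ((- 1) ^+ j * x ^+ j.+1 / j.+1%:R) *: 'X^(j.+1).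
have x01 t : 0 <= t <= 1 -> `|t * x| <= 1 / 2.
  move=> /andP[t0 t1]; rewrite normrM ger0_norm//; apply: le_trans x2.
  by rewrite ler_piMl.
have dq t : q^`().[t] * (1 + t * x) = x * (1 - (- (t * x)) ^+ N).
  rewrite /q raddf_sum horner_sum mulr_suml.
  elim: N {q} => [|N IH]; first by rewrite big_ord0 expr0 subrr mulr0.
  rewrite big_ord_recr/= IH derivZ derivXn hornerZ hornerMn hornerXn.
  have n0 : N.+1%:R != 0 :> R by rewrite pnatr_eq0.
  have eN : (- (t * x)) ^+ N = (- 1) ^+ N * (t ^+ N * x ^+ N) by rewrite -[- (t * x)]mulN1r !exprMn_comm// /GRing.comm mulrC.
  rewrite [(- (t * x)) ^+ N.+1]exprS eN [x ^+ N.+1]exprS -mulr_natr; field.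
  by rewrite addrC natr1.
have D t : 0 <= t <= 1 -> is_derive t 1 (fun u => ln (1 + x * u) - q.[u])
    (x * (- (t * x)) ^+ N / (1 + t * x)).
  move=> t01; have h := x01 t t01.
  have pos : 0 < 1 + x * t by move: h; rewrite ler_norml mulrC; lra.
  have l1 := is_derive_1D_scale x t.
  have l2 := @is_derive1_comp R (@ln R) _ t _ _ (is_derive1_ln pos) l1.
  have l3 := is_deriveB l2 (is_derive_poly q t).
  apply: is_derive_conv l3 _.
  have pos' : 1 + t * x != 0 by rewrite mulrC gt_eqF.
  apply: (mulIf pos'); rewrite divfK// mulrBl.
  rewrite -[X in _ - X * _]/(q^`().[t]) dq [x * t]mulrC mulrAC mulVf//; ring.
have [t t01] := @mean_value R _ _ D.
rewrite mulr1 mulr0 addr0 ln1.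
have -> : q.[1] = \sum_(j < N) (- 1) ^+ j * x ^+ j.+1 / j.+1%:R.
  by rewrite /q horner_sum; apply: eq_bigr => j _; rewrite hornerZ hornerXn expr1n mulr1.
have -> : q.[0] = 0.
  rewrite /q horner_sum big1// => j _; by rewrite hornerZ hornerXn expr0n/= mulr0.
rewrite subr0 subr0 => ->.
have h := x01 t t01.
have pos : 1 / 2 <= 1 + t * x by move: h; rewrite ler_norml; lra.
rewrite normrM normfV (ger0_norm (_ : 0 <= 1 + t * x)); last by lra.
rewrite ler_pdivrMr; last by lra.
rewrite normrM normrX normrN exprS.
apply: (@le_trans _ _ (`|x| * `|x| ^+ N)).
  rewrite ler_wpM2l// lerXn2r ?nnegrE// normrM ger0_norm; last by case/andP: t01.
  by rewrite ler_piMl//; case/andP: t01.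
have : 0 <= `|x| * `|x| ^+ N by rewrite mulr_ge0// exprn_ge0.
set X := `|x| * _ => X0.
have -> : 2 * X * (1 + t * x) = X * (2 * (1 + t * x)) by ring.
by rewrite ler_peMr//; lra.
Qed.

(* Bernstein polynomials by the recursion on the last Bernoulli trial: [bern n phi x]
   is the mean of [phi] under the binomial law with parameters [n] and [x]. *)
Fixpoint bern n (phi : nat -> R) x : R :=
  if n is m.+1 then x * bern m (fun k => phi k.+1) x + (1 - x) * bern m phi x
  else phi 0%N.

Fixpoint bernp n (phi : nat -> R) : {poly R} :=
  if n is m.+1 then 'X * bernp m (fun k => phi k.+1) + (1 - 'X) * bernp m phi
  else (phi 0%N)%:P.

Lemma horner_bernp n phi x : (bernp n phi).[x] = bern n phi x.
Proof. by elim: n phi => [|n IH] phi /=; rewrite !hornerE// !IH. Qed.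

Lemma bern_le n (phi psi : nat -> R) x : 0 <= x <= 1 ->
  (forall k, (k <= n)%N -> phi k <= psi k) -> bern n phi x <= bern n psi x.
Proof.
move=> /andP[x0 x1]; elim: n phi psi => [|n IH] phi psi H /=; first exact: H.
apply: lerD; apply: ler_wpM2l; rewrite ?subr_ge0//; apply: IH => k kn; apply: H => //.
exact: leqW.
Qed.

Lemma bern_affine n (phi : nat -> R) (a b : R) x :
  bern n (fun k => a + b * phi k) x = a + b * bern n phi x.
Proof. by elim: n phi => [|n IH] phi //=; rewrite !IH; ring. Qed.

(** The centre [a] is arbitrary because a success in the last trial replaces it by [a - 1]. At
    [a = n x] only the variance remains. *)
Lemma bern_moment2 n (a x : R) :
  bern n (fun k => (k%:R - a) ^+ 2) x = (n%:R * x - a) ^+ 2 + n%:R * (x * (1 - x)).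
Proof.
elim: n a => [|n IH] a /=; first by ring.
have -> : (fun k => (k.+1%:R - a) ^+ 2) = (fun k : nat => (k%:R - (a - 1)) ^+ 2).
  by apply/funext => k; rewrite -natr1; ring.
by rewrite !IH -natr1; ring.
Qed.

Lemma uniform_continuity01 (f : R -> R) : continuous f -> forall e : R, 0 < e ->
  exists2 d : R, 0 < d & forall x y, 0 <= x <= 1 -> `|x - y| <= d -> `|f x - f y| <= e.
Proof.
move=> cf e e0.
have e2 : 0 < e / 2 by rewrite divr_gt0.
have /compact_near_coveringP nc := @segment_compact R 0 1.
have := nc R (0^'+) (fun d x => forall y, `|x - y| <= d -> `|f x - f y| <= e) _.
case.
  move=> x _.
  have /cvgrPdist_le/(_ _ e2)/nbhs_normP[r /= r0 Hr] := cf x.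
  have r20 : 0 < r / 2 by rewrite divr_gt0.
  exists (ball x (r / 2), [set d | d < r / 2]) => /=.
    split; first exact: nbhsx_ballx.
    exact: nbhs_right_lt.
  move=> [x' d] /= [xx' dr] y yx.
  rewrite /ball/= in xx'.
  have h1 : `|f x - f x'| <= e / 2 by apply: Hr; rewrite /ball_/=; apply: lt_le_trans xx' _; lra.
  have h2 : `|f x - f y| <= e / 2.
    apply: Hr; rewrite /ball_/=.
    have -> : x - y = (x - x') + (x' - y) by ring.
    apply: le_lt_trans (ler_normD _ _) _; lra.
  have -> : f x' - f y = (f x - f y) - (f x - f x') by ring.
  apply: le_trans (ler_normB _ _) _; lra.
move=> d /= d0 Hd.
exists (d / 2); first by rewrite divr_gt0.
move=> x y x01 xy.
have d20 : 0 < d / 2 by rewrite divr_gt0.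
apply: (Hd (d / 2)) xy => //=.
by rewrite sub0r normrN gtr0_norm//; lra.
Qed.

(** Bernstein's proof by the Chebyshev inequality: [|f x - f (k / N)|] is at most [e / 2] plus a
    multiple of [(k - N x)^2], a bound whose binomial mean is known exactly. *)
Lemma weierstrass01 (f : R -> R) : continuous f -> forall e : R, 0 < e ->
  exists p : {poly R}, forall x, 0 <= x <= 1 -> `|f x - p.[x]| <= e.
Proof.
move=> cf e e0; have e2 : 0 < e / 2 by rewrite divr_gt0.
have [d d0 Hd] := uniform_continuity01 cf e2.
have [M [_ HM]] := compact_bounded (continuous_compact (continuous_subspaceT cf)
  (@segment_compact R 0 1)).
set M1 : R := `|M| + 1.
have M10 : 0 < M1 by rewrite ltr_wpDl.
have fM x : 0 <= x <= 1 -> `|f x| <= M1.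
  move=> x01; apply: (HM M1); last by exists x => //=; rewrite in_itv.
  by rewrite /M1; have := ler_norm M; lra.
(* [K d^2 = 2 M1], so the quadratic term alone dominates [|f x - f (k / N)|] when [k / N] is farther
   than [d] from [x]. *)
set K : R := 2 * M1 / d ^+ 2.
have K0 : 0 < K by rewrite divr_gt0 ?exprn_gt0// mulr_gt0.
have [n nK] : exists n : nat, K / (e / 2) < n.+1%:R.
  exists (Num.truncn (K / (e / 2))).
  by apply: truncnS_gt.
set N := n.+1 in nK.
have N0 : 0 < N%:R :> R by rewrite ltr0n.
exists (bernp N (fun k => f (k%:R / N%:R))) => x x01; rewrite horner_bernp.
have kN k : (k <= N)%N -> 0 <= (k%:R / N%:R : R) <= 1.
  by move=> kn; rewrite divr_ge0//= ler_pdivrMr// mul1r ler_nat.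
have key k : (k <= N)%N ->
    `|f x - f (k%:R / N%:R)| <= e / 2 + K / N%:R ^+ 2 * (k%:R - N%:R * x) ^+ 2.
  move=> kn; have [xk|xk] := leP (`|x - k%:R / N%:R|) d.
    apply: le_trans (Hd _ _ x01 xk) _.
    by rewrite lerDl mulr_ge0 ?sqr_ge0// divr_ge0 ?sqr_ge0// ltW.
  have -> : K / N%:R ^+ 2 * (k%:R - N%:R * x) ^+ 2 = K * (x - k%:R / N%:R) ^+ 2.
    by field; rewrite gt_eqF.
  have h2 : d ^+ 2 <= (x - k%:R / N%:R) ^+ 2.
    rewrite -[leRHS]real_normK ?num_real// lerXn2r ?nnegrE ?(ltW d0)//; exact: ltW.
  have h3 : 2 * M1 <= K * (x - k%:R / N%:R) ^+ 2.
    have -> : 2 * M1 = K * d ^+ 2 by rewrite /K divfK// expf_neq0// gt_eqF.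
    by rewrite ler_pM2l.
  apply: le_trans (ler_normB _ _) _.
  have := fM _ x01; have := fM _ (kN _ kn); lra.
have m2 := bern_moment2 N (N%:R * x) x.
rewrite subrr expr0n add0r in m2.
have var : K / N%:R ^+ 2 * (N%:R * (x * (1 - x))) <= e / 2.
  have -> : K / N%:R ^+ 2 * (N%:R * (x * (1 - x))) = K / N%:R * (x * (1 - x)).
    by field; rewrite gt_eqF.
  apply: (@le_trans _ _ (K / N%:R)).
    rewrite ler_piMr//; first by rewrite divr_ge0 ?(ltW K0)// ltW.
    by nra.
  by rewrite ler_pdivrMr// mulrC -ler_pdivrMr// ltW.
have up := @bern_le N (fun k => f (k%:R / N%:R))
  (fun k => (f x + e / 2) + K / N%:R ^+ 2 * (k%:R - N%:R * x) ^+ 2) x x01.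
have lo := @bern_le N (fun k => (f x - e / 2) + (- (K / N%:R ^+ 2)) * (k%:R - N%:R * x) ^+ 2)
  (fun k => f (k%:R / N%:R)) x x01.
rewrite bern_affine m2 in up; rewrite bern_affine m2 in lo.
have {}up : bern N (fun k => f (k%:R / N%:R)) x <= f x + e / 2 + e / 2.
  apply: le_trans (up _) _ => [k /key|]; last by lra.
  by rewrite ler_norml; lra.
have {}lo : f x - e / 2 - e / 2 <= bern N (fun k => f (k%:R / N%:R)) x.
  apply: le_trans (lo _) => [|k /key]; first by lra.
  by rewrite ler_norml; lra.
by rewrite ler_norml; lra.
Qed.

End extraction.

(** * Moments from the values of [Re g] on the negative axis *)

Section expectation_convergence.
Variable R : realType.
Implicit Types (x y u : R) (E : (R -> R) -> R).
Local Notation Re := (@complex.Re R).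
Local Notation tau := (@of_angle R).

Lemma continuous_sum_ord n (f : nat -> R -> R) : (forall j, continuous (f j)) ->
  continuous (fun x => \sum_(j < n) f j x).
Proof.
move=> cf x; apply: (@cvg_sum_ord R _ _ _ n (fun x j => f j x) (fun j => f j x)) => j _.
exact: cf.
Qed.

Lemma expect_sum E : expectation E -> forall n (f : nat -> R -> R),
  (forall j, continuous (f j)) ->
  E (fun x => \sum_(j < n) f j x) = \sum_(j < n) E (f j).
Proof.
move=> HE n f cf; elim: n => [|n IH].
  rewrite big_ord0 -[RHS](expect_cst HE); congr E; apply/funext => x; exact: big_ord0.
rewrite big_ord_recr/= -IH -(expectD HE)//; last exact: continuous_sum_ord.
by congr E; apply/funext => x; rewrite big_ord_recr.
Qed.

Lemma continuous_tauX j : continuous (fun x => tau x ^+ j).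
Proof.
elim: j => [|j IH] x; first by under eq_fun do rewrite expr0; exact: cvg_cst.
under eq_fun do rewrite exprS.
by apply: cvgM; [exact: continuous_of_angle|exact: IH].
Qed.

Lemma expect_poly E (p : {poly R}) : expectation E ->
  E (fun x => p.[tau x]) = \sum_(j < size p) p`_j * E (fun x => tau x ^+ j).
Proof.
move=> HE.
have -> : (fun x => p.[tau x]) = (fun x => \sum_(j < size p) (p`_j * tau x ^+ j)).
  by apply/funext => x; rewrite horner_coef.
rewrite (@expect_sum E HE _ (fun j x => p`_j * tau x ^+ j)); last first.
  by move=> j x; apply: cvgMr; exact: continuous_tauX.
by apply: eq_bigr => j _; rewrite (expectZ HE)//; exact: continuous_tauX.
Qed.

(* For [zeta = e^u] real, [jinv u = 1 / (zeta + 1 / zeta)] is the variable in which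
   [Re (g u)] is, up to [ln (jinv u)], a generating function of the moments. *)
Definition jinv u : R := (expR u + expR (- u))^-1.

Lemma jinv_gt0 u : 0 < jinv u.
Proof. by rewrite invr_gt0 addr_gt0 ?expR_gt0. Qed.

Lemma jinv_lt u : jinv u < expR u.
Proof.
rewrite /jinv invf_plt ?posrE ?expR_gt0 ?addr_gt0 ?expR_gt0//.
by rewrite -expRN ltrDr expR_gt0.
Qed.

Lemma normr_tau x : `|tau x| <= 2.
Proof. by rewrite ler_norml; have := of_angle_itv x; lra. Qed.

Lemma continuous_ln_tau y : 0 < y -> y <= 1 / 4 -> continuous (fun x => ln (1 + tau x * y)).
Proof.
move=> y0 y4 x.
have pos : 0 < 1 + tau x * y by have := of_angle_itv x; nra.
have c1 : (fun x => 1 + tau x * y) @ x --> 1 + tau x * y.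
  by apply: cvgD; [exact: cvg_cst|apply: cvgMl; exact: continuous_of_angle].
by apply: continuous_cvg c1; exact: continuous_ln.
Qed.

Lemma Re_gmap_real (lA : R) E u : expectation E -> u < 0 -> jinv u <= 1 / 4 ->
  Re (gmap lA E u%:C) = lA + ln (jinv u) - E (fun x => ln (1 + tau x * jinv u)).
Proof.
move=> HE u0 y4; have y0 := jinv_gt0 u.
have s0 : Re (u%:C) < 0 by [].
have [c1 _] := ccontinuous_kernel_kappa s0.
rewrite /gmap ReD /= -addrA; congr (_ + _).
have -> : ln (jinv u) - E (fun x => ln (1 + tau x * jinv u)) =
    E (fun x => ln (jinv u) - ln (1 + tau x * jinv u)).
  rewrite (expectB HE) ?(expect_cst HE)//; first by move=> x; exact: cvg_cst.
  exact: continuous_ln_tau.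
congr E; apply/funext => x.
have pos : 0 < 1 + tau x * jinv u by have := of_angle_itv x; nra.
have e := congr1 (@normc R) (cexp_kernel x s0).
have e2 : (tau x)%:C + cexp u%:C + (cexp u%:C)^-1 = ((1 + tau x * jinv u) / jinv u)%:C.
  rewrite cexp_real -real_complexV -!real_complexD; congr (_ %:C).
  have eu := expR_gt0 u.
  have eN : expR u + (expR u)^-1 = (jinv u)^-1 by rewrite /jinv invrK expRN.
  rewrite -addrA eN; field; rewrite gt_eqF//.
rewrite e2 normc_cexp normc_real ger0_norm ?divr_ge0 ?ltW// ReN in e.
have := congr1 (@ln R) e; rewrite expRK ln_div ?posrE// => h.
by rewrite -[LHS]opprK h opprB.
Qed.

(** In the variable [y = jinv u] the hypothesis concerns [lA - E (ln (1 + tau y))], whose expansion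
    at 0 has the moments of [tau] as coefficients. As [|tau| <= 2], the restriction [y <= 1 / 4]
    gives [|tau y| <= 1 / 2] and remainders uniform over all expectations. Polynomials in [tau] are
    then dense in the functions of the angle. *)
Lemma expect_cvg (E_ : nat -> (R -> R) -> R) (lA_ : nat -> R) E (lA : R) :
  (forall n, expectation (E_ n)) -> expectation E ->
  (forall u, u < 0 ->
    Re (gmap (lA_ n) (E_ n) u%:C) @[n --> \oo] --> Re (gmap lA E u%:C)) ->
  (lA_ n @[n --> \oo] --> lA) /\
  (forall f : R -> R, continuous f -> E_ n f @[n --> \oo] --> E f).
Proof.
move=> HE_ HE H.
(* Slot 0 carries [l], and slot [j.+1] the moment of order [j.+1] up to a nonzero factor. The moment
   of order 0 has no slot; it is 1 by normalization. *)
pose coef (l : R) (e : (R -> R) -> R) (j : nat) : R :=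
  if j is i.+1 then - ((- 1) ^+ i * e (fun x => tau x ^+ i.+1) / i.+1%:R) else l.
pose S : set R := [set y | exists u, [/\ u < 0, jinv u <= 1 / 4 & y = jinv u]].
pose Phi (l : R) (e : (R -> R) -> R) y := l - e (fun x => ln (1 + tau x * y)).
have bound l e : expectation e -> forall k y, S y ->
    `|Phi l e y - \sum_(j < k.+1) coef l e j * y ^+ j| <= 2 * 2 ^+ k.+1 * y ^+ k.+1.
  move=> He k _ [u [u0 y4 ->]].
  have y0 := jinv_gt0 u; set y := jinv u in y4 y0 *; clearbody y.
  pose T x := \sum_(j < k) (- 1) ^+ j * (tau x * y) ^+ j.+1 / j.+1%:R.
  pose a j : R := (- 1) ^+ j * y ^+ j.+1 / j.+1%:R.
  have TE : T = fun x => \sum_(j < k) a j * tau x ^+ j.+1.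
    by apply/funext => x; apply: eq_bigr => j _; rewrite exprMn /a; ring.
  have cT : continuous T.
    rewrite TE; apply: (@continuous_sum_ord k (fun j x => a j * tau x ^+ j.+1)) => j x.
    by apply: cvgMr; exact: continuous_tauX.
  have cl := continuous_ln_tau y0 y4.
  have -> : Phi l e y - \sum_(j < k.+1) coef l e j * y ^+ j =
      - (e (fun x => ln (1 + tau x * y) - T x)).
    rewrite (expectB He)// big_ord_recl/= expr0 mulr1 /Phi.
    have -> : e T = - \sum_(i < k) - ((- 1) ^+ i * e (fun x => tau x ^+ i.+1) / i.+1%:R) * y ^+ i.+1.
      rewrite TE (@expect_sum e He k (fun j x => a j * tau x ^+ j.+1)); last first.
        by move=> j x; apply: cvgMr; exact: continuous_tauX.
      rewrite -sumrN; apply: eq_bigr => j _; rewrite (expectZ He); last exact: continuous_tauX.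
      by rewrite /a; ring.
    by rewrite (eq_bigr (fun i : 'I_k => - ((- 1) ^+ i * e (fun x => tau x ^+ i.+1) / i.+1%:R) * y ^+ i.+1))//; ring.
  rewrite normrN; apply: (expect_abs_le He) => [x|x _].
    by apply: cvgB; [exact: cl|exact: cT].
  have ty : `|tau x * y| <= 2 * y.
    by rewrite normrM (gtr0_norm y0) ler_pM2r// normr_tau.
  apply: le_trans (ln1D_taylor k _) _; first by lra.
  by rewrite -mulrA ler_pM2l// -exprMn lerXn2r ?nnegrE// mulr_ge0// ltW.
have Ssmall d : 0 < d -> exists2 y, S y & 0 < y < d.
  move=> d0; pose v := Num.min (ln d) (Num.min (-1) (ln (1 / 4))).
  have v1 : v <= ln d by rewrite ge_min lexx.
  have v2 : v <= - 1 by rewrite !ge_min lexx orbT.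
  have v3 : v <= ln (1 / 4) by rewrite !ge_min lexx !orbT.
  have j1 := jinv_lt v.
  exists (jinv v).
    exists v; split => //; first by apply: le_lt_trans v2 _; rewrite ltrN10.
    apply: ltW; apply: lt_le_trans j1 _.
    by rewrite -[leRHS]lnK ?ler_expR// posrE.
  rewrite jinv_gt0/=; apply: lt_le_trans j1 _.
  by rewrite -[leRHS]lnK ?ler_expR// posrE.
have Phic y : S y -> Phi (lA_ n) (E_ n) y @[n --> \oo] --> Phi lA E y.
  move=> [u [u0 y4 ->]].
  have e l e : expectation e -> Phi l e (jinv u) = Re (gmap l e u%:C) - ln (jinv u).
    by move=> He; rewrite Re_gmap_real// /Phi; ring.
  rewrite e//; under eq_fun do rewrite e//.
  by apply: cvgB; [exact: H|exact: cvg_cst].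
have coefc := @coef_extract R (fun n => coef (lA_ n) (E_ n)) (coef lA E)
  (fun n => Phi (lA_ n) (E_ n)) (Phi lA E) S (fun k => 2 * 2 ^+ k.+1) Ssmall Phic
  (fun k n => bound _ _ (HE_ n) k) (bound _ _ HE).
split; first exact: (coefc 0%N).
have moments j : E_ n (fun x => tau x ^+ j) @[n --> \oo] --> E (fun x => tau x ^+ j).
  case: j => [|j].
    have e1 e : expectation e -> e (fun x => tau x ^+ 0) = 1.
      by move=> He; rewrite -(expect1 He); congr e; apply/funext => x; rewrite expr0.
    by rewrite e1//; under eq_fun do rewrite e1//; exact: cvg_cst.
  pose c : R := - ((- 1) ^+ j * j.+1%:R).
  have e2 (l : R) (e : (R -> R) -> R) : e (fun x => tau x ^+ j.+1) = c * coef l e j.+1.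
    rewrite /= /c.
    have -> : - ((-1) ^+ j * j.+1%:R) * - ((-1) ^+ j * e (fun x => tau x ^+ j.+1) / j.+1%:R) =
      ((-1) ^+ j * (-1) ^+ j) * (j.+1%:R / j.+1%:R) * e (fun x => tau x ^+ j.+1) by ring.
    rewrite -exprMn mulrNN mulr1 expr1n divff ?pnatr_eq0//; ring.
  rewrite (e2 lA); under eq_fun => n do rewrite (e2 (lA_ n)).
  by apply: cvgMr; exact: coefc.
move=> f cf; apply/cvgrPdist_le => e e0.
have e3 : 0 < e / 3 by rewrite divr_gt0.
(* The affine map from [[0, 1]] onto [[-2, 2]], clamped so that composition with [angle] is
   continuous on the whole line. *)
pose c x : R := Num.max (-2) (Num.min 2 (4 * x - 2)).
have cc : continuous c.
  apply: (@lipschitz_continuousR R c 4) => x y.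
  have h1 := ler_norm (y - x); have h2 := ler_norm (x - y); rewrite distrC in h2.
  rewrite /c ler_norml /Num.max /Num.min; clear -h1 h2.
  case: (ltP 2 (4 * y - 2)) => ?; case: (ltP 2 (4 * x - 2)) => ?;
  case: ltP => ?; case: ltP => ?; lra.
have c2 x : -2 <= c x <= 2.
  rewrite /c /Num.max /Num.min; clear; case: (ltP 2 (4 * x - 2)) => ?; case: ltP => ?; lra.
have ch : continuous ((f \o @angle R) \o c).
  by apply: continuous_comp_segment => //; exact: continuous_comp_angle.
have [p hp] := weierstrass01 ch e3.
pose q := p \Po (4^-1 *: ('X + 2%:P)).
have fq x : 0 <= x <= pi -> `|f x - q.[tau x]| <= e / 3.
  move=> x01; rewrite /q horner_comp hornerZ hornerD hornerX hornerC.
  set v := 4^-1 * _.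
  have t2 := of_angle_itv x.
  have v01 : 0 <= v <= 1 by rewrite /v; lra.
  have := hp v v01; rewrite /=.
  have -> : c v = tau x.
    rewrite /c; have -> : 4 * v - 2 = tau x by rewrite /v; field.
    by rewrite min_r ?max_r//; lra.
  by rewrite of_angleK.
have cq : continuous (fun x => q.[tau x]).
  have -> : (fun x => q.[tau x]) = (fun x => \sum_(j < size q) (q`_j * tau x ^+ j)).
    by apply/funext => x; rewrite horner_coef.
  apply: (@continuous_sum_ord _ (fun j x => q`_j * tau x ^+ j)) => j x.
  by apply: cvgMr; exact: continuous_tauX.
have qc : E_ n (fun x => q.[tau x]) @[n --> \oo] --> E (fun x => q.[tau x]).
  rewrite expect_poly//; under eq_fun do rewrite expect_poly//.
  apply: (@cvg_sum_ord R _ _ _ (size q) (fun n j => q`_j * E_ n (fun x => tau x ^+ j))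
    (fun j => q`_j * E (fun x => tau x ^+ j))) => j _.
  by apply: cvgMr; exact: moments.
have dist G : expectation G -> `|G f - G (fun x => q.[tau x])| <= e / 3.
  move=> HG; rewrite -(expectB HG)//; apply: (expect_abs_le HG) => // x.
  by apply: cvgB; [exact: cf|exact: cq].
near=> n.
have h1 := dist _ (HE_ n); have h2 := dist _ HE.
have h3 : `|E (fun x => q.[tau x]) - E_ n (fun x => q.[tau x])| <= e / 3.
  by near: n; move/cvgrPdist_le: qc; exact.
move: h1 h2 h3; rewrite !ler_norml => /andP[? ?] /andP[? ?] /andP[? ?].
by apply/andP; split; lra.
Unshelve. all: by end_near. Qed.

End expectation_convergence.

(** * Convergence of the image domains *)

Section domain_convergence.
Variable R : realType.
Implicit Types (y z w s h : R[i]) (x t u : R) (g : R[i] -> R[i]) (E : (R -> R) -> R).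
Local Notation Re := (@complex.Re R).
Local Notation Im := (@complex.Im R).

(** The point 0 is added because it corresponds to [s = -oo], outside the reach of the logarithmic
    coordinate. *)
Definition sm_domain g : set (Cplx R) :=
  [set z | z = 0 \/ exists2 y, sm_image g y & cexp y = z].

Lemma sm_domain_cexp lA g : starlike_map lA g -> forall y,
  sm_domain g (cexp y) -> sm_image g y.
Proof.
move=> G y [/eqP|]; first by rewrite (negbTE (cexp_neq0 y)).
exact: (sm_image_cexp G).
Qed.

Lemma cexp_near_log y w (r : R) : r <= 1 / 2 ->
  normc (w - cexp y) <= r * normc (cexp y : R[i]) ->
  exists2 y', cexp y' = w & normc (y' - y) <= 2 * r.
Proof.
move=> r2 wy.
have n0 : 0 < normc (cexp y : R[i]) by rewrite normc_gt0 cexp_neq0.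
pose v := (w - cexp y) / cexp y.
have vr : normc v <= r by rewrite normcM normcV ler_pdivrMr.
have v2 : normc v <= 1 / 2 by apply: le_trans r2.
exists (y + clog (1 + v)).
  rewrite cexpD clogK; last first.
    by have := Re_le_normc (- v); rewrite normcN !ReImE/=; lra.
  by rewrite /v; have := cexp_neq0 y => ?; field.
have -> : y + clog (1 + v) - y = clog (1 + v) by ring.
by apply: le_trans (clog_taylor0 v2) _; rewrite ler_pM2l.
Qed.

Section kernel_of_convergence.
Variables (Fl : set_system nat) (FF : ProperFilter Fl).
Variables (lA_ : nat -> R) (g_ : nat -> R[i] -> R[i]) (lA : R) (g : R[i] -> R[i]).
Hypothesis G_ : forall n, starlike_map (lA_ n) (g_ n).
Hypothesis G : starlike_map lA g.
Hypothesis lA_cvg : \forall n \near Fl, lA - 1 <= lA_ n.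
Hypothesis g_cvg : forall s (e : R), Re s < 0 -> 0 < e ->
  \forall n \near Fl, normc (g_ n s - g s) <= e.

(** The filter is arbitrary because the result serves both for [\oo] and for ultrafilters. About 0
    the radius comes from [sm_image_small] and [lA_ n >= lA - 1]; elsewhere [sm_hurwitz] requires
    closeness at a single point. *)
Lemma kernel_inside (z : Cplx R) : sm_domain g z ->
  exists2 r : R, 0 < r & \forall n \near Fl, disk z r `<=` sm_domain (g_ n).
Proof.
case=> [->|[y [s s0 gs] <-]].
- exists (expR (lA - 2 - 2 * ln 2)); first exact: expR_gt0.
  near=> n => w /disk_normc; rewrite subr0 => hw.
  have [->|w0] := eqVneq w 0; first by left.
  right; have [y ye] := cexp_surj w0; exists y => //.
  apply: (sm_image_small (G_ n)).
  rewrite -ye normc_cexp ltr_expR in hw.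
  have : lA - 1 <= lA_ n by near: n.
  lra.
- have [d [s1 [d0 s10 H]]] := sm_hurwitz G s0.
  have n0 : 0 < normc (cexp y : R[i]) by rewrite normc_gt0 cexp_neq0.
  pose r := Num.min (1 / 2) (d / 2).
  have r0 : 0 < r by rewrite lt_min !divr_gt0.
  exists (r * normc (cexp y : R[i])); first exact: mulr_gt0.
  near=> n => w /disk_normc hw.
  have r2 : r <= 1 / 2 by rewrite ge_min lexx.
  have rd : r <= d / 2 by rewrite ge_min lexx orbT.
  have [y' <- y'y] := cexp_near_log r2 (ltW hw).
  right; exists y' => //; apply: (H _ _ (G_ n)); last first.
    by rewrite gs; apply: le_trans y'y _; lra.
  by near: n; exact: g_cvg.
Unshelve. all: by end_near. Qed.

Lemma kernel_outside (z : Cplx R) (r : R) : ~ sm_domain g z -> 0 < r ->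
  \forall n \near Fl, ~ (disk z r `<=` sm_domain (g_ n)).
Proof.
move=> zg r0.
have z0 : z != 0 by apply/eqP => z0; apply: zg; left.
have [y ye] := cexp_surj z0.
have yg : ~ sm_image g y by move=> yg; apply: zg; right; exists y.
have n0 : 0 < normc (cexp y : R[i]) * expR 1.
  by rewrite mulr_gt0 ?expR_gt0// normc_gt0 cexp_neq0.
pose d := Num.min 1 (r / 2 / (normc (cexp y : R[i]) * expR 1)).
have d0 : 0 < d by rewrite lt_min ltr01 !divr_gt0.
have [e [s1 [s2 [e0 s10 s20 H]]]] := sm_nonkernel G yg d0.
near=> n => sub.
apply: (H _ _ (G_ n)) => [||y' y'y].
- by near: n; exact: g_cvg.
- by near: n; exact: g_cvg.
- apply: (sm_domain_cexp (G_ n)); apply: sub; apply/disk_normc.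
  move: y'y; rewrite le_min => /andP[y1]; rewrite ler_pdivlMr// => y2.
  rewrite -ye; apply: le_lt_trans (cexp_dist y1) _.
  rewrite mulrA mulrC; lra.
Unshelve. all: by end_near. Qed.

End kernel_of_convergence.

Lemma sm_upper lA g : starlike_map lA g -> forall s, Re s <= -1 ->
  Re (g s) <= Re s + (lA + 4).
Proof.
move=> G s s1.
have es : expR (Re s) <= 1 / 2 by apply: le_trans (expRN1_half R); rewrite ler_expR.
have := sm_asymp G es => /(le_trans (Re_le_normc _)); rewrite !ReImE/=; lra.
Qed.

Lemma sm_image_sub_le lA g lA' g' : starlike_map lA g -> starlike_map lA' g' ->
  sm_image g' `<=` sm_image g ->
  forall s s', Re s < 0 -> Re s' < 0 -> g s' = g' s -> Re s' <= Re s.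
Proof.
move=> G G' sub; apply: (sm_lindelof (f := g') (B := lA' + 4) G).
- by move=> s s0; have [a [b [J _ _]]] := sm_jet G' s0; exists a, b.
- by move=> s s0; exact: (sm_periodic G').
- exact: sm_upper G'.
- by move=> s s0; apply: sub; exists s.
Qed.

(** The Schwarz lemma for both inclusions shows that the preimage [s] of [g' u] has real part [u];
    conjugation symmetry and injectivity make it real. *)
Lemma sm_image_uniq lA g lA' g' : starlike_map lA g -> starlike_map lA' g' ->
  sm_image g' = sm_image g -> forall u, u < 0 -> g' u%:C = g u%:C.
Proof.
move=> G G' e u u0.
have [s s0 gs] : sm_image g (g' u%:C) by rewrite -e; exists u%:C.
have h1 : Re s <= u.
  apply: (sm_image_sub_le G G' _ (s := u%:C) _ s0 gs) => //.
  by rewrite e.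
have h2 : u <= Re s.
  apply: (sm_image_sub_le G' G _ (s := s) (s' := u%:C) s0 u0) => //.
  by rewrite e.
have ru : (u%:C)^* = u%:C :> R[i] by apply: complexP; rewrite ?ReJ ?ImJ/= ?oppr0.
have sJ : s^* = s.
  apply: (sm_inj G); rewrite ?ReJ//.
  by rewrite (sm_conj G)// gs -(sm_conj G') ?ru.
rewrite -gs; congr g; apply: complexP => /=.
  by apply/eqP; rewrite eq_le h1 h2.
by have := congr1 Im sJ; rewrite ImJ; lra.
Qed.

(** Comparison with the dilation of the unit disc onto the disc of radius [r / 2], whose logarithm
    is [f]: the Schwarz lemma at [s = -1] turns an inscribed disc into a lower bound for [lA]. *)
Lemma sm_inradius lA g (r : R) : starlike_map lA g -> 0 < r ->
  disk 0 r `<=` sm_domain g -> ln (r / 2) <= lA + 4.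
Proof.
move=> G r0 sub.
pose f s : R[i] := s + (ln (r / 2))%:C.
have r20 : 0 < r / 2 by rewrite divr_gt0.
have fim s : Re s < 0 -> sm_image g (f s).
  move=> s0; apply: (sm_domain_cexp G); apply: sub; apply/disk_normc.
  rewrite subr0 normc_cexp /f ReD/= expRD lnK ?posrE//.
  have : expR (Re s) * (r / 2) < 1 * (r / 2) by rewrite ltr_pM2r// expR_lt1.
  lra.
have s0 : Re (-1 : R[i]) < 0 by rewrite /=; lra.
have [s' s'0 gs'] := fim _ s0.
have s'1 : Re s' <= -1.
  apply: (sm_lindelof (f := f) (B := ln (r / 2)) G _ _ _ fim s0 s'0 gs') => s hs.
  - exists (1 - 0), (0 - 0); rewrite /f => e e0; exists 1 => // h _.
    have -> : s + h + (ln (r / 2))%:C - (s + (ln (r / 2))%:C) - (1 - 0) * h - (0 - 0) * h ^+ 2 = 0.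
      by ring.
    by rewrite normc0 mulr_ge0 ?sqr_ge0// ltW.
  - by rewrite /f; ring.
  - by rewrite /f ReD.
have := sm_upper G s'1; rewrite gs' /f ReD/=; lra.
Qed.

Lemma cexpect_cvg (Fl : set_system nat) (FF : ProperFilter Fl)
    (E_ : nat -> (R -> R) -> R) E :
  (forall f : R -> R, continuous f -> E_ n f @[n --> Fl] --> E f) ->
  forall (f : R -> R[i]) (e : R), ccontinuous f -> 0 < e ->
  \forall n \near Fl, normc (cexpect (E_ n) f - cexpect E f) <= e.
Proof.
move=> Ec f e [c1 c2] e0; have e2 : 0 < e / 2 by rewrite divr_gt0.
near=> n; apply: le_trans (normc_le_ReIm _) _; rewrite !ReImE/=.
have h1 : `|E (fun x => Re (f x)) - E_ n (fun x => Re (f x))| <= e / 2.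
  by near: n; move/cvgrPdist_le: (Ec _ c1); exact.
have h2 : `|E (fun x => Im (f x)) - E_ n (fun x => Im (f x))| <= e / 2.
  by near: n; move/cvgrPdist_le: (Ec _ c2); exact.
rewrite distrC in h1; rewrite distrC in h2; lra.
Unshelve. all: by end_near. Qed.

Lemma gmap_cvg (Fl : set_system nat) (FF : ProperFilter Fl) (lA_ : nat -> R)
    (E_ : nat -> (R -> R) -> R) (lA : R) E :
  lA_ n @[n --> Fl] --> lA ->
  (forall f : R -> R, continuous f -> E_ n f @[n --> Fl] --> E f) ->
  forall s (e : R), Re s < 0 -> 0 < e ->
  \forall n \near Fl, normc (gmap (lA_ n) (E_ n) s - gmap lA E s) <= e.
Proof.
move=> lAc Ec s e s0 e0; have e2 : 0 < e / 2 by rewrite divr_gt0.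
have ck := ccontinuous_kernel_kappa s0.
near=> n.
have h1 : `|lA - lA_ n| <= e / 2 by near: n; move/cvgrPdist_le: lAc; exact.
have h2 : normc (cexpect (E_ n) (kernel (@kappa R) s) - cexpect E (kernel (@kappa R) s)) <= e / 2.
  by near: n; exact: cexpect_cvg.
have -> : gmap (lA_ n) (E_ n) s - gmap lA E s = (lA_ n - lA)%:C +
    (cexpect (E_ n) (kernel (@kappa R) s) - cexpect E (kernel (@kappa R) s)).
  by rewrite /gmap real_complexB; ring.
apply: le_trans (le_normcD _ _) _; rewrite normc_real distrC; lra.
Unshelve. all: by end_near. Qed.

(** If convergence failed, the filter restricted to the bad indices would be proper, and an
    ultrafilter refining it would contradict the hypothesis. *)
Lemma cvg_ultra (x_ : nat -> R) (l : R) :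
  (forall U : set_system nat, UltraFilter U -> \oo `<=` U -> x_ n @[n --> U] --> l) ->
  x_ n @[n --> \oo] --> l.
Proof.
move=> H; apply/cvgrPdist_le => e e0; apply: contrapT => nH.
pose S : set nat := [set n | ~ (`|l - x_ n| <= e)].
have PS : ProperFilter (within S \oo).
  apply: Build_ProperFilter_ex => P PP; apply: contrapT => nP; apply: nH.
  have {}PP : \forall n \near \oo, S n -> P n by exact: PP.
  near=> n; apply: contrapT => Sn; apply: nP; exists n.
  by have := near PP n; apply.
have [U [UU SU]] := ultraFilterLemma PS.
have sub : \oo `<=` U.
  move=> P PP; apply: SU; suff : \forall n \near \oo, S n -> P n by [].
  by near=> n => _; have := near PP n; apply.
have US : U S by apply: SU; exact: (@withinT _ \oo S).
have := H U UU sub; move/cvgrPdist_le => /(_ e e0) UH.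
have PU : ProperFilter U by exact: ultra_proper.
by have [n [? ?]] := @filter_ex _ U _ _ (filterI US UH).
Unshelve. all: by end_near. Qed.

Lemma ultra_limit (U : set_system nat) (UU : UltraFilter U) (x_ : nat -> R) (M : R) :
  (\forall n \near U, `|x_ n| <= M) -> exists l : R, x_ n @[n --> U] --> l.
Proof.
move=> xM.
have [|l [_ cl]] := @segment_compact R (- M) M (x_ n @[n --> U]) _.
  by apply: filterS xM => n; rewrite /= in_itv/= -ler_norml.
exists l => V Vl.
have [//|UV] := in_ultra_setVsetC (x_ @^-1` V) UU.
by have [x [/= ? ?]] := cl (~` V) V UV Vl.
Qed.

(** For each continuous function the values are bounded, hence have a limit along [U]; linearity,
    monotonicity and normalization survive in the limit. This replaces weak-star compactness of
    probability measures. *)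
Lemma ultra_expectation (U : set_system nat) (UU : UltraFilter U)
    (E_ : nat -> (R -> R) -> R) : (forall n, expectation (E_ n)) ->
  exists2 E, expectation E &
    forall f : R -> R, continuous f -> E_ n f @[n --> U] --> E f.
Proof.
move=> HE_.
have /choice[E EP] : forall f : R -> R, exists l : R,
    continuous f -> E_ n f @[n --> U] --> l.
  move=> f; have [cf|ncf] := pselect (continuous f); last by exists 0.
  have [M [_ HM]] := compact_bounded (continuous_compact (continuous_subspaceT cf)
    (@segment_compact R 0 pi)).
  have [|l hl] := @ultra_limit U UU (fun n => E_ n f) (`|M| + 1); last by exists l.
  apply: nearW => n; apply: (expect_abs_le (HE_ n)) => // x x01.
  apply: (HM (`|M| + 1)); last by exists x => //=; rewrite in_itv.
  by have := ler_norm M; lra.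
exists E => //.
have uniqR (a b : R) (u : nat -> R) : u n @[n --> U] --> a -> u n @[n --> U] --> b -> a = b.
  by move=> ua ub; exact: (cvg_unique (@Rhausdorff R) ua ub).
split.
- move=> f g cf cg; apply: (uniqR _ _ (fun n => E_ n (fun x => f x + g x))).
    by apply: EP => x; apply: cvgD; [exact: cf|exact: cg].
  under eq_fun do rewrite (expectD (HE_ _))//.
  by apply: cvgD; exact: EP.
- move=> a f cf; apply: (uniqR _ _ (fun n => E_ n (fun x => a * f x))).
    by apply: EP => x; apply: cvgMr; exact: cf.
  under eq_fun do rewrite (expectZ (HE_ _))//.
  by apply: cvgMr; exact: EP.
- move=> f g cf cg fg.
  apply: (ler_cvg_to (EP _ cf) (EP _ cg)).
  by apply: nearW => n; exact: (expect_le (HE_ n)).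
- apply: (uniqR _ _ (fun n => E_ n (fun=> 1))).
    by apply: EP => x; exact: cvg_cst.
  by under eq_fun do rewrite (expect1 (HE_ _)); exact: cvg_cst.
Qed.

End domain_convergence.

(** * Local uniform convergence *)

Section local_uniform_convergence.
Variable R : realType.
Implicit Types (z w s : R[i]) (x y : R).
Local Notation Re := (@complex.Re R).
Local Notation Im := (@complex.Im R).
Local Notation C := (Cplx R).

Lemma Cplx_normE (w : C) : `|w| = (normc w)%:C.
Proof. by case: w. Qed.

Lemma uniform_cvg_Cplx (A : set C) (f_ : nat -> C -> C) (f : C -> C) :
  (forall e : R, 0 < e -> \forall n \near \oo, forall w, A w -> normc (f_ n w - f w) <= e) ->
  {uniform A, f_ @ \oo --> f}.
Proof.
move=> H P /uniform_nbhs[E [entE subP]].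
move: entE; rewrite -entourage_ballE => -[e /= e0 Ee].
have eE : e = (Re e)%:C.
  by apply: complexP => //=; move: e0; rewrite ltcE => /andP[/eqP] /=.
have e0' : 0 < Re e by move: e0; rewrite {1}eE ltcR.
have e2 : 0 < Re e / 2 by rewrite divr_gt0.
apply: filterS (H _ e2) => n Hn; apply: subP => w Aw; apply: Ee => /=.
rewrite -ball_normE /ball_/= Cplx_normE eE ltcR normcBC.
by apply: le_lt_trans (Hn w Aw) _; lra.
Qed.

Lemma uniform_cvg_real (A : set C) (f_ : nat -> C -> R) (f : C -> R) :
  (forall e : R, 0 < e -> \forall n \near \oo, forall w, A w -> `|f_ n w - f w| <= e) ->
  {uniform A, f_ @ \oo --> f}.
Proof.
move=> H P /uniform_nbhs[E [entE subP]].
move: entE; rewrite -entourage_ballE => -[e /= e0 Ee].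
have e2 : 0 < e / 2 by rewrite divr_gt0.
apply: filterS (H _ e2) => n Hn; apply: subP => w Aw; apply: Ee => /=.
rewrite -ball_normE /ball_/= distrC.
by apply: le_lt_trans (Hn w Aw) _; lra.
Qed.

Lemma locally_uniformly_pointwise (V : uniformType) (U : set C)
    (f_ : nat -> C -> V) (f : C -> V) : cvg_locally_uniformly U f_ f ->
  forall z, U z -> f_ n z @[n --> \oo] --> f z.
Proof.
move=> H z Uz; have [W Wz cW] := H z Uz.
have sub : [set z] `<=` W `&` U by move=> _ ->; split => //; exact: (nbhs_singleton Wz).
have := @uniform_subset_cvg _ _ f _ _ _ _ sub cW.
by rewrite uniform_set1 => h; exact: h.
Qed.

Lemma cvg_normc (z_ : nat -> C) (z : C) : z_ n @[n --> \oo] --> z ->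
  forall e : R, 0 < e -> \forall n \near \oo, normc (z_ n - z) < e.
Proof.
move=> H e e0; have : nbhs z [set w | normc (w - z) < e] by apply/nbhs_normc; exists e.
exact: H.
Qed.

(** The Arzela-Ascoli mechanism: with common local Lipschitz constants, closeness at a point extends
    to a neighbourhood independent of [n], and compactness of a square makes it uniform. *)
Lemma equilipschitz_cvg (U : set C) (f_ : nat -> C -> C) (f : C -> C) :
  (forall z, U z -> exists r L : R, [/\ 0 < r, 0 < L,
    forall w, normc (w - z) <= r -> U w &
    forall w w', normc (w - z) <= r -> normc (w' - z) <= r ->
      (forall n, normc (f_ n w' - f_ n w) <= L * normc (w' - w)) /\
      normc (f w' - f w) <= L * normc (w' - w)]) ->
  (forall z, U z -> forall e : R, 0 < e ->
    \forall n \near \oo, normc (f_ n z - f z) <= e) ->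
  forall z, U z -> exists2 r : R, 0 < r & forall e : R, 0 < e ->
    \forall n \near \oo, forall w, normc (w - z) <= r -> normc (f_ n w - f w) <= e.
Proof.
move=> lip ptw z Uz; have [r [L [r0 L0 rU rL]]] := lip z Uz.
exists (r / 2); first by rewrite divr_gt0.
move=> e e0; have e3 : 0 < e / 3 by rewrite divr_gt0.
(* The half side [r / 2] makes the square fit in the disc of radius [r] by the bound
   [|Re| + |Im|]. *)
pose K : set (R * R) := `[Re z - r / 2, Re z + r / 2]%classic `*` `[Im z - r / 2, Im z + r / 2]%classic.
have Kc : compact K by apply: compact_setX; exact: segment_compact.
have Kr (p : R * R) : K p -> normc ((p.1 +i* p.2) - z) <= r.
  move=> [/=]; rewrite !in_itv/= => h1 h2; apply: le_trans (normc_le_ReIm _) _.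
  rewrite !ReImE/=.
  have : `|p.1 - Re z| <= r / 2 by rewrite ler_norml; lra.
  have : `|p.2 - Im z| <= r / 2 by rewrite ler_norml; lra.
  lra.
have /compact_near_coveringP/near_covering_withinP nc := Kc.
suff : \forall n \near \oo, K `<=` [set p | normc (f_ n (p.1 +i* p.2) - f (p.1 +i* p.2)) <= e].
  apply: filterS => n Hn w wz.
  have := Hn (Re w, Im w).
  rewrite /= (_ : Re w +i* Im w = w); last exact: complexP.
  apply; have h1 := le_trans (normr_Re _) wz; have h2 := le_trans (normr_Im _) wz.
  move: h1 h2; rewrite !ReImE !ler_norml => /andP[? ?] /andP[? ?].
  by split => /=; rewrite in_itv/=; apply/andP; split; lra.
apply: (nc nat \oo (fun n (p : R * R) => normc (f_ n (p.1 +i* p.2) - f (p.1 +i* p.2)) <= e)).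
move=> p Kp.
have pr := Kr p Kp; have Up := rU _ pr.
have d0 : 0 < e / 3 / (2 * L) by rewrite !divr_gt0// mulr_gt0.
near=> q n => Kq.
have qr := Kr q Kq.
have [lip1 lip2] := rL _ _ pr qr.
have h1 : `|p.1 - q.1| <= e / 3 / (2 * L).
  by near: q; apply: (@cvgr_dist_le _ _ _ (nbhs p) _ fst p.1 _ _ d0); exact: cvg_fst.
have h2 : `|p.2 - q.2| <= e / 3 / (2 * L).
  by near: q; apply: (@cvgr_dist_le _ _ _ (nbhs p) _ snd p.2 _ _ d0); exact: cvg_snd.
have h3 : normc (f_ n (p.1 +i* p.2) - f (p.1 +i* p.2)) <= e / 3.
  by near: n; exact: ptw.
have qp : L * normc ((q.1 +i* q.2) - (p.1 +i* p.2)) <= e / 3.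
  rewrite -ler_pdivlMl//; apply: le_trans (normc_le_ReIm _) _.
  rewrite !ReImE/= [`|q.1 - _|]distrC [`|q.2 - _|]distrC.
  have -> : L^-1 * (e / 3) = e / 3 / (2 * L) + e / 3 / (2 * L) by field; rewrite gt_eqF.
  exact: lerD.
have := lip1 n; move: lip2 qp h3.
set a := f_ n _; set b := f _; set c := f_ n _; set d := f _ => lip2 qp h3 lip1'.
have -> : c - b = (c - a) + (a - d) - (b - d) by ring.
apply: le_trans (normcB _ _) _.
apply: le_trans (lerD (le_normcD _ _) (lexx _)) _; lra.
Unshelve. all: by end_near. Qed.

Lemma clog_lipschitz z w : 0 < Re z -> 0 < Re w -> normc (w - z) <= normc z / 2 ->
  normc (clog w - clog z) <= 2 * (normc (w - z) / normc z).
Proof.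
move=> z0 w0 wz.
have n0 : 0 < normc z by rewrite normc_gt0; apply: contraTneq z0 => ->; rewrite ltxx.
have zN0 : z != 0 by rewrite -normc_gt0.
pose v := (w - z) / z.
have nv : normc v = normc (w - z) / normc z by rewrite normcM normcV.
have v2 : normc v <= 1 / 2 by rewrite nv ler_pdivrMr//; lra.
have wE : w = z * (1 + v) by rewrite /v; field.
have -> : clog w - clog z = clog (1 + v).
  rewrite {1}wE clogM//; first by ring.
    by have := Re_le_normc (- v); rewrite normcN !ReImE/=; lra.
  by rewrite -wE.
by rewrite -nv; exact: clog_taylor0.
Qed.

Lemma cln_lower_clog z : Im z < 0 -> cln_lower z = clog ('i * z) + (0 +i* (- (pi / 2))).
Proof.
move=> z0; apply: cln_lower_unique.
  by have := Im_clog_lt ('i * z); rewrite ltr_norml ImD/=; lra.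
rewrite cexpD clogK; last by rewrite !ReImE/=; lra.
rewrite cexp_imag /expi cosN sinN cos_pihalf sin_pihalf.
by apply: complexP; rewrite !ReImE/=; ring.
Qed.

Lemma cln_lower_lipschitz (m : R) z w : 0 < m -> Im z <= - m -> Im w <= - m ->
  normc (w - z) <= m / 2 ->
  normc (cln_lower w - cln_lower z) <= 2 / m * normc (w - z).
Proof.
move=> m0 zm wm wz.
have z0 : Im z < 0 by lra.
have w0 : Im w < 0 by lra.
have nz : m <= normc z by have := normr_Im z; have := ler_norm (- Im z); rewrite normrN; lra.
have ni (v : R[i]) : normc ('i * v) = normc v.
  by rewrite normcM (_ : normc 'i = 1) ?mul1r// /= expr0n expr1n add0r sqrtr1.
rewrite !cln_lower_clog//.
have -> : clog ('i * w) + (0 +i* (- (pi / 2))) - (clog ('i * z) + (0 +i* (- (pi / 2)))) =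
  clog ('i * w) - clog ('i * z) by ring.
apply: le_trans (clog_lipschitz _ _ _) _.
- by rewrite !ReImE/=; lra.
- by rewrite !ReImE/=; lra.
- by rewrite -mulrBr !ni; lra.
rewrite -mulrBr !ni -mulrA ler_pM2l// mulrC ler_wpM2r ?normc_ge0//.
by rewrite lef_pV2 ?posrE//; lra.
Qed.

(** What remains of [s - kernel] as a function of [zeta = e^s]. It is regular at [zeta = 0], so
    [F zeta / zeta] is an exponential on the whole disc, which local uniformity at the origin
    requires. *)
Definition log_kernel z x : R[i] := clog (1 - expi x * z) + clog (1 - expi (- x) * z).

Lemma normc_expi_mul x z : normc (expi x * z) = normc z.
Proof. by rewrite normcM normc_expi mul1r. Qed.

Lemma clog1_lipschitz (r : R) z w : r < 1 -> normc z <= r -> normc w <= r ->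
  normc (w - z) <= (1 - r) / 2 ->
  normc (clog (1 - w) - clog (1 - z)) <= 2 / (1 - r) * normc (w - z).
Proof.
move=> r1 zr wr wz.
have nz : 1 - r <= normc (1 - z) by have := lerB_normc 1 z; rewrite normc1; lra.
have e : 1 - w - (1 - z) = - (w - z) by ring.
apply: le_trans (clog_lipschitz _ _ _) _.
- by apply: Re_1B_gt0; lra.
- by apply: Re_1B_gt0; lra.
- by rewrite e normcN; lra.
rewrite e normcN -mulrA ler_pM2l// mulrC ler_wpM2r ?normc_ge0//.
by rewrite lef_pV2 ?posrE//; lra.
Qed.

Lemma log_kernel_lipschitz (r : R) z w x : r < 1 -> normc z <= r -> normc w <= r ->
  normc (w - z) <= (1 - r) / 2 ->
  normc (log_kernel w x - log_kernel z x) <= 4 / (1 - r) * normc (w - z).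
Proof.
move=> r1 zr wr wz; rewrite /log_kernel.
have key y : normc (clog (1 - expi y * w) - clog (1 - expi y * z)) <=
    2 / (1 - r) * normc (w - z).
  have := @clog1_lipschitz r (expi y * z) (expi y * w) r1.
  by rewrite -mulrBr !normc_expi_mul; exact.
have -> : clog (1 - expi x * w) + clog (1 - expi (- x) * w) -
   (clog (1 - expi x * z) + clog (1 - expi (- x) * z)) =
  (clog (1 - expi x * w) - clog (1 - expi x * z)) +
  (clog (1 - expi (- x) * w) - clog (1 - expi (- x) * z)) by ring.
apply: le_trans (le_normcD _ _) _.
have -> : 4 / (1 - r) * normc (w - z) =
  2 / (1 - r) * normc (w - z) + 2 / (1 - r) * normc (w - z) by ring.
exact: lerD.
Qed.

Lemma ccontinuous_log_kernel z : normc z < 1 -> ccontinuous (log_kernel z).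
Proof.
move=> z1.
have c1 : ccontinuous (@expi R) by split; [exact: continuous_cos|exact: continuous_sin].
have c2 : ccontinuous (fun x => expi (- x)).
  have := ccontinuous_conj c1; under eq_fun do rewrite -[_^*]/(_ +i* _) -cosN -sinN.
  by [].
apply: ccontinuousD; apply: ccontinuous_clog => [|x]; try by
  apply: Re_1B_gt0; rewrite normc_expi_mul.
- apply: ccontinuousB; first exact: ccontinuous_cst.
  by apply: ccontinuousM => //; exact: ccontinuous_cst.
- apply: ccontinuousB; first exact: ccontinuous_cst.
  by apply: ccontinuousM => //; exact: ccontinuous_cst.
Qed.

Lemma kernel_log_kernel s x : kernel (@kappa R) s x = s - log_kernel (cexp s) x.
Proof.
rewrite /kernel /kappa /log_kernel.
have -> : expi x * cexp s = cexp (s + (0 +i* x)) :> R[i] by rewrite cexpD cexp_imag mulrC.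
have -> : expi (- x) * cexp s = cexp (s - (0 +i* x)) :> R[i].
  rewrite cexpD mulrC -cexp_imag; congr (_ * cexp _).
  by apply: complexP; rewrite !ReImE/= ?oppr0.
by field.
Qed.

End local_uniform_convergence.

(** * Equivalence of the analytic and kernel conditions with convergence of the data *)

Section analytic_equivalences.
Variable R : realType.
Local Notation Re := (@complex.Re R).
Local Notation Im := (@complex.Im R).
Local Notation C := (Cplx R).
Local Notation seg := (@segment R).
Local Notation prob := (probability (measurableTypeR R) R).

Lemma is_F_log_kernel (A : R) (dk : prob) (F : C -> C) : dk seg = 1%E -> is_F A dk F ->
  forall z, normc z < 1 ->
  F z = z * cexp ((ln A)%:C - cexpect (integral_expect dk) (log_kernel z)).
Proof.
move=> dk1 HF z z1; have [->|z0] := eqVneq z 0; first by rewrite (F_0 dk1 HF) mul0r.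
have [s hs] := cexp_surj z0; rewrite -hs in z1 *.
have s0 : Re s < 0 by rewrite -expR_lt1 -normc_cexp.
rewrite (F_cexp dk1 HF)// -cexpD; congr cexp.
have HE := integral_expectation dk1.
have -> : s + ((ln A)%:C - cexpect (integral_expect dk) (log_kernel (cexp s))) =
  (ln A)%:C + (s - cexpect (integral_expect dk) (log_kernel (cexp s))) by ring.
rewrite /gmap; congr (_ + _).
rewrite -[X in X - _](cexpect_cst HE s) -(cexpectB HE).
- by congr cexpect; apply/funext => x; exact: kernel_log_kernel.
- exact: ccontinuous_cst.
- exact: ccontinuous_log_kernel.
Qed.

Lemma w_of_cexpect (A : R) (dk : prob) (z : C) :
  w_of A dk z = (ln A)%:C -
    cexpect (integral_expect dk) (fun x => cln_lower ((of_angle x)%:C - z)).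
Proof.
rewrite /w_of; congr (_ - _); apply: complexP.
- exact: (@eq_integral_angle _ dk (fun t => Re (cln_lower (t%:C - z)))).
- exact: (@eq_integral_angle _ dk (fun t => Im (cln_lower (t%:C - z)))).
Qed.

Lemma ccontinuous_cln_lower (z : C) : 0 < Im z ->
  ccontinuous (fun x => cln_lower ((of_angle x)%:C - z)).
Proof.
move=> z0.
have c (x : R) : Im ((of_angle x)%:C - z) < 0 by rewrite !ReImE/=; lra.
under eq_fun do rewrite cln_lower_clog//.
apply: ccontinuousD; last exact: ccontinuous_cst.
apply: ccontinuous_clog => [|x]; last by rewrite !ReImE/=; have := c x; rewrite !ReImE/=; lra.
apply: ccontinuousZ; apply: ccontinuousB; last exact: ccontinuous_cst.
by split => x; [exact: continuous_of_angle|exact: cvg_cst].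
Qed.

Lemma near_ge_sub1 (Fl : set_system nat) (FF : ProperFilter Fl) (x_ : nat -> R) (x : R) :
  x_ n @[n --> Fl] --> x -> \forall n \near Fl, x - 1 <= x_ n.
Proof.
move=> /cvgrPdist_le/(_ 1 ltr01) H; near=> n.
have : `|x - x_ n| <= 1 by near: n.
by rewrite ler_norml => /andP[? ?]; lra.
Unshelve. all: by end_near. Qed.

Variables (A_ : nat -> R) (dk_ : nat -> prob) (F_ : nat -> C -> C) (h_ : nat -> C -> R)
  (A : R) (dk : prob) (F : C -> C) (h : C -> R).
Hypotheses (D_ : forall n, calD (A_ n) (dk_ n)) (isF_ : forall n, is_F (A_ n) (dk_ n) (F_ n))
  (ish_ : forall n, is_h (F_ n @` @unit_disk R) (h_ n))
  (D : calD A dk) (isF : is_F A dk F) (ish : is_h (F @` @unit_disk R) h).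

Let E_ n := integral_expect (dk_ n).
Let E := integral_expect dk.
Let g_ n := gmap (ln (A_ n)) (E_ n).
Let g := gmap (ln A) E.

Let HE_ n : expectation (E_ n).
Proof. by apply: integral_expectation; case: (D_ n). Qed.

Let HE : expectation E.
Proof. by apply: integral_expectation; case: D. Qed.

Let G_ n : starlike_map (ln (A_ n)) (g_ n).
Proof. exact: gmap_starlike. Qed.

Let G : starlike_map (ln A) g.
Proof. exact: gmap_starlike. Qed.

Let FE_ n s : Re s < 0 -> F_ n (cexp s) = cexp (g_ n s).
Proof. by apply: (F_cexp _ (isF_ n)); case: (D_ n). Qed.

Let FE s : Re s < 0 -> F (cexp s) = cexp (g s).
Proof. by apply: (F_cexp _ isF); case: D. Qed.

Let dom_ n : F_ n @` @unit_disk R = sm_domain (g_ n).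
Proof. by apply: (F_image _ (isF_ n)); case: (D_ n). Qed.

Let dom : F @` @unit_disk R = sm_domain g.
Proof. by apply: (F_image _ isF); case: D. Qed.

Lemma Omega_lt1 (Omega : set C) (k : C -> R) : is_h Omega k ->
  forall z, Omega z -> normc z < 1.
Proof.
move=> [k01 _ _ ->] z [r [a [/andP[r0 r1] ->]]].
rewrite normcM normc_real normc_expi mulr1 ger0_norm//.
have /k01/andP[k0 _] : unit_circle (expi a : C).
  by rewrite /unit_circle/= Cplx_normE normc_expi.
lra.
Qed.

(* Every analytic condition is compared with the convergence of [ln A_n] and of
   the integrals of continuous functions of the angle. *)
Definition data_cvg := ln (A_ n) @[n --> \oo] --> ln A /\
  forall f : R -> R, continuous f -> E_ n f @[n --> \oo] --> E f.

Lemma data_cvg_weak : data_cvg <-> A_ n @[n --> \oo] --> A /\ weak_star_cvg dk_ dk.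
Proof.
have A0 : 0 < A by case: D.
have A_0 n : 0 < A_ n by case: (D_ n).
split=> -[h1 h2]; split.
- have -> : A_ = fun n => expR (ln (A_ n)) by apply/funext => n; rewrite lnK// posrE.
  by rewrite -[A]lnK ?posrE//; apply: continuous_cvg h1; exact: continuous_expR.
- move=> f cf; rewrite integral_of_angle.
  under eq_fun do rewrite integral_of_angle.
  by apply: h2; exact: continuous_segment_of_angle.
- by apply: continuous_cvg h1; exact: continuous_ln.
- by move=> f cf; apply: h2; exact: continuous_comp_angle.
Qed.

Let w_uniform : data_cvg -> forall z, 0 < Im z -> exists2 r : R, 0 < r & forall e : R, 0 < e ->
  \forall n \near \oo, forall w, normc (w - z) <= r ->
    normc (w_of (A_ n) (dk_ n) w - w_of A dk w) <= e.
Proof.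
move=> [h1 h2].
apply: (@equilipschitz_cvg R [set z | 0 < Im z]) => z z0; have {}z0 : 0 < Im z := z0.
(* On this disc imaginary parts stay above [m = Im z / 2] and distances below [m / 2], as
   [cln_lower_lipschitz] demands. *)
- exists (Im z / 8), (2 / (Im z / 2)); split; rewrite ?divr_gt0//.
    move=> w wz; have : `|Im (w - z)| <= Im z / 8 := le_trans (normr_Im _) wz.
    by rewrite !ReImE ler_norml /mkset => ?; lra.
  move=> w w' wz w'z.
  have e1 := le_trans (normr_Im _) wz; have e2 := le_trans (normr_Im _) w'z.
  have ww : normc (w' - w) <= Im z / 2 / 2.
    apply: le_trans (normc_dist z _ _) _; rewrite (normcBC z); lra.
  move: e1 e2; rewrite !ReImE !ler_norml => /andP[? ?] /andP[? ?].
  have key B (nu : prob) : expectation (integral_expect nu) ->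
      normc (w_of B nu w' - w_of B nu w) <= 2 / (Im z / 2) * normc (w' - w).
    move=> Hnu; rewrite !w_of_cexpect.
    set a := cexpect _ _; set b := cexpect _ _.
    have -> : (ln B)%:C - a - ((ln B)%:C - b) = b - a by ring.
    have ca : ccontinuous (fun x => cln_lower ((of_angle x)%:C - w')).
      by apply: ccontinuous_cln_lower; lra.
    have cb : ccontinuous (fun x => cln_lower ((of_angle x)%:C - w)).
      by apply: ccontinuous_cln_lower; lra.
    rewrite /a /b -(cexpectB Hnu)//; apply: (cexpect_le Hnu) => [|x _].
      exact: ccontinuousB.
    have e : (of_angle x)%:C - w - ((of_angle x)%:C - w') = w' - w by ring.
    apply: le_trans (@cln_lower_lipschitz R (Im z / 2) _ _ _ _ _ _) _; rewrite ?e ?divr_gt0//.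
      by rewrite !ReImE/=; lra.
    by rewrite !ReImE/=; lra.
  by split => [n|]; apply: key; [exact: HE_|exact: HE].
- move=> e e0; have e2 : 0 < e / 2 by rewrite divr_gt0.
  have cz := ccontinuous_cln_lower z0.
  near=> n; rewrite !w_of_cexpect.
  have d1 : `|ln A - ln (A_ n)| <= e / 2 by near: n; move/cvgrPdist_le: h1; exact.
  set f := fun x => cln_lower ((of_angle x)%:C - z).
  have d2 : normc (cexpect (E_ n) f - cexpect E f) <= e / 2.
    by near: n; exact: (@cexpect_cvg R \oo _ E_ E h2 f _ cz e2).
  have -> : (ln (A_ n))%:C - cexpect (integral_expect (dk_ n)) f - ((ln A)%:C - cexpect (integral_expect dk) f) =
    (ln (A_ n) - ln A)%:C - (cexpect (E_ n) f - cexpect E f).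
    by rewrite real_complexB /E_ /E; ring.
  apply: le_trans (normcB _ _) _; rewrite normc_real distrC; lra.
Unshelve. all: by end_near. Qed.

Lemma nbhs_closed_disk (z : C) (r : R) : 0 < r -> nbhs z [set w | normc (w - z) <= r].
Proof. by move=> r0; apply/nbhs_normc; exists r => // w; exact: ltW. Qed.

Lemma data_cvg_w : data_cvg -> cvg_locally_uniformly (@upper_half R)
  (fun n => w_of (A_ n) (dk_ n)) (w_of A dk).
Proof.
move=> H z z0; have [r r0 Hr] := w_uniform H z0.
exists [set w | normc (w - z) <= r]; first exact: nbhs_closed_disk.
apply: uniform_cvg_Cplx => e e0; near=> n => w [wz _].
by move: w wz; near: n; exact: Hr.
Unshelve. all: by end_near. Qed.

Lemma data_cvg_gamma : data_cvg -> cvg_locally_uniformly (@upper_half R)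
  (fun n => gamma_of (A_ n) (dk_ n)) (gamma_of A dk).
Proof.
move=> H z z0; have [r r0 Hr] := w_uniform H z0.
exists [set w | normc (w - z) <= r]; first exact: nbhs_closed_disk.
apply: uniform_cvg_real => e e0; near=> n => w [wz _].
have : normc (w_of (A_ n) (dk_ n) w - w_of A dk w) <= e.
  by move: w wz; near: n; exact: Hr.
rewrite /gamma_of -opprD normrN -ReN -ReD; exact: le_trans (normr_Re _).
Unshelve. all: by end_near. Qed.

(** Writing [F_n = zeta e^(H_n)] gives [F_n - F = F (e^(H_n - H) - 1)], and [|F| < 1]; so only the
    exponents have to converge locally uniformly. *)
Lemma data_cvg_F : data_cvg -> cvg_locally_uniformly (@unit_disk R) F_ F.
Proof.
move=> [h1 h2] z /unit_disk_normc z1.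
pose H_ n w := (ln (A_ n))%:C - cexpect (E_ n) (log_kernel w).
pose H w := (ln A)%:C - cexpect E (log_kernel w).
have HU : forall z : C, normc z < 1 -> exists2 r : R, 0 < r & forall e : R, 0 < e ->
    \forall n \near \oo, forall w, normc (w - z) <= r -> normc (H_ n w - H w) <= e.
  apply: (@equilipschitz_cvg R [set z | normc z < 1] H_ H) => /= {z1}z z1.
  - pose r := (1 - normc z) / 6; pose rho := normc z + r.
    have r0 : 0 < r by rewrite /r; lra.
    have rho1 : rho < 1 by rewrite /rho /r; lra.
    have in_rho w : normc (w - z) <= r -> normc w <= rho.
      move=> wz; have := lerB_normc w z; rewrite /rho; lra.
    exists r, (4 / (1 - rho)); split => //.
    + by rewrite divr_gt0// subr_gt0.
    + by move=> w /in_rho wr; exact: (le_lt_trans wr rho1).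
    move=> w w' wz w'z.
    have ww : normc (w' - w) <= (1 - rho) / 2.
      apply: le_trans (normc_dist z _ _) _; rewrite (normcBC z) /rho.
      rewrite /r in wz w'z *; lra.
    have wr := in_rho _ wz; have w'r := in_rho _ w'z.
    have key (l : R) (e : (R -> R) -> R) : expectation e ->
        normc (l%:C - cexpect e (log_kernel w') - (l%:C - cexpect e (log_kernel w)))
        <= 4 / (1 - rho) * normc (w' - w).
      move=> He.
      have -> : l%:C - cexpect e (log_kernel w') - (l%:C - cexpect e (log_kernel w)) =
        - (cexpect e (log_kernel w') - cexpect e (log_kernel w)) by ring.
      have ca : ccontinuous (log_kernel w').
        by apply: ccontinuous_log_kernel; exact: le_lt_trans rho1.
      have cb : ccontinuous (log_kernel w).
        by apply: ccontinuous_log_kernel; exact: le_lt_trans rho1.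
      rewrite normcN -(cexpectB He)//; apply: (cexpect_le He) => [|x _].
        exact: ccontinuousB.
      exact: log_kernel_lipschitz.
    by split => [n|]; exact: key.
  - move=> e e0; have e2 : 0 < e / 2 by rewrite divr_gt0.
    have cz := ccontinuous_log_kernel z1.
    near=> n.
    have d1 : `|ln A - ln (A_ n)| <= e / 2 by near: n; move/cvgrPdist_le: h1; exact.
    have d2 : normc (cexpect (E_ n) (log_kernel z) - cexpect E (log_kernel z)) <= e / 2.
      by near: n; exact: (@cexpect_cvg R \oo _ E_ E h2 _ _ cz e2).
    have Hz : H_ n z - H z = (ln (A_ n) - ln A)%:C -
        (cexpect (E_ n) (log_kernel z) - cexpect E (log_kernel z)).
      by rewrite /H_ /H real_complexB; ring.
    change (normc (H_ n z - H z : R[i]) <= e); rewrite Hz.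
    apply: le_trans (normcB _ _) _; rewrite normc_real distrC; lra.
have [r r0 Hr] := HU z z1.
pose q := Num.min r ((1 - normc z) / 2).
have q0 : 0 < q by rewrite lt_min r0 divr_gt0// subr_gt0.
exists [set w | normc (w - z) <= q]; first exact: nbhs_closed_disk.
apply: uniform_cvg_Cplx => e e0.
have K0 := expR_gt0 (1 : R).
have m0 : 0 < Num.min 1 (e / expR 1) by rewrite lt_min ltr01 divr_gt0.
near=> n => w [/= wz _]; move: wz; rewrite le_min => /andP[wr wz].
have w1 : normc w < 1 by have := lerB_normc w z; lra.
have : normc (H_ n w - H w) <= Num.min 1 (e / expR 1).
  by move: w wr {wz w1}; near: n; exact: Hr.
rewrite le_min => /andP[k1]; rewrite ler_pdivlMr// => k2.
have e1 : F_ n w = w * cexp (H_ n w).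
  by apply: (is_F_log_kernel _ (isF_ n)) => //; case: (D_ n).
have e3 : F w = w * cexp (H w) by apply: (is_F_log_kernel _ isF) => //; case: D.
have -> : F_ n w - F w = F w * (cexp (H_ n w - H w) - 1).
  have e4 : H_ n w = H w + (H_ n w - H w) by ring.
  by rewrite e1 e3 {1}e4 cexpD; ring.
have Fw : normc (F w) < 1.
  by apply: (Omega_lt1 ish); exists w => //; exact/unit_disk_normc.
rewrite normcM; apply: (@le_trans _ _ (1 * normc (cexp (H_ n w - H w) - 1))).
  by rewrite ler_wpM2r ?normc_ge0// ltW.
rewrite mul1r; apply: le_trans (cexp_taylor0 k1) _; by rewrite mulrC.
Unshelve. all: by end_near. Qed.

Let real_axis_data : (forall u : R, u < 0 ->
    Re (g_ n u%:C) @[n --> \oo] --> Re (g u%:C)) -> data_cvg.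
Proof. by move=> H; apply: expect_cvg. Qed.

(** The open upper half plane corresponds to the open strip [0 < Im s < pi], which misses the
    negative real axis where moments are read off. The vertical Lipschitz bound, common to all [n],
    bridges the gap. *)
Let upper_data : (forall s, Re s < 0 -> 0 < Im s < pi ->
    Re (g_ n s) @[n --> \oo] --> Re (g s)) -> data_cvg.
Proof.
move=> H; apply: real_axis_data => u u0.
apply/cvgrPdist_le => e e0; have e3 : 0 < e / 3 by rewrite divr_gt0.
have c0 := poisson_ub_gt0 u0.
pose t := Num.min 1 (e / 3 / poisson_ub u).
have t0 : 0 < t by rewrite lt_min ltr01 divr_gt0.
have t1 : t <= 1 by rewrite ge_min lexx.
have te : poisson_ub u * t <= e / 3 by rewrite mulrC -ler_pdivlMr// ge_min lexx orbT.
have near_axis l (k : R[i] -> R[i]) : starlike_map l k ->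
    `|Re (k (u +i* t)) - Re (k u%:C)| <= e / 3.
  move=> Hk; have := sm_lip_vertical Hk 0 t u0; rewrite subr0 gtr0_norm// => h1.
  rewrite -ReN -ReD; apply: le_trans (normr_Re _) _; exact: le_trans h1 te.
have p2 := pi_ge2 R.
have cs : Re (g_ n (u +i* t)) @[n --> \oo] --> Re (g (u +i* t)).
  by apply: H => //=; rewrite t0/=; lra.
near=> n.
have d1 := near_axis _ _ (G_ n); have d2 := near_axis _ _ G.
have d3 : `|Re (g (u +i* t)) - Re (g_ n (u +i* t))| <= e / 3.
  by near: n; move/cvgrPdist_le: cs; exact.
apply: le_trans (ler_distD (Re (g (u +i* t))) _ _) _.
have -> : e = e / 3 + (e / 3 + e / 3) by field.
rewrite lerD ?(distrC (Re (g u%:C)))//.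
by apply: le_trans (ler_distD (Re (g_ n (u +i* t))) _ _) _; exact: lerD.
Unshelve. all: by end_near. Qed.

Let joukowski_upper s : Re s < 0 -> 0 < Im s < pi -> upper_half (joukowski s : C).
Proof.
move=> s0 si; have sp : 0 < sin (Im s) by exact: sin_gt0_pi.
suff : 0 < Im (joukowski s) by [].
rewrite /joukowski -cexpN ImD !ImN !Im_cexp ReN ImN sinN.
have : expR (Re s) < expR (- Re s) by rewrite ltr_expR; lra.
nra.
Qed.

Let wg_ n s : Re s < 0 -> 0 < Im s < pi -> w_of (A_ n) (dk_ n) (joukowski s) = g_ n s.
Proof. by move=> s0 si; rewrite w_of_gmap//; case: (D_ n). Qed.

Let wg s : Re s < 0 -> 0 < Im s < pi -> w_of A dk (joukowski s) = g s.
Proof. by move=> s0 si; rewrite w_of_gmap//; case: D. Qed.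

Lemma w_data_cvg : cvg_locally_uniformly (@upper_half R)
  (fun n => w_of (A_ n) (dk_ n)) (w_of A dk) -> data_cvg.
Proof.
move=> H; apply: upper_data => s s0 si.
have := locally_uniformly_pointwise H (joukowski_upper s0 si); rewrite wg// => Hs.
apply/cvgrPdist_lt => e e0; have {}Hs := cvg_normc Hs e0.
near=> n; have : normc (w_of (A_ n) (dk_ n) (joukowski s) - g s) < e by near: n.
rewrite wg_// distrC -ReN -ReD; exact: le_lt_trans (normr_Re _).
Unshelve. all: by end_near. Qed.

Lemma gamma_data_cvg : cvg_locally_uniformly (@upper_half R)
  (fun n => gamma_of (A_ n) (dk_ n)) (gamma_of A dk) -> data_cvg.
Proof.
move=> H; apply: upper_data => s s0 si.
have Hs := locally_uniformly_pointwise H (joukowski_upper s0 si).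
have {}Hs : - gamma_of (A_ n) (dk_ n) (joukowski s) @[n --> \oo] -->
    - gamma_of A dk (joukowski s) by exact: cvgN.
rewrite /gamma_of wg// opprK in Hs.
by under eq_fun do rewrite -wg_// -[Re _]opprK; exact: Hs.
Qed.

Lemma F_data_cvg : cvg_locally_uniformly (@unit_disk R) F_ F -> data_cvg.
Proof.
move=> H; apply: real_axis_data => u u0.
have u0' : Re u%:C < 0 by [].
have Hu := locally_uniformly_pointwise H (unit_disk_cexp u0').
have nF : normc (F_ n (cexp u%:C)) @[n --> \oo] --> normc (F (cexp u%:C)).
  apply/cvgrPdist_lt => e e0; have {}Hu := cvg_normc Hu e0.
  near=> n; have h1 : normc (F_ n (cexp u%:C) - F (cexp u%:C)) < e by near: n.
  apply: le_lt_trans h1.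
  have := lerB_normc (F_ n (cexp u%:C)) (F (cexp u%:C)).
  have := lerB_normc (F (cexp u%:C)) (F_ n (cexp u%:C)).
  rewrite (normcBC (F _)) ler_norml; lra.
have -> : Re (g u%:C) = ln (normc (F (cexp u%:C))) by rewrite FE// normc_cexp expRK.
have -> : (fun n => Re (g_ n u%:C)) = (fun n => ln (normc (F_ n (cexp u%:C)))).
  by apply/funext => n; rewrite FE_// normc_cexp expRK.
apply: continuous_cvg nF; apply: continuous_ln.
by rewrite FE// normc_cexp expR_gt0.
Unshelve. all: by end_near. Qed.

Lemma data_cvg_kernel : data_cvg ->
  kernel_cvg (fun n => F_ n @` @unit_disk R) (F @` @unit_disk R).
Proof.
move=> [h1 h2].
have near_lA : \forall n \near \oo, ln A - 1 <= ln (A_ n).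
  exact: near_ge_sub1.
have gc s (e : R) : Re s < 0 -> 0 < e -> \forall n \near \oo, normc (g_ n s - g s) <= e.
  exact: gmap_cvg.
rewrite dom; split => z.
- move=> /(kernel_inside _ G_ G near_lA gc)[r r0 [N _ HN]].
  by exists r, N; split => // n Nn; rewrite dom_; exact: HN.
- move=> r zg r0; have [N _ HN] := kernel_outside _ G_ G gc zg r0.
  by exists N => n Nn; rewrite dom_; exact: HN.
Unshelve. all: by end_near. Qed.

(** Along an ultrafilter the bounded data have a limit, whose domain is the kernel of the [Omega_n]
    by the forward direction. Kernels being unique, this domain is [Omega], and [Omega] determines
    the data. *)
Lemma kernel_data_cvg :
  kernel_cvg (fun n => F_ n @` @unit_disk R) (F @` @unit_disk R) -> data_cvg.
Proof.
rewrite dom => -[Hin Hout].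
(* The image lies in the unit disc, so [Re g_n < 0] at [s = -1], while [sm_lower] bounds it below by
   [ln A_n - 1 - 2 ln 2]. *)
have upper n : ln (A_ n) <= 4.
  have s0 : Re (-1 : R[i]) < 0 by rewrite /=; lra.
  have := sm_lower (G_ n) s0.
  have : normc (F_ n (cexp (-1))) < 1.
    by apply: (Omega_lt1 (ish_ n)); exists (cexp (-1)) => //; exact: unit_disk_cexp.
  rewrite FE_// normc_cexp expR_lt1 /=; have := ln2_le1 R; lra.
have [r [N [r0 HN]]] : exists (r : R) N, 0 < r /\
    forall n, (N <= n)%N -> disk 0 r `<=` sm_domain (g_ n).
  have [|r [N [r0 HN]]] := Hin 0; first by left.
  by exists r, N; split => // n Nn; rewrite -dom_; exact: HN.
have lower n : (N <= n)%N -> ln (r / 2) - 4 <= ln (A_ n).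
  by move=> /HN /(sm_inradius (G_ n) r0); lra.
have key (U : set_system nat) : UltraFilter U -> \oo `<=` U ->
    ln (A_ n) @[n --> U] --> ln A /\
    forall f : R -> R, continuous f -> E_ n f @[n --> U] --> E f.
  move=> UU oU.
  have PU : ProperFilter U by exact: ultra_proper.
  have [E' HE' E'c] := ultra_expectation UU HE_.
  have [|lA' lA'c] := @ultra_limit R U UU (fun n => ln (A_ n)) (`|ln (r / 2)| + 4).
    apply: oU; exists N => // n Nn; rewrite /= ler_norml.
    have := upper n; have := lower n Nn.
    have := ler_norm (- ln (r / 2)); rewrite normrN.
    by have := normr_ge0 (ln (r / 2)); lra.
  pose g' := gmap lA' E'.
  have G' : starlike_map lA' g' by exact: gmap_starlike.
  have near_lA : \forall n \near U, lA' - 1 <= ln (A_ n).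
    exact: near_ge_sub1.
  have gc s (e : R) : Re s < 0 -> 0 < e -> \forall n \near U, normc (g_ n s - g' s) <= e.
    exact: gmap_cvg.
  (* A point in one domain only would have a disc eventually contained in the [Omega_n] by one
     kernel convergence, and eventually not contained by the other. *)
  have dom' : sm_domain g' = sm_domain g.
    apply/seteqP; split => z zg; apply: contrapT => nz.
    - have [q q0 Hq] := kernel_inside PU G_ G' near_lA gc zg.
      have [M HM] := Hout z q nz q0.
      have UM : U [set n | (M <= n)%N] by apply: oU; exists M.
      have [n [h1 h2]] := @filter_ex _ U _ _ (filterI Hq UM).
      by apply: (HM n h2); rewrite dom_.
    - have [q [M [q0 HM]]] := Hin z zg.
      have Hq := kernel_outside PU G_ G' gc nz q0.
      have UM : U [set n | (M <= n)%N] by apply: oU; exists M.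
      have [n [h1 h2]] := @filter_ex _ U _ _ (filterI Hq UM).
      by apply: h1; rewrite -dom_; exact: HM.
  have img : sm_image g' = sm_image g.
    apply/seteqP; split => y yg.
    - by apply: (sm_domain_cexp G); rewrite -dom'; right; exists y.
    - by apply: (sm_domain_cexp G'); rewrite dom'; right; exists y.
  have gg := sm_image_uniq G G' img.
  have ce u : u < 0 -> Re (g' u%:C) @[n --> \oo] --> Re (g u%:C).
    by move=> u0; rewrite gg//; exact: cvg_cst.
  (* Applied to constant sequences, the convergence statement becomes uniqueness: the limit data
     equal [ln A] and [E]. *)
  have [c1 c2] := @expect_cvg R (fun=> E') (fun=> lA') E (ln A) (fun=> HE') HE ce.
  have uniqR (a b : R) : (fun=> a : R) @ \oo --> b -> a = b.
    by move=> ab; exact: (cvg_unique (@Rhausdorff R) (@cvg_cst _ _ _ _ _) ab).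
  split; first by rewrite -(uniqR _ _ c1).
  by move=> f cf; rewrite -(uniqR _ _ (c2 f cf)); exact: E'c.
split; first by apply: cvg_ultra => U UU oU; have [] := key U UU oU.
by move=> f cf; apply: cvg_ultra => U UU oU; have [_] := key U UU oU; exact.
Unshelve. all: by end_near. Qed.

End analytic_equivalences.

(** * Radial functions and suprema *)

Section radial_functions.
Variable R : realType.
Local Notation C := (Cplx R).
Implicit Types (z w y : C) (h k phi : C -> R) (e d c r t a : R).
Local Notation circle := (@unit_circle R).

Lemma circleE z : circle z <-> normc z = 1.
Proof.
rewrite /unit_circle/= Cplx_normE; split => [|->//].
by move/(congr1 (@complex.Re R)).
Qed.

Lemma circle_expi z : circle z <-> exists2 a, 0 <= a <= 2 * pi & z = expi a.
Proof.
split => [/circleE z1|[a _ ->]]; last by apply/circleE; exact: normc_expi.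
have z0 : z != 0 by rewrite -normc_gt0 z1.
have [s hs] := cexp_surj z0.
have [j hj] := shift2pi 0 (complex.Im s).
exists (complex.Im s + j%:~R * (2 * pi)); first by rewrite add0r in hj.
rewrite (periodic_shift (p := 2 * pi)); last first.
  by move=> t; rewrite /expi mulrC mulr_natr cosD2pi sinD2pi.
rewrite -[LHS]hs /cexp.
have -> : expR (complex.Re s) = 1 by rewrite -normc_cexp hs.
by rewrite mul1r.
Qed.

Lemma polar_decomp z : exists2 y, circle y & z = (normc z)%:C * y.
Proof.
have [->|z0] := eqVneq z 0.
  by exists 1; [apply/circleE; rewrite normc1|rewrite normc0 mul0r].
exists (z / (normc z)%:C); last first.
  by rewrite mulrC divfK//; apply: contra z0 => /eqP/(congr1 (@complex.Re R))/= /eq0_normc ->.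
have n0 : 0 < normc z by rewrite normc_gt0.
by apply/circleE; rewrite normcM normcV normc_real ger0_norm ?ltW// divff// gt_eqF.
Qed.

Lemma circle_scal_inj r t y z : 0 < r -> 0 <= t -> circle y -> circle z ->
  r%:C * y = t%:C * z -> r = t /\ y = z.
Proof.
move=> r0 t0 /circleE y1 /circleE z1 e.
have rt : r = t.
  have := congr1 (@normc R) e.
  by rewrite !normcM !normc_real y1 z1 !mulr1 !ger0_norm// ltW.
split => //; move: e; rewrite -rt => /mulfI; apply.
by rewrite -normc_gt0 normc_real gtr0_norm.
Qed.

Lemma polar_near r z d : 0 < r -> circle z -> 0 < d -> exists2 q, 0 < q &
  forall w, normc (w - r%:C * z) < q ->
  exists t y, [/\ circle y, w = t%:C * y, 0 < t, `|t - r| < d & normc (y - z) < d].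
Proof.
move=> r0 /circleE z1 d0.
exists (Num.min (r / 2) (Num.min d (r * d / 4))).
  by rewrite !lt_min d0 !divr_gt0// mulr_gt0.
move=> w; rewrite !lt_min => /andP[w1 /andP[w2 w3]].
have nrz : normc (r%:C * z) = r by rewrite normcM normc_real z1 mulr1 gtr0_norm.
have [y cy ye] := polar_decomp w; have y1 := (circleE y).1 cy.
have h1 := lerB_normc w (r%:C * z); have h2 := lerB_normc (r%:C * z) w.
rewrite (normcBC _ w) !nrz in h1 h2.
have t0 : 0 < normc w by lra.
exists (normc w), y; split => //.
  by rewrite ltr_norml; apply/andP; split; lra.
have e : (normc w)%:C * (y - z) = (w - r%:C * z) + (r - normc w)%:C * z.
  by rewrite real_complexB {2}ye; ring.
have : normc w * normc (y - z) <= 2 * normc (w - r%:C * z).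
  have -> : normc w * normc (y - z) = normc ((normc w)%:C * (y - z)).
    by rewrite normcM normc_real gtr0_norm.
  rewrite e; apply: le_trans (le_normcD _ _) _.
  rewrite normcM normc_real z1 mulr1.
  have : `|r - normc w| <= normc (w - r%:C * z) by rewrite ler_norml; apply/andP; split; lra.
  lra.
rewrite ltNge => h; apply/negP => hd.
have : r / 2 * d <= normc w * normc (y - z) by apply: ler_pM => //; lra.
lra.
Qed.

Lemma Omega_of_scal h r z : 0 <= r -> circle z -> h z < 1 ->
  Omega_of h (r%:C * z) <-> r < 1 - h z.
Proof.
move=> r0 cz hz; have [a _ ze] := (circle_expi z).1 cz; split => [|h1].
- move=> [t [b [/andP[t0 tb] e]]].
  move: r0; rewrite le_eqVlt => /predU1P[<-|r0]; first by rewrite subr_gt0.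
  have cb : circle (expi b) by apply/circleE; exact: normc_expi.
  by have [-> ->] := circle_scal_inj r0 t0 cz cb e.
- by exists r, a; rewrite -ze r0.
Qed.

(** Compactness of the circle, transported from [[0, 2 pi]] by [expi], in a form that makes a local
    eventual property hold eventually all around the circle. *)
Lemma near_circle (I : Type) (Fl : set_system I) (FF : Filter Fl) (Q : I -> C -> Prop) :
  (forall z, circle z -> exists2 d, 0 < d &
     \forall i \near Fl, forall y, circle y -> normc (y - z) < d -> Q i y) ->
  \forall i \near Fl, forall y, circle y -> Q i y.
Proof.
move=> H.
have := (compact_near_coveringP _).1 (@segment_compact R 0 (2 * pi)) I Fl
  (fun i a => Q i (expi a)) FF.
move=> K; have {K} : \near Fl, `[0, 2 * pi] `<=` (fun a => Q Fl (expi a)).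
  apply: K => a _.
  have ca : circle (expi a) by apply/circle_expi/circle_expi/circleE; exact: normc_expi.
  have [d d0 Hd] := H _ ca.
  pose q := Num.min 1 (d / 2 / expR 1).
  have q0 : 0 < q by rewrite lt_min ltr01 !divr_gt0 ?expR_gt0.
  exists ([set b | `|a - b| < q],
      [set i | forall y, circle y -> normc (y - expi a) < d -> Q i y]).
    by split=> //=; apply: (@cvgr_dist_lt _ _ _ (nbhs a) _ id a) => //; exact: cvg_id.
  move=> [b i] [/= ab {}Hd].
  have cb : circle (expi b) by apply/circleE; exact: normc_expi.
  apply: (Hd _ cb).
  move: ab; rewrite lt_min ltr_pdivlMr ?expR_gt0// => /andP[ab1 ab2].
  rewrite -!cexp_imag; apply: le_lt_trans (cexp_dist _) _.
    have -> : (0 +i* b) - (0 +i* a) = 0 +i* (b - a) :> R[i].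
      by apply: complexP; rewrite !ReImE/= ?subrr.
    by rewrite normc_imag distrC ltW.
  have -> : (0 +i* b) - (0 +i* a) = 0 +i* (b - a) :> R[i].
    by apply: complexP; rewrite !ReImE/= ?subrr.
  by rewrite normc_imag normc_cexp/= expR0 mul1r distrC mulrC; lra.
apply: filterS => i Hi y /circle_expi[a a01 ->]; apply: Hi.
by rewrite /= in_itv.
Qed.

Lemma near_within_circle z (P : C -> Prop) :
  (\forall y \near within circle (nbhs z), P y) <->
  exists2 d, 0 < d & forall y, circle y -> normc (y - z) < d -> P y.
Proof.
split=> [/nbhs_normc[d d0 H]|[d d0 H]].
  by exists d => // y cy /H; exact.
by apply/nbhs_normc; exists d => // y yz cy; exact: H.
Qed.

(** A tent of height 1 and radius [d], the test function that localizes a supremum near [z]. *)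
Definition bump z d y : R := Num.max 0 (1 - normc (y - z) / d).

Lemma bump_ge0 z d y : 0 <= bump z d y.
Proof. by rewrite le_max lexx. Qed.

Lemma bump_le1 z d y : 0 < d -> bump z d y <= 1.
Proof. by move=> d0; rewrite ge_max ler01 gerBl divr_ge0 ?normc_ge0// ltW. Qed.

Lemma bump_center z d : bump z d z = 1.
Proof. by rewrite /bump subrr normc0 mul0r subr0 max_r// ler01. Qed.

Lemma bump_support z d y : 0 < d -> d <= normc (y - z) -> bump z d y = 0.
Proof. by move=> d0 dy; rewrite /bump max_l// subr_le0 ler_pdivlMr// mul1r. Qed.

Lemma continuous_bump z d : 0 < d -> continuous (bump z d : C -> R).
Proof.
move=> d0 y; apply/(@cvgrPdist_le _ _ _ (nbhs (y : C)) _) => e e0; apply/nbhs_normc.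
exists (e * d); first exact: mulr_gt0.
move=> w; rewrite -ltr_pdivrMr// => we /=.
have h1 : normc (w - z) / d - normc (y - z) / d <= normc (w - y) / d.
  rewrite -mulrBl ler_pM2r ?invr_gt0//.
  by have := normc_dist y w z; lra.
have h2 : normc (y - z) / d - normc (w - z) / d <= normc (w - y) / d.
  rewrite -mulrBl ler_pM2r ?invr_gt0//.
  by have := normc_dist w y z; rewrite (normcBC y w); lra.
rewrite /bump ler_norml.
by case: (leP 0 (1 - normc (y - z) / d)); case: (leP 0 (1 - normc (w - z) / d)); lra.
Qed.

Section weighted_sup.
Variables (phi k : C -> R).
Hypotheses (phi_cont : {within circle, continuous phi})
  (phi0 : forall z, circle z -> 0 <= phi z) (k01 : forall z, circle z -> 0 <= k z < 1).

Lemma circle_continuous z e : circle z -> 0 < e ->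
  exists2 d, 0 < d & forall y, circle y -> normc (y - z) < d -> `|phi z - phi y| < e.
Proof.
move=> cz e0; apply/near_within_circle.
have /cvgrPdist_lt/(_ e e0) := @phi_cont z.
by move=> H; have : within circle (nbhs z) (fun y => `|phi z - phi y| < e)
  by rewrite nbhs_subspace_in.
Qed.

Let weighted := [set phi z * k z | z in circle].

Let weighted_neq0 : weighted !=set0.
Proof. by exists (phi 1 * k 1), 1 => //; apply/circleE; rewrite normc1. Qed.

Lemma sup_weighted_le c : (forall z, circle z -> phi z * k z <= c) -> sup weighted <= c.
Proof. by move=> H; apply: ge_sup => // _ [z cz <-]; exact: H. Qed.

Lemma sup_weighted_gt c : c < sup weighted -> exists2 z, circle z & c < phi z * k z.
Proof.
move=> H; apply: contrapT => nH; move: H; apply/negP; rewrite -leNgt.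
apply: sup_weighted_le => z cz; rewrite leNgt; apply/negP => h.
by apply: nH; exists z.
Qed.

(** [sup] is a true upper bound only for a bounded set; the bound on [phi] comes from compactness of
    the circle. *)
Lemma le_sup_weighted z : circle z -> phi z * k z <= sup weighted.
Proof.
move=> cz; apply: ub_le_sup; last by exists z.
have [n Hn] : exists n : nat, forall y, circle y -> phi y <= n%:R.
  have : \forall n \near \oo, forall y, circle y -> phi y <= n%:R; last exact: filter_ex.
  apply: near_circle => y cy.
  have [d d0 Hd] := circle_continuous cy ltr01; exists d => //.
  near=> n => v cv /(Hd v cv); rewrite ltr_norml => /andP[h1 _].
  have : phi y + 1 <= n%:R by near: n; exact: nbhs_infty_ger.
  lra.
exists n%:R => _ [y cy <-].
have /andP[k0 k1] := k01 cy; have p0 := phi0 cy; have pn := Hn y cy.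
nra.
Unshelve. all: by end_near. Qed.

End weighted_sup.

(** * Kernel convergence and convergence of weighted suprema *)

Section kernel_sup.
Variables (h_ : nat -> C -> R) (h : C -> R).
Hypotheses (h_01 : forall n z, circle z -> 0 <= h_ n z < 1)
  (h01 : forall z, circle z -> 0 <= h z < 1) (h_usc : usc_on circle h).

(* Both [kernel_cvg] and [sup_cvg] say that [h_ n] converges to [h] in the sense
   of the following two local conditions. *)
Let upper_lim := forall z c, circle z -> h z < c -> exists2 d, 0 < d &
  \forall n \near \oo, forall y, circle y -> normc (y - z) < d -> h_ n y < c.

Let lower_lim := forall z c d, circle z -> c < h z -> 0 < d ->
  \forall n \near \oo, exists y, [/\ circle y, normc (y - z) < d & c < h_ n y].

Let h_usc_circle z c : circle z -> h z < c -> exists2 d, 0 < d &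
  forall y, circle y -> normc (y - z) < d -> h y < c.
Proof. by move=> cz zc; apply/near_within_circle; exact: h_usc. Qed.

(** An upper semicontinuous function below 1 on a compact set stays away from 1. This uniform gap is
    needed at the origin, whose neighbourhoods see all directions at once. *)
Let h_bound : exists2 c, c < 1 & forall z, circle z -> h z < c.
Proof.
have [n Hn] : exists n : nat, forall z, circle z -> h z < 1 - n.+1%:R^-1.
  have : \forall n \near \oo, forall z, circle z -> h z < 1 - n.+1%:R^-1; last exact: filter_ex.
  apply: near_circle => z cz.
  have /andP[_ z1] := h01 cz.
  have q0 : 0 < (1 - h z) / 2 by lra.
  have [d d0 Hd] := @h_usc_circle z ((1 + h z) / 2) cz ltac:(lra).
  exists d => //; near=> n => y cy /(Hd y cy) yc; apply: lt_le_trans yc _.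
  have : n.+1%:R^-1 < (1 - h z) / 2 by near: n; exact: (near_infty_natSinv_lt (PosNum q0)).
  by move: (n.+1%:R^-1) => ? ?; lra.
by exists (1 - n.+1%:R^-1) => //; rewrite ltrBlDr ltrDl invr_gt0.
Unshelve. all: by end_near. Qed.

Let circle1 : circle (1 : C).
Proof. by apply/circleE; rewrite normc1. Qed.

Let Omega_0 k : (forall z, circle z -> 0 <= k z < 1) -> Omega_of k 0.
Proof.
move=> k01; have /andP[_ k1] := k01 1 circle1.
have <- : (0 : R)%:C * (1 : C) = 0 by rewrite mul0r.
by apply/Omega_of_scal => //; rewrite subr_gt0.
Qed.

(** For [c <= 1] the inequality [h_n y < c] means that [(1 - c) y] lies in the domain of [h_n], so a
    disc about [(1 - c) z] gives it for all [y] near [z]. For [c > 1] there is nothing to prove. *)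
Let kernel_upper : kernel_cvg (fun n => Omega_of (h_ n)) (Omega_of h) -> upper_lim.
Proof.
move=> [Hin _] z c cz zc; have [c1|c1] := ltP 1 c.
  exists 1 => //; near=> n => y cy _; have /andP[_] := h_01 n cy; lra.
have /andP[_ z1] := h01 cz.
have [|d [N [d0 HN]]] := Hin ((1 - c)%:C * z).
  by apply/Omega_of_scal => //; lra.
exists d => //; near=> n => y cy yz.
have /andP[y0 y1] := h_01 n cy.
have Nn : (N <= n)%N by near: n; exact: nbhs_infty_ge.
have : Omega_of (h_ n) ((1 - c)%:C * y).
  apply: HN Nn _ _; apply/disk_normc; rewrite -mulrBr normcM normc_real.
  have c0 : 0 <= 1 - c by lra.
  have /andP[z0 _] := h01 cz.
  rewrite ger0_norm//; have := normc_ge0 (y - z); nra.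
by move/(Omega_of_scal _ cy y1); lra.
Unshelve. all: by end_near. Qed.

(** The point [(1 - h z) z] is outside the domain of [h]. If [h_n <= c] held at all directions near
    [z], the domain of [h_n] would contain every radius below [1 - c] there, hence a fixed disc
    about that point. *)
Let kernel_lower : kernel_cvg (fun n => Omega_of (h_ n)) (Omega_of h) -> lower_lim.
Proof.
move=> [_ Hout] z c d cz zc d0; have /andP[z0 z1] := h01 cz.
have r0 : 0 < 1 - h z by lra.
pose m := Num.min d (h z - c).
have m0 : 0 < m by rewrite lt_min d0 subr_gt0.
have [q q0 Hq] := polar_near r0 cz m0.
have [|N HN] := Hout ((1 - h z)%:C * z) q _ q0.
  by move/(Omega_of_scal (ltW r0) cz z1); rewrite ltxx.
exists N => // n Nn; apply: contrapT => nH; apply: (HN n Nn) => w /disk_normc/Hq.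
move=> [t [y [cy -> t0]]]; rewrite !lt_min => /andP[_ t2] /andP[y1 _].
have /andP[yn0 yn1] := h_01 n cy.
apply/(Omega_of_scal (ltW t0) cy yn1).
have : h_ n y <= c.
  by rewrite leNgt; apply/negP => yc; apply: nH; exists y.
by move: t2; rewrite ltr_norml => /andP[_]; lra.
Qed.

Let limits_kernel : upper_lim -> lower_lim ->
  kernel_cvg (fun n => Omega_of (h_ n)) (Omega_of h).
Proof.
move=> up lo; split => z.
- have [y cy ze] := polar_decomp z; rewrite ze => zO.
  have /andP[y0 y1] := h01 cy.
  have {zO} := (Omega_of_scal (normc_ge0 z) cy y1).1 zO.
  have := normc_ge0 z; rewrite le_eqVlt => /predU1P[<- _|].
    have [c c1 hc] := h_bound.
    have [N _ HN] : \forall n \near \oo, forall y, circle y -> h_ n y < c.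
      by apply: near_circle => v cv; exact: up (hc v cv).
    exists (1 - c), N; split; first by rewrite subr_gt0.
    move=> n Nn w /disk_normc; rewrite mul0r subr0 => wc.
    have [v cv we] := polar_decomp w; rewrite we.
    have /andP[_ v1] := h_01 n cv.
    by apply/(Omega_of_scal (normc_ge0 _) cv v1); have := HN n Nn v cv; lra.
  move=> z0 zy; pose c := (h y + (1 - normc z)) / 2.
  have [|d d0 [N _ HN]] := up y c cy; first by rewrite /c; lra.
  pose m := Num.min d (1 - c - normc z).
  have m0 : 0 < m by rewrite lt_min d0 /c; lra.
  have [q q0 Hq] := polar_near z0 cy m0.
  exists q, N; split => // n Nn w /disk_normc/Hq[t [v [cv -> t0]]].
  rewrite !lt_min => /andP[_ t2] /andP[v1 _].
  have /andP[_ vn] := h_01 n cv.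
  apply/(Omega_of_scal (ltW t0) cv vn).
  by have := HN n Nn v cv v1; move: t2; rewrite ltr_norml => /andP[_]; lra.
- move=> r zO r0; have [y cy ze] := polar_decomp z; rewrite ze in zO *.
  have /andP[y0 y1] := h01 cy.
  have z0 : 0 < normc z.
    rewrite lt_def normc_ge0 andbT; apply/eqP => nz; apply: zO.
    by rewrite nz mul0r; exact: Omega_0.
  have zy : 1 - h y <= normc z.
    by rewrite leNgt; apply/negP => zy; apply: zO; apply/(Omega_of_scal (ltW z0) cy y1).
  (* The budget [r] is split evenly: the turn from [y] to [v] costs less than [r / 2] at radius
     [|z|], and the passage to radius [t], outside the domain of [h_n], costs less than [r / 2]. *)
  have [||N _ HN] := lo y (1 - normc z - r / 2) (r / 2 / normc z) cy.
  + lra.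
  + by rewrite !divr_gt0.
  exists N => n Nn sub.
  have [v [cv]] := HN n Nn; rewrite ltr_pdivlMr// => vy vn.
  have /andP[_ v1] := h_01 n cv.
  pose t := Num.max (normc z) (1 - h_ n v).
  have tz : normc z <= t by rewrite le_max lexx.
  have tv : 1 - h_ n v <= t by rewrite le_max lexx orbT.
  have tr : t < normc z + r / 2 by rewrite gt_max; lra.
  have : Omega_of (h_ n) (t%:C * v).
    apply: sub; apply/disk_normc.
    have -> : t%:C * v - (normc z)%:C * y = (t - normc z)%:C * v + (normc z)%:C * (v - y).
      by rewrite real_complexB; ring.
    apply: le_lt_trans (le_normcD _ _) _; rewrite !normcM !normc_real.
    have v1' := (circleE v).1 cv.
    rewrite v1' (ger0_norm (normc_ge0 z)) ger0_norm; last by lra.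
    lra.
  by move/(Omega_of_scal (le_trans (normc_ge0 z) tz) cv v1); lra.
Qed.

(** The upper estimate needs every direction and comes from compactness; the lower one follows a
    single near-maximizer [z], near which some [h_n y] is almost [h z]. *)
Let limits_sup : upper_lim -> lower_lim -> sup_cvg h_ h.
Proof.
move=> up lo phi cphi phi0; apply/cvgrPdist_le => e e0.
set M := sup [set phi z * h z | z in circle].
have U : \forall n \near \oo, forall z, circle z -> phi z * h_ n z <= M + e.
  apply: near_circle => z cz.
  have /andP[z0 z1] := h01 cz; have p0 := phi0 z cz.
  have hM : phi z * h z <= M by exact: le_sup_weighted.
  pose q := e / 2 / (phi z + 1).
  have p1 : 0 < phi z + 1 by lra.
  have q0 : 0 < q by rewrite !divr_gt0.
  have qe : q * (phi z + 1) = e / 2 by rewrite /q divfK// gt_eqF.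
  pose c := h z + q; have zc : h z < c by rewrite /c; lra.
  have [d d0 Hd] := up z c cz zc.
  have e2 : 0 < e / 2 / c by rewrite !divr_gt0//; lra.
  have [d' d'0 Hd'] := circle_continuous cphi cz e2.
  exists (Num.min d d'); first by rewrite lt_min d0.
  apply: filterS Hd => n Hd y cy; rewrite lt_min => /andP[/(Hd y cy) yc /(Hd' y cy)].
  rewrite ltr_pdivlMr; last by lra.
  have /andP[yn _] := h_01 n cy; have py := phi0 y cy.
  have h1 : phi y * h_ n y <= phi y * c by rewrite ler_wpM2l// ltW.
  have h2 : (phi y - phi z) * c <= `|phi z - phi y| * c.
    by rewrite ler_wpM2r ?ler_distl//; [lra|rewrite distrC ler_norm].
  have h3 : phi z * c = phi z * h z + (e / 2 - q) by rewrite /c -qe; ring.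
  lra.
have L : \forall n \near \oo, exists2 z, circle z & M - e <= phi z * h_ n z.
  have [z cz Mz] : exists2 z, circle z & M - e / 2 < phi z * h z.
    by apply: sup_weighted_gt; rewrite -/M; lra.
  have /andP[z0 z1] := h01 cz; have p0 := phi0 z cz.
  have p1 : 0 < phi z + 1 by lra.
  pose q := e / 4 / (phi z + 1).
  have q0 : 0 < q by rewrite !divr_gt0.
  have qe : q * (phi z + 1) = e / 4 by rewrite /q divfK// gt_eqF.
  (* The strict inequality [c < h z] may force [c] below 0; keeping [|c| <= 1] lets the oscillation
     of [phi] control that of [phi * c]. *)
  have [c [c0 c1 cM]] : exists c, [/\ c < h z, `|c| <= 1 & M - 3 * e / 4 < phi z * c].
    have [zq|zq] := leP q (h z + 1).
      exists (h z - q); split; first by lra.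
        by rewrite ler_norml; apply/andP; split; lra.
      have : phi z * (h z - q) = phi z * h z - (e / 4 - q) by rewrite -qe; ring.
      lra.
    exists (-1); split; [lra|by rewrite normrN1|].
    have : 0 <= phi z * (h z + 1 - 0) by rewrite mulr_ge0//; lra.
    have : phi z * (h z + 1) <= phi z * q by rewrite ler_wpM2l// ltW.
    lra.
  have e4 : 0 < e / 4 by rewrite divr_gt0.
  have [d d0 Hd] := circle_continuous cphi cz e4.
  apply: filterS (lo z c d cz c0 d0) => n [y [cy yz cy']].
  exists y => //; have := Hd y cy yz.
  have py := phi0 y cy.
  have h1 : phi y * c <= phi y * h_ n y by rewrite ler_wpM2l// ltW.
  have h2 : (phi z - phi y) * c <= `|phi z - phi y| * 1.
    by apply: le_trans (ler_norm _) _; rewrite normrM ler_wpM2l.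
  lra.
near=> n.
have U' : forall z, circle z -> phi z * h_ n z <= M + e by near: n.
have [z cz zL] : exists2 z, circle z & M - e <= phi z * h_ n z by near: n.
have h1 := sup_weighted_le U'.
have h2 := le_sup_weighted cphi phi0 (h_01 n) cz.
by rewrite ler_norml; apply/andP; split; lra.
Unshelve. all: by end_near. Qed.

Let cbump z d : 0 < d -> {within circle, continuous (bump z d : C -> R)}.
Proof. by move=> d0; apply: continuous_subspaceT; exact: continuous_bump. Qed.

(** The levels [c1 < c2 < c] divide the gap above [h z] in three. A bump supported where [h < c1]
    has weighted supremum at most [c1], hence below [c2] for [h_n]; where the bump is at least
    [c2 / c] this prevents [h_n y >= c]. *)
Let sup_upper : sup_cvg h_ h -> upper_lim.
Proof.
move=> H z c cz zc; have /andP[z0 z1] := h01 cz.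
pose c1 := (2 * h z + c) / 3; pose c2 := (h z + 2 * c) / 3.
have [|d d0 Hd] := @h_usc_circle z c1 cz; first by rewrite /c1; lra.
have bump0 y (_ : circle y) := bump_ge0 z d y.
have /cvgrPdist_lt/(_ (c2 - c1)) := H _ (@cbump z d d0) bump0.
have Mc : sup [set bump z d y * h y | y in circle] <= c1.
  apply: sup_weighted_le => y cy; have /andP[y0 y1] := h01 cy.
  have b1 := bump_le1 z y d0; have b0 := bump_ge0 z d y.
  have [yd|yd] := ltP (normc (y - z)) d.
    have := Hd y cy yd; nra.
  by rewrite bump_support// mul0r /c1; lra.
move=> Hn; have {}Hn := Hn ltac:(rewrite /c1 /c2; lra).
have q0 : 0 < (1 - c2 / c) * d.
  by rewrite mulr_gt0// subr_gt0 ltr_pdivrMr /c2; lra.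
exists ((1 - c2 / c) * d) => //; apply: filterS Hn => n.
rewrite ltr_norml => /andP[h1 _] y cy.
rewrite -ltr_pdivrMr// => yd; have /andP[y0 y1] := h_01 n cy.
have h2 := le_sup_weighted (@cbump z d d0) bump0 (h_01 n) cy.
have cc : 0 < c by lra.
have h3 : c2 / c <= bump z d y by rewrite le_max; apply/orP; right; lra.
rewrite ltNge; apply/negP => cy'.
have : c2 / c * c <= bump z d y * h_ n y.
  by apply: ler_pM => //; [apply: divr_ge0; rewrite /c2; lra|lra].
by rewrite divfK ?gt_eqF//; lra.
Qed.

(** For [c >= 0] a weighted value above [c] can only occur in the support of the bump, which locates
    [y]. For [c < 0] that argument fails, but [z] itself serves. *)
Let sup_lower : sup_cvg h_ h -> lower_lim.
Proof.
move=> H z c d cz zc d0; have [c0|c0] := ltP c 0.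
  near=> n; exists z; split => //; first by rewrite subrr normc0.
  by have /andP[] := h_01 n cz; lra.
have bump0 y (_ : circle y) := bump_ge0 z d y.
have /cvgrPdist_lt/(_ (h z - c)) := H _ (@cbump z d d0) bump0.
have := le_sup_weighted (@cbump z d d0) bump0 h01 cz; rewrite bump_center mul1r => zM.
rewrite subr_gt0 => /(_ zc); apply: filterS => n; rewrite ltr_norml => /andP[_ h1].
have [|y cy yc] := @sup_weighted_gt (bump z d) (h_ n) c; first by lra.
have /andP[y0 y1] := h_01 n cy.
have b1 := bump_le1 z y d0; have b0 := bump_ge0 z d y.
exists y; split => //; last by nra.
rewrite ltNge; apply/negP => yd; move: yc.
by rewrite bump_support// mul0r; lra.
Unshelve. all: by end_near. Qed.

Lemma kernel_sup_cvg :
  kernel_cvg (fun n => Omega_of (h_ n)) (Omega_of h) <-> sup_cvg h_ h.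
Proof.
split=> H; first exact: limits_sup (kernel_upper H) (kernel_lower H).
exact: limits_kernel (sup_upper H) (sup_lower H).
Qed.

End kernel_sup.

End radial_functions.

Theorem theorem4p1 (R : realType)
    (A_ : nat -> R) (dk_ : nat -> probability (measurableTypeR R) R)
    (F_ : nat -> Cplx R -> Cplx R) (h_ : nat -> Cplx R -> R)
    (A : R) (dk : probability (measurableTypeR R) R)
    (F : Cplx R -> Cplx R) (h : Cplx R -> R)
    (D_ : forall n, calD (A_ n) (dk_ n))
    (isF_ : forall n, is_F (A_ n) (dk_ n) (F_ n))
    (ish_ : forall n, is_h (F_ n @` @unit_disk R) (h_ n))
    (D : calD A dk)
    (isF : is_F A dk F)
    (ish : is_h (F @` @unit_disk R) h) :
  [<-> A_ n @[n --> \oo] --> A /\ weak_star_cvg dk_ dk;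
       cvg_locally_uniformly (@upper_half R)
         (fun n => w_of (A_ n) (dk_ n)) (w_of A dk);
       cvg_locally_uniformly (@upper_half R)
         (fun n => gamma_of (A_ n) (dk_ n)) (gamma_of A dk);
       cvg_locally_uniformly (@unit_disk R) F_ F;
       kernel_cvg (fun n => F_ n @` @unit_disk R) (F @` @unit_disk R);
       sup_cvg h_ h].
Proof.
have ef : kernel_cvg (fun n => F_ n @` @unit_disk R) (F @` @unit_disk R) <->
    sup_cvg h_ h.
  have [h01 h_usc _ ->] := ish.
  have -> : (fun n => F_ n @` @unit_disk R) = (fun n => Omega_of (h_ n)).
    by apply/funext => n; have [_ _ _ ->] := ish_ n.
  by apply: kernel_sup_cvg => // n; have [] := ish_ n.
(* Each arrow of the cycle factors through [data_cvg], except the one from (e) to (f), which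
   concerns only the functions [h_n] and [h]. *)
tfae.
- by move/(data_cvg_weak D_ D); exact: data_cvg_w.
- by move/(w_data_cvg D_ D); exact: data_cvg_gamma.
- by move/(gamma_data_cvg D_ D); exact: (data_cvg_F D_ isF_ D isF ish).
- by move/(F_data_cvg D_ isF_ D isF); exact: data_cvg_kernel.
- by move/ef.
- by move/ef/(kernel_data_cvg D_ isF_ ish_ D isF)/(data_cvg_weak D_ D).
Qed.
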